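(* Assume that $P^\mu$ is stationary and ergodic under space-time shifts. If $P^\mu$ is cone-mixing, then there exists a $v\in\mathbb{R}$ such that $$\lim_{t\to\infty} X_t/t = v \qquad \mathbb{P}_{\mu,0}\text{-a.s.}$$
   Context: Environment. Let $\Omega=\{0,1\}^{\mathbb{Z}}$ and let $D_\Omega[0,\infty)$ be the set of càdlàg functions on $[0,\infty)$ with values in $\Omega$. Let $\xi=(\xi_t)_{t\ge 0}$, $\xi_t=\{\xi_t(x):x\in\mathbb{Z}\}$, be an interacting particle system, i.e. a Markov process with state space $\Omega$, paths in $D_\Omega[0,\infty)$ and a Markov semigroup on $C(\Omega)$ (constructed as in Liggett's book ''Interacting Particle Systems'', Chapter I). $P^\eta$ denotes the law of $\xi$ started from $\xi_0=\eta$, and for a probability measure $\mu$ on $\Omega$, $P^\mu(\cdot)=\int_\Omega P^\eta(\cdot)\,\mu(\mathrm{d}\eta)$. (In particular, if $P^\mu$ is stationary, $\mu$ is an equilibrium for $\xi$.) Random walk. Fix $0<\beta<\alpha<\infty$. Conditional on $\xi$, $X=(X_t)_{t\ge0}$ is the continuous-time random walk on $\mathbb{Z}$ with $X_0=0$ which, when at $x$ at time $t$, jumps $x\to x+1$ at rate $\alpha\,\xi_t(x)+\beta\,[1-\xi_t(x)]$ and $x\to x-1$ at rate $\beta\,\xi_t(x)+\alpha\,[1-\xi_t(x)]$. Its conditional (quenched) law is $P_0^\xi$, and the annealed law is $\mathbb{P}_{\mu,0}(\cdot)=\int_{D_\Omega[0,\infty)}P_0^\xi(\cdot)\,P^\mu(\mathrm{d}\xi)$.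 Cone-mixing. Let $(\cdot,\cdot)$ and $\|\cdot\|$ be the Euclidean inner product and norm on $\mathbb{R}^2$, and $\ell=(0,1)$. For $\theta\in(0,\tfrac12\pi)$ and $t\ge0$ let $$C_t^\theta=\{u\in\mathbb{Z}\times[0,\infty):(u-t\ell,\ell)\ge\|u-t\ell\|\cos\theta\},$$ where a point $(x,s)\in\mathbb{Z}\times[0,\infty)$ has space coordinate $x$ and time coordinate $s$. Let $\mathcal{F}_0=\sigma\{\xi_0(x):x\in\mathbb{Z}\}$ and $\mathcal{F}_t^\theta=\sigma\{\xi_s(x):(x,s)\in C_t^\theta\}$. A measure $P^\mu$ that is stationary and ergodic under space-time shifts is called cone-mixing if for all $\theta\in(0,\tfrac12\pi)$ $$\lim_{t\to\infty}\ \sup_{A\in\mathcal{F}_0,\ B\in\mathcal{F}_t^\theta,\ P^\mu(A)>0}\big|P^\mu(B\mid A)-P^\mu(B)\big|=0.$$ *)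

(* Defs.v *)
From HB Require Import structures.
From mathcomp Require Import all_boot all_order all_algebra.
From mathcomp Require Import all_classical all_reals all_analysis.

Set Implicit Arguments.
Unset Strict Implicit.
Unset Printing Implicit Defensive.

Import Order.TTheory GRing.Theory Num.Theory.
Import numFieldNormedType.Exports.

Local Open Scope classical_set_scope.
Local Open Scope ring_scope.

Section cadlag_paths.
Context {R : realType} {T : ptopologicalType}.

Definition cadlag (w : R -> T) := forall t : R, 0 <= t ->
  (w s @[s --> t^'+] --> w t) /\
  (0 < t -> exists l : T, w s @[s --> t^'-] --> l).

Lemma cadlag_cst (a : T) : cadlag (fun=> a).
Proof.
by move=> t _; split=> [|_]; [exact: cvg_cst | exists a; exact: cvg_cst].
Qed.

End cadlag_paths.

(* The space D_T[0,oo).  Paths are functions on R that are only constrained on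
   [0,oo); the sigma-algebra below is generated by the evaluations at times
   t >= 0, hence no event depends on the values at negative times. For the
   metrizable separable T used here it is the Skorokhod Borel sigma-algebra. *)
Record cadlag_path (R : realType) (T : ptopologicalType) := Path {
  path_fun :> R -> T ;
  cadlag_pathP : cadlag path_fun }.

HB.instance Definition _ R T := gen_eqMixin (cadlag_path R T).
HB.instance Definition _ R T := gen_choiceMixin (cadlag_path R T).
HB.instance Definition _ R T :=
  isPointed.Build (cadlag_path R T) (Path (@cadlag_cst R T point)).

Section path_sigma_algebra.
Context {R : realType} {T : ptopologicalType}.

(* sigma(w_s : s in I), T carrying its Borel sigma-algebra *)
Definition path_events (I : set R) : set (set (cadlag_path R T)) :=
  <<s [set A | exists s (U : set T),
         [/\ I s, open U & A = [set w : cadlag_path R T | U (w s)]] ] >>.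

Let path_measurable := path_events [set t | 0 <= t].

Let path_measurable0 : path_measurable set0.
Proof. exact: sigma_algebra0. Qed.

Let path_measurableC (A : set (cadlag_path R T)) :
  path_measurable A -> path_measurable (~` A).
Proof. exact: sigma_algebraC. Qed.

Let path_measurableU (F : (set (cadlag_path R T))^nat) :
  (forall i, path_measurable (F i)) -> path_measurable (\bigcup_i F i).
Proof. exact: sigma_algebra_bigcup. Qed.

Definition path_display : measure_display.
Proof. by constructor. Qed.

HB.instance Definition _ := @isMeasurable.Build path_display (cadlag_path R T)
  path_measurable path_measurable0 path_measurableC path_measurableU.

Lemma cadlag_shift (g : T -> T) (s : R) (w : cadlag_path R T) :
  continuous g -> 0 <= s -> cadlag (fun t => g (w (t + s))).
Proof.
move=> cg s0 t t0; have ts0 : 0 <= t + s by rewrite addr_ge0.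
have [wr wl] := @cadlag_pathP _ _ w (t + s) ts0.
have shr : (u + s) @[u --> t^'+] --> (t + s)^'+.
  move=> A [e /= e0 He]; exists e => //= u /= ut tu.
  by apply: He => /=; rewrite ?ltrD2r// opprD addrACA subrr addr0.
have shl : (u + s) @[u --> t^'-] --> (t + s)^'-.
  move=> A [e /= e0 He]; exists e => //= u /= ut tu.
  by apply: He => /=; rewrite ?ltrD2r// opprD addrACA subrr addr0.
split=> [|tgt0].
  apply: (@cvg_comp _ _ _ (fun u => w (u + s)) g _ (nbhs (w (t + s)))).
    exact: (@cvg_comp _ _ _ (fun u => u + s) w _ (t + s)^'+).
  exact: cg.
have [l wlim] := wl (ltr_wpDr s0 tgt0).
exists (g l).
apply: (@cvg_comp _ _ _ (fun u => w (u + s)) g _ (nbhs l)).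
  exact: (@cvg_comp _ _ _ (fun u => u + s) w _ (t + s)^'-).
exact: cg.
Qed.

End path_sigma_algebra.
Arguments path_events {R} T I.

Section mixture.
Context d d' (X : measurableType d) (Y : measurableType d') (R : realType).
Variables (mu : probability X R) (k : R.-pker X ~> Y).
Local Open Scope ereal_scope.

Definition mixture (A : set Y) : \bar R := \int[mu]_x k x A.

Let mixture0 : mixture set0 = 0.
Proof.
by rewrite /mixture (eq_integral (cst 0)) ?integral0// => y _; rewrite measure0.
Qed.

Let mixture_ge0 A : 0 <= mixture A. Proof. exact: integral_ge0. Qed.

Let mixture_sigma_additive : semi_sigma_additive mixture.
Proof.
move=> U mU tU mUU; rewrite [X in _ --> X](_ : _ =
  \int[mu]_y (\sum_(n <oo) k y (U n))); last first.
  apply: eq_integral => V _.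
  by apply/esym/cvg_lim => //; exact/measure_semi_sigma_additive.
apply/cvg_closeP; split.
  by apply: is_cvg_nneseries => n _ _; exact: integral_ge0.
rewrite closeE// integral_nneseries// => n.
exact: measurable_kernel k _ (mU n).
Qed.

HB.instance Definition _ := isMeasure.Build _ _ R
  mixture mixture0 mixture_ge0 mixture_sigma_additive.

Let mixture_setT : mixture setT = 1.
Proof.
rewrite /mixture (eq_integral (cst 1)) => [|x _]; last exact: prob_kernel.
by rewrite integral_cst// mul1e; exact: probability_setT.
Qed.

HB.instance Definition _ :=
  Measure_isProbability.Build _ _ _ mixture mixture_setT.

End mixture.

(* Omega = {0,1}^Z with the product topology and its Borel sigma-algebra *)
Definition config : Type := {ptws int -> bool}.

HB.instance Definition _ := Topological.copy config {ptws int -> bool}.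
HB.instance Definition _ := Pointed.copy config (int -> bool).

Section config_measurable.
Let config_measurable : set (set config) := <<s open >>.

Let config_measurable0 : config_measurable set0.
Proof. exact: sigma_algebra0. Qed.

Let config_measurableC (A : set config) :
  config_measurable A -> config_measurable (~` A).
Proof. exact: sigma_algebraC. Qed.

Let config_measurableU (F : (set config)^nat) :
  (forall i, config_measurable (F i)) -> config_measurable (\bigcup_i F i).
Proof. exact: sigma_algebra_bigcup. Qed.

Definition config_display : measure_display.
Proof. by constructor. Qed.

HB.instance Definition _ := @isMeasurable.Build config_display config
  config_measurable config_measurable0 config_measurableC config_measurableU.

End config_measurable.

Definition space_shift (z : int) (eta : config) : config :=
  fun x => eta (x + z).

Lemma continuous_space_shift z : continuous (space_shift z).
Proof.
move=> eta.
have /= := @pointwise_cvgP (discrete_topology int) bool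
  (space_shift z @ nbhs eta) (space_shift z eta) _.
case=> _; apply => x.
exact: (@proj_continuous int (fun=> bool) (x + z) eta).
Qed.

Section environment.
Context {R : realType}.

Definition time_shift (s : {nonneg R}) (w : cadlag_path R config) : cadlag_path R config :=
  Path (cadlag_shift w (fun eta : config => @cvg_id _ _) (ge0 s)).

Definition space_time_shift (z : int) (s : {nonneg R}) (w : cadlag_path R config)
    : cadlag_path R config :=
  Path (cadlag_shift w (@continuous_space_shift z) (ge0 s)).

(* P eta is the law P^eta.  Measurability of eta |-> P^eta(A) is part of the
   kernel structure; the last field says that the semigroup
   S(t)f(eta) = E^eta[f(xi_t)] maps C(Omega) to itself. *)
Record interacting_particle_system (P : R.-pker config ~> cadlag_path R config)
    : Prop := {
  ips_start : forall eta : config,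
    P eta [set w : cadlag_path R config | w 0 = eta] = 1%E ;
  ips_markov : forall (eta : config) (s : {nonneg R})
      (G A : set (cadlag_path R config)),
    path_events config [set r | 0 <= r <= s%:num] G -> measurable A ->
    (P eta (G `&` time_shift s @^-1` A) = \int[P eta]_(w in G) P (w s%:num) A)%E ;
  ips_feller : forall f : config -> R, continuous f ->
    forall t : R, 0 <= t ->
      continuous (fun eta : config => \int[P eta]_w f (w t) : R) }.

Definition stationary (Pmu : probability (cadlag_path R config) R) :=
  forall z s A, measurable A -> Pmu (space_time_shift z s @^-1` A) = Pmu A.

Definition ergodic (Pmu : probability (cadlag_path R config) R) :=
  forall A, measurable A ->
    (forall z s, space_time_shift z s @^-1` A = A) ->
    Pmu A = 0%E \/ Pmu A = 1%E.

Definition inner2 (u v : R * R) : R := u.1 * v.1 + u.2 * v.2.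
Definition norm2 (u : R * R) : R := Num.sqrt (inner2 u u).
Definition ell : R * R := (0, 1).

(* (x, s) stands for the site x at time s *)
Definition cone (theta t : R) : set (int * R) :=
  [set p | 0 <= p.2 /\
     let u : R * R := (p.1%:~R - t * ell.1, p.2 - t * ell.2) in
     inner2 u ell >= norm2 u * cos theta].

(* sigma(xi_s(x) : (x, s) in S) *)
Definition site_events (S : set (int * R)) : set (set (cadlag_path R config)) :=
  <<s [set A | exists x s (b : bool),
         S (x, s) /\ A = [set w : cadlag_path R config | w s x = b] ] >>.

Definition cond_prob (Pmu : probability (cadlag_path R config) R) B A : R :=
  fine (Pmu (B `&` A)) / fine (Pmu A).

Definition cone_dependence (Pmu : probability (cadlag_path R config) R)
    (theta t : R) : \bar R :=
  ereal_sup [set e | exists A B,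
    [/\ site_events [set p | p.2 = 0] A, site_events (cone theta t) B,
        (0 < Pmu A)%E
      & e = (`|cond_prob Pmu B A - fine (Pmu B)|)%:E] ].

Definition cone_mixing (Pmu : probability (cadlag_path R config) R) :=
  forall theta : R, 0 < theta < pi / 2 ->
    cone_dependence Pmu theta t @[t --> +oo] --> 0%E.

End environment.

Definition Zdiscr : Type := discrete_topology int.

HB.instance Definition _ := DiscreteTopology.copy Zdiscr (discrete_topology int).
HB.instance Definition _ := isPointed.Build Zdiscr (0 : int).

Section random_walk.
Context {R : realType}.

Definition first_jump (t u : R) (x y : int) : set (cadlag_path R Zdiscr) :=
  [set X | exists r : R, [/\ t < r <= u,
     forall s, t <= s < r -> X s = x & X r = y] ].

(* Law of the nearest-neighbour walk started at x0 which, when at x at time s,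
   jumps to y at rate q s x y: given the past up to time t and X_t = x, the
   first jump after t happens at time s and leads to y with density
     q s x y * exp (- \int_t^s (total jump rate at x at time r) dr).
   Summing over y gives the law of the holding time, hence no separate clause
   for the probability of not jumping in (t, u]. *)
Definition jump_law (q : R -> int -> int -> R) (x0 : int)
    (Q : {measure set (cadlag_path R Zdiscr) -> \bar R}) :=
  Q [set X : cadlag_path R Zdiscr | X 0 = x0] = 1%E /\
  forall (t u : R) (x y : int) (G : set (cadlag_path R Zdiscr)),
    0 <= t <= u -> y != x -> path_events Zdiscr [set r | 0 <= r <= t] G ->
    let H := G `&` [set X : cadlag_path R Zdiscr | X t = x] in
    let total r := q r x (x + 1) + q r x (x - 1) in
    Q (H `&` first_jump t u x y) =
    (Q H * (\int[lebesgue_measure]_(s in `[t, u])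
        (q s x y *
         expR (- (\int[lebesgue_measure]_(r in `[t, s]) total r))))%R%:E)%E.

Definition rwre_rate (alpha beta : R) (xi : cadlag_path R config) (t : R) (x y : int)
    : R :=
  if y == x + 1 then alpha * (xi t x)%:R + beta * (1 - (xi t x)%:R)
  else if y == x - 1 then beta * (xi t x)%:R + alpha * (1 - (xi t x)%:R)
  else 0.

(* Q xi is the quenched law P_0^xi; measurability in xi is part of the kernel. *)
Definition quenched_walk (alpha beta : R)
    (Q : R.-pker cadlag_path R config ~> cadlag_path R Zdiscr) :=
  forall xi, jump_law (rwre_rate alpha beta xi) 0 (Q xi).

End random_walk.

(* Main.v *)
Require Import Defs.
From HB Require Import structures.
From mathcomp Require Import all_boot all_order all_algebra.
From mathcomp Require Import all_classical all_reals all_analysis.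
From mathcomp Require Import measurable_realfun ring lra zify.
Set Implicit Arguments.
Unset Strict Implicit.
Unset Printing Implicit Defensive.
Import Order.TTheory GRing.Theory Num.Theory.
Import numFieldNormedType.Exports.
Local Open Scope classical_set_scope.
Local Open Scope ring_scope.

(* The total jump rate lam = alpha + beta does not depend on the environment.
   Hence, whatever the past and the environment, the walk does not move during
   a time interval of length 2L with probability exp (- 2 lam L); afterwards it
   sits well inside a wide cone whose apex lies L time units after the last use
   of the environment.  By the Markov property and cone mixing, the walk then
   starts afresh up to a small error, so that the mean displacement over a long
   time, given any past, differs from its annealed mean by at most a small
   multiple of the time (mean_drift_defect).  Exponential moments over successive
   time blocks turn this into exponential concentration, and Borel-Cantelli gives
   the law of large numbers.

   The estimates are proved, uniformly in N, for a nearest-neighbour walk on the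
   time grid Z / (N + 1), which differs from the quenched walk by O(1 / N) per
   unit of time; then N tends to infinity. *)

(** A fresh start succeeds only with the small probability [p] of standing still through the gap, so
    a single attempt would leave an error proportional to the time. After a failure the same
    estimate is applied to the remaining time. This recursion closes with a fixed error [2 q l / p]
    plus a small multiple of the time, and blocks are taken so long that the fixed part is
    negligible. The past enters without conditional expectations, through integration against all
    [0,1]-valued functions of the environment up to a grid time. Multiplying by transition
    probabilities of the walk stays in this class, so all means are taken under the law of the
    environment alone. Cone mixing conditions on the configuration at time 0 only; stationarity and
    the Markov property extend it to the whole past. The velocity found on a grid depends on N, and
    the discretisation error is small only for a fixed time block. Hence velocities of different
    grids are compared through a common path, and N tends to infinity in each block before the
    blocks are summed. *)

Section exponential_bounds.
Context {R : realType}.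
Implicit Types u z s : R.

Lemma expR_le_quadratic u : expR u <= 1 + u + 4 * u ^+ 2 * expR `|u|.
Proof.
have eu0 : 0 < expR u by exact: expR_gt0.
have e1 : 1 <= expR `|u| by rewrite -expR0 ler_expR.
have u2 : 0 <= u ^+ 2 by exact: sqr_ge0.
have [ule|uge] := lerP `|u| 2^-1.
  have : 1 - u <= expR (- u) by exact: expR_ge1Dx.
  rewrite expRN => h.
  have hu : u <= 2^-1 by exact: le_trans (ler_norm _) ule.
  have : (1 - u) * expR u <= 1.
    by rewrite -ler_pdivlMr// div1r.
  move=> h1.
  suff : expR u <= 1 + u + 4 * u ^+ 2 by nra.
  rewrite -(ler_pM2l (_ : 0 < 1 - u)); last lra.
  apply: le_trans h1 _.
  have -> : (1 - u) * (1 + u + 4 * u ^+ 2) = 1 + u ^+ 2 * (3 - 4 * u) by ring.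
  by nra.
have u4 : 1 <= 4 * u ^+ 2.
  by rewrite -(real_normK (num_real u)) !expr2; nra.
have eule : expR u <= expR `|u| by rewrite ler_expR ler_norm.
have [u1|u1] := lerP (-1) u; first by nra.
have : expR u <= 1 by rewrite -[leRHS]expR0 ler_expR; lra.
by nra.
Qed.

Lemma sqr_le_expR z : z ^+ 2 <= 4 * expR `|z|.
Proof.
have h : 1 + `|z| / 2 <= expR (`|z| / 2) by exact: expR_ge1Dx.
have -> : `|z| = `|z| / 2 + `|z| / 2 by rewrite -splitr.
rewrite expRD -(real_normK (num_real z)).
by have := normr_ge0 z; nra.
Qed.

(** Expands an exponential moment to second order in [s], with a remainder whose mean under the grid
    walk is bounded by [walk_exp] at [c = 2]. The 16 is the 4 of [expR_le_quadratic] times the 4 of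
    [sqr_le_expR]. *)
Lemma expRM_le_quadratic s z : `|s| <= 1 ->
  expR (s * z) <= 1 + s * z + 16 * s ^+ 2 * expR (2 * `|z|).
Proof.
move=> s1; apply: le_trans (expR_le_quadratic _) _.
rewrite lerD2l exprMn.
have h1 : expR `|s * z| <= expR `|z|.
  by rewrite ler_expR normrM; have := normr_ge0 z; nra.
have -> : expR (2 * `|z|) = expR `|z| * expR `|z|.
  by rewrite -expRD; congr expR; ring.
have h2 := sqr_le_expR z; have h3 := expR_gt0 `|z|.
have h4 := sqr_ge0 s; have h5 := sqr_ge0 z.
have : s ^+ 2 * z ^+ 2 * expR `|s * z| <= s ^+ 2 * (4 * expR `|z|) * expR `|z|.
  apply: ler_pM; [exact: mulr_ge0|exact: expR_ge0|by rewrite ler_wpM2l|exact: h1].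
by nra.
Qed.

(** Serves to bound the probability of standing still for many grid steps from below, uniformly in
    the mesh. *)
Lemma onem_ge_expR z : 0 <= z <= 2^-1 -> expR (- (2 * z)) <= 1 - z.
Proof.
move=> /andP[z0 z1]; have h : 1 + 2 * z <= expR (2 * z) by exact: expR_ge1Dx.
have e0 := expR_gt0 (2 * z).
have : expR (2 * z) * expR (- (2 * z)) = 1 by rewrite -expRD subrr expR0.
have := expR_gt0 (- (2 * z)).
by nra.
Qed.

End exponential_bounds.

(** * The walk on a time grid, for a fixed environment *)

Section grid_walk.
Context {R : realType}.

(* [g i x] is the probability that the walk [S] goes from [x] to [x + 1] during
   the [i]-th grid interval; it moves with total probability [q].  Starting from
   [x] at step [i], [walk i n phi x] is the mean of [phi S_(i + n)], [drift i n x]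
   the mean displacement after [n] steps, [cone_drift W i n x] the same for the
   walk stopped when it leaves [|y| <= W j], and [confined A i n x] the
   probability that [S_j] is in [A j] for all [i <= j <= i + n]. *)
Variables (q : R) (g : nat -> int -> R).

Definition step i (phi : int -> R) x :=
  g i x * phi (x + 1) + (q - g i x) * phi (x - 1) + (1 - q) * phi x.

Fixpoint walk i n (phi : int -> R) x :=
  if n is n'.+1 then step i (walk i.+1 n' phi) x else phi x.

Definition local_drift i x := g i x - (q - g i x).

Fixpoint drift i n x :=
  if n is n'.+1 then local_drift i x + step i (drift i.+1 n') x else 0.

Fixpoint cone_drift (W : nat -> R) i n x :=
  if n is n'.+1 then
    if `|x%:~R| <= W i then
      local_drift i x + step i (cone_drift W i.+1 n') x
    else 0
  else 0.

Fixpoint confined (A : nat -> set int) i n x : R :=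
  if `[< A i x >] then
    (if n is n'.+1 then step i (confined A i.+1 n') x else 1)
  else 0.

Lemma step_cst i c x : step i (fun=> c) x = c.
Proof. by rewrite /step; ring. Qed.

Lemma eq_step i phi psi x : phi =1 psi -> step i phi x = step i psi x.
Proof. by move=> e; rewrite /step !e. Qed.

Lemma stepD i a phi psi x :
  step i (fun y => a * phi y + psi y) x = a * step i phi x + step i psi x.
Proof. by rewrite /step; ring. Qed.

Lemma stepB i phi psi x :
  step i (fun y => phi y - psi y) x = step i phi x - step i psi x.
Proof. by rewrite /step; ring. Qed.

Lemma eq_walk i n phi psi x : phi =1 psi -> walk i n phi x = walk i n psi x.
Proof.
by move=> e; elim: n i x => [|n IH] i x /=; [exact: e|apply: eq_step].
Qed.

Lemma walkD i n a phi psi x :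
  walk i n (fun y => a * phi y + psi y) x = a * walk i n phi x + walk i n psi x.
Proof.
elim: n i x => [//|n IH] i x /=.
by rewrite -stepD; apply: eq_step.
Qed.

Lemma walk_cst i n c x : walk i n (fun=> c) x = c.
Proof.
elim: n i x => [//|n IH] i x /=.
by rewrite (eq_step _ (psi := fun=> c)) ?step_cst.
Qed.

Lemma walkZ i n a phi x : walk i n (fun y => a * phi y) x = a * walk i n phi x.
Proof.
have := walkD i n a phi (fun=> 0) x; rewrite walk_cst addr0 => <-.
by apply: eq_walk => y; rewrite addr0.
Qed.

Lemma walk_cat i n k phi x :
  walk i (n + k) phi x = walk i n (walk (i + n) k phi) x.
Proof.
elim: n i x => [|n IH] i x /=; first by rewrite addn0.
by apply: eq_step => y; rewrite IH addSnnS.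
Qed.

Lemma drift_cat i n k x :
  drift i (n + k) x = drift i n x + walk i n (drift (i + n) k) x.
Proof.
elim: n i x => [|n IH] i x /=; first by rewrite add0r addn0.
rewrite -[RHS]addrA; congr (_ + _).
rewrite (eq_step _
  (psi := fun y => 1 * drift i.+1 n y + walk i.+1 n (drift (i + n.+1) k) y)).
  by rewrite stepD mul1r.
by move=> y; rewrite IH mul1r addSnnS.
Qed.

(** Telescoping: each step changes the mean position by [local_drift]. *)
Lemma drift_walk i n x : drift i n x = walk i n (fun y => y%:~R) x - x%:~R.
Proof.
elim: n i x => [|n IH] i x /=; first by rewrite subrr.
rewrite (eq_step _ (psi := fun y => (-1) * y%:~R + walk i.+1 n intr y)); last first.
  by move=> y; rewrite IH; ring.
rewrite stepD {1}/step /local_drift !intrD; ring.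
Qed.

Lemma confined_cat A i n k x : (forall j y, (i <= j < i + n)%N -> A j y) ->
  confined A i (n + k) x = walk i n (confined A (i + n) k) x.
Proof.
elim: n i x => [|n IH] i x hA; first by rewrite addn0.
rewrite addSn [LHS]/=; case: ifPn => [_|/asboolPn]; last first.
  by case; apply: hA; rewrite leqnn/= addnS ltnS leq_addr.
apply: eq_step => y; rewrite IH ?addSnnS// => j z /andP[ij ji].
by apply: hA; rewrite (ltnW ij).
Qed.

Hypothesis q01 : 0 <= q <= 1.
Hypothesis gq : forall i x, 0 <= g i x <= q.

Lemma le_step i phi psi x : (forall y, phi y <= psi y) ->
  step i phi x <= step i psi x.
Proof.
move=> h; have /andP[? ?] := gq i x; have /andP[? ?] := q01.
by rewrite /step !lerD// ler_wpM2l// subr_ge0.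
Qed.

Lemma le_walk i n phi psi x : (forall y, phi y <= psi y) ->
  walk i n phi x <= walk i n psi x.
Proof.
by move=> h; elim: n i x => [|n IH] i x //=; exact: le_step.
Qed.

Lemma normr_local_drift i x : `|local_drift i x| <= q.
Proof.
by have := gq i x; rewrite /local_drift ler_norml => /andP[? ?]; lra.
Qed.

Lemma normr_step_le i phi c x : (forall y, `|phi y| <= c) ->
  `|step i phi x| <= c.
Proof.
move=> h; rewrite ler_norml; apply/andP; split.
  rewrite -[leLHS](step_cst i (- c) x); apply: le_step => y.
  by have := h y; rewrite ler_norml => /andP[].
rewrite -[leRHS](step_cst i c x); apply: le_step => y.
by have := h y; rewrite ler_norml => /andP[].
Qed.

Lemma normr_drift i n x : `|drift i n x| <= q * n%:R.
Proof.
elim: n i x => [|n IH] i x /=; first by rewrite normr0 mulr0.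
rewrite -natr1 mulrDr mulr1 [leRHS]addrC.
apply: le_trans (ler_normD _ _) _; apply: lerD.
  exact: normr_local_drift.
exact: normr_step_le.
Qed.

Lemma normr_cone_drift W i n x : `|cone_drift W i n x| <= q * n%:R.
Proof.
have /andP[q0 q1] := q01.
elim: n i x => [|n IH] i x /=; first by rewrite normr0 mulr0.
case: ifPn => _; last by rewrite normr0 mulr_ge0.
rewrite -natr1 mulrDr mulr1 [leRHS]addrC.
apply: le_trans (ler_normD _ _) _; apply: lerD.
  exact: normr_local_drift.
exact: normr_step_le.
Qed.

(** A move has probability [q] and increases the distance to [a] by at most 1, so the exponential
    grows on average by at most the factor 1 + q (e^c - 1). *)
Lemma step_exp i (c a : R) x : 0 <= c ->
  step i (fun y => expR (c * `|y%:~R - a|)) x <=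
  expR (c * `|x%:~R - a| + q * (expR c - 1)).
Proof.
move=> c0; have /andP[g0 gle] := gq i x; have /andP[q0 q1] := q01.
rewrite expRD; set E := expR (c * `|x%:~R - a|).
have E0 : 0 < E by exact: expR_gt0.
have moved (y : int) : `|y%:~R - x%:~R| <= 1 :> R ->
    expR (c * `|y%:~R - a|) <= E * expR c.
  move=> yx; rewrite -expRD ler_expR.
  have h : `|y%:~R - a| <= `|x%:~R - a| + 1.
    have -> : y%:~R - a = (y%:~R - x%:~R) + (x%:~R - a) by ring.
    by apply: le_trans (ler_normD _ _) _; lra.
  by have := ler_wpM2l c0 h; lra.
have hp : expR (c * `|(x + 1)%:~R - a|) <= E * expR c.
  by apply: moved; rewrite intrD addrAC subrr add0r normr1.
have hm : expR (c * `|(x - 1)%:~R - a|) <= E * expR c.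
  by apply: moved; rewrite intrB addrAC subrr add0r normrN normr1.
have h1 : 1 + q * (expR c - 1) <= expR (q * (expR c - 1)) by exact: expR_ge1Dx.
have : step i (fun y => expR (c * `|y%:~R - a|)) x <=
    g i x * (E * expR c) + (q - g i x) * (E * expR c) + (1 - q) * E.
  by rewrite /step; apply: lerD => //; apply: lerD; apply: ler_wpM2l; lra.
move=> /le_trans; apply.
have -> : g i x * (E * expR c) + (q - g i x) * (E * expR c) + (1 - q) * E =
  E * (1 + q * (expR c - 1)) by ring.
by rewrite ler_pM2l.
Qed.

Lemma walk_exp i n (c a : R) x : 0 <= c ->
  walk i n (fun y => expR (c * `|y%:~R - a|)) x <=
  expR (c * `|x%:~R - a| + q * (expR c - 1) * n%:R).
Proof.
move=> c0; elim: n i x => [|n IH] i x /=; first by rewrite mulr0 addr0.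
apply: le_trans (le_step _ _ _) _; first exact: IH.
set k := q * _ * _.
rewrite (eq_step _
  (psi := fun y => expR k * expR (c * `|y%:~R - a|) + 0)); last first.
  by move=> y; rewrite expRD addr0 mulrC.
rewrite stepD step_cst addr0.
have -> : c * `|x%:~R - a| + q * (expR c - 1) * n.+1%:R =
  k + (c * `|x%:~R - a| + q * (expR c - 1)) by rewrite /k -natr1; ring.
by rewrite [leRHS]expRD ler_pM2l ?expR_gt0// step_exp.
Qed.

(** The exponential is expanded around the starting point: the linear term yields the drift, and the
    remainder is averaged by [walk_exp] with [c = 2] and [a = x]. *)
Lemma walk_expM i n (s : R) x : `|s| <= 1 ->
  walk i n (fun y => expR (s * y%:~R)) x <=
  expR (s * x%:~R) *
  (1 + s * drift i n x + s ^+ 2 * (16 * expR (q * (expR 2 - 1) * n%:R))).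
Proof.
move=> s1.
pose psi (y : int) := expR (s * x%:~R) *
  (s * y%:~R + ((16 * s ^+ 2) * expR (2 * `|y%:~R - x%:~R|) + (1 - s * x%:~R))).
have hpsi y : expR (s * y%:~R) <= psi y.
  have -> : s * y%:~R = s * x%:~R + s * (y%:~R - x%:~R) by ring.
  rewrite expRD ler_pM2l ?expR_gt0//.
  by apply: le_trans (expRM_le_quadratic _ s1) _; lra.
apply: le_trans (le_walk _ _ _ hpsi) _.
rewrite walkZ ler_pM2l ?expR_gt0// walkD walkD walk_cst drift_walk.
have := walk_exp i n x%:~R x (ler0n R 2).
rewrite subrr normr0 mulr0 add0r => h.
have := ler_wpM2l (_ : 0 <= 16 * s ^+ 2) h; rewrite mulr_ge0 ?sqr_ge0//.
by move=> /(_ isT); lra.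
Qed.

(** The two drifts differ only after an exit from the cone, and then by at most [q] per remaining
    step. The exponential of |y| - W_j exceeds 1 at an exit and is a supermartingale, because the
    boundary recedes by at least q (e - 1) per step; its initial value therefore bounds the exit
    probability. *)
Lemma drift_cone_drift W i n x :
  (forall j, (i <= j)%N -> W j + q * (expR 1 - 1) <= W j.+1) ->
  `|drift i n x - cone_drift W i n x| <= q * n%:R * expR (`|x%:~R| - W i).
Proof.
have /andP[q0 q1] := q01.
elim: n i x => [|n IH] i x hW; first by rewrite /= subrr normr0 mulr0 mul0r.
rewrite [cone_drift _ _ _ _]/=; case: ifPn => [xW|]; last first.
  rewrite -ltNge => xW; rewrite subr0; apply: le_trans (normr_drift _ _ _) _.
  by rewrite ler_peMr ?mulr_ge0// -[leLHS]expR0 ler_expR subr_ge0 ltW//.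
rewrite [drift _ _ _]/= opprD addrACA subrr add0r.
rewrite -stepB.
have : `|step i (fun y => drift i.+1 n y - cone_drift W i.+1 n y) x| <=
    step i (fun y => (q * n%:R * expR (- W i.+1)) * expR (1 * `|y%:~R - 0|) + 0) x.
  have hb y : `|drift i.+1 n y - cone_drift W i.+1 n y| <=
      (q * n%:R * expR (- W i.+1)) * expR (1 * `|y%:~R - 0|) + 0.
    rewrite mul1r subr0 addr0 -mulrA -expRD [- _ + _]addrC.
    by apply: IH => j ij; apply: hW; exact: ltnW.
  rewrite ler_norml; apply/andP; split.
    rewrite lerNl -mulN1r.
    have -> : -1 * step i (fun y => drift i.+1 n y - cone_drift W i.+1 n y) x =
        step i (fun y => - (drift i.+1 n y - cone_drift W i.+1 n y)) x.
      by rewrite /step; ring.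
    by apply: le_step => y; apply: le_trans (hb y); rewrite -normrN ler_norm.
  by apply: le_step => y; apply: le_trans (hb y); rewrite ler_norm.
move=> /le_trans; apply.
rewrite stepD step_cst addr0.
apply: le_trans (ler_wpM2l _ (step_exp _ _ _ _)) _ => //.
  by rewrite !mulr_ge0 ?expR_ge0.
have -> : q * n.+1%:R = q * n%:R + q by rewrite -natr1; ring.
rewrite mul1r subr0 -[leLHS]mulrA -expRD [leRHS]mulrDl.
apply: ler_wpDr; first by rewrite mulr_ge0 ?expR_ge0.
apply: ler_wpM2l; first by rewrite mulr_ge0.
by rewrite ler_expR; have := hW i (leqnn _); lra.
Qed.

Lemma confined_ge0 A i n x : 0 <= confined A i n x.
Proof.
elim: n i x => [|n IH] i x /=; case: ifPn => // _.
by rewrite -(step_cst i 0 x); apply: le_step.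
Qed.

Lemma confined_le1 A i n x : confined A i n x <= 1.
Proof.
elim: n i x => [|n IH] i x /=; case: ifPn => // _.
by rewrite -[leRHS](step_cst i 1 x); apply: le_step.
Qed.

(** The same exponential argument in a fixed window: the growth q (e - 1) per step is now paid for
    by the number of remaining steps instead of a receding boundary. *)
Lemma confined_window A i n x (c K : R) :
  (forall j, (i <= j <= i + n)%N -> A j = [set y | `|y%:~R - c| <= K]) ->
  1 - expR (`|x%:~R - c| - K + q * (expR 1 - 1) * n%:R) <= confined A i n x.
Proof.
have /andP[q0 q1] := q01.
have e1 : 1 <= expR 1 :> R by rewrite -[leLHS]expR0 ler_expR.
elim: n i x => [|n IH] i x hA /=; rewrite hA ?leqnn ?leq_addr//.
  rewrite mulr0 addr0; case: asboolP => [/= h|/= /negP h].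
    by rewrite lerBlDr lerDl expR_ge0.
  by rewrite subr_le0 -[leLHS]expR0 ler_expR subr_ge0; apply/ltW; rewrite ltNge.
case: asboolP => [/= h|/= /negP h]; last first.
  rewrite subr_le0 -[leLHS]expR0 ler_expR addr_ge0// ?mulr_ge0 ?subr_ge0//.
  by apply/ltW; rewrite ltNge.
have {}IH y := IH i.+1 y.
have : step i (fun y => 1 - expR (`|y%:~R - c| - K + q * (expR 1 - 1) * n%:R)) x
    <= step i (confined A i.+1 n) x.
  apply: le_step => y; apply: IH => j /andP[ij ji].
  by apply: hA; rewrite (ltnW ij)/= -addSnnS.
apply: le_trans.
rewrite (eq_step _
  (psi := fun y => (- expR (- K + q * (expR 1 - 1) * n%:R)) *
    expR (1 * `|y%:~R - c|) + 1)); last first.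
  by move=> y; rewrite mul1r mulNr -expRD addrC; congr (- expR _ + _); ring.
rewrite stepD step_cst addrC lerD2r mulNr lerN2.
apply: le_trans (ler_wpM2l (expR_ge0 _) (step_exp i c x ler01)) _.
by rewrite mul1r -expRD ler_expR -natr1; lra.
Qed.

End grid_walk.

(** * Right-continuous paths *)

Section right_constant.
Context {R : realType}.

(** What right continuity amounts to for values in a discrete space. *)
Definition right_constant {A : Type} (f : R -> A) :=
  forall t, 0 <= t -> exists2 e, 0 < e & forall s, t <= s < t + e -> f s = f t.

Lemma grid_cover (a h s : R) n : 0 < h -> a < s <= a + h ->
  exists k : 'I_n.+1,
    a + h * k%:R / n.+1%:R < s <= a + h * k.+1%:R / n.+1%:R.
Proof.
move=> h0 /andP[sa sh].
pose P k := s <= a + h * k%:R / n.+1%:R.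
have Pn : P n.+1 by rewrite /P mulfK ?pnatr_eq0.
have exP : exists k, P k by exists n.+1.
case: (ex_minnP exP) => -[|k] Pk minP.
  by move: Pk; rewrite /P mulr0 mul0r addr0; lra.
have kn : (k < n.+1)%N by apply: minP.
exists (Ordinal kn) => /=; apply/andP; split; last exact: Pk.
rewrite ltNge.
by apply/negP => /minP; rewrite ltnn.
Qed.

Variables (f : R -> bool) (a h : R).
Hypotheses (a0 : 0 <= a) (h0 : 0 < h) (fr : right_constant f).

Let node n k : R := a + h * k%:R / n.+1%:R.

Let ler_node n k l : (k <= l)%N -> node n k <= node n l.
Proof.
move=> kl; rewrite /node lerD2l ler_pM2r ?invr_gt0// ler_pM2l//.
by rewrite ler_nat.
Qed.

(** Riemann sums that read [f] at finitely many times. Through them, measurability with respect to a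
    small sigma-algebra and covariance under shifts pass to the integral of a site over a time
    interval. *)
Definition right_sum n : R :=
  \sum_(k < n.+1) (h / n.+1%:R) * (f (a + h * k.+1%:R / n.+1%:R))%:R.

Let approx n (s : R) : R :=
  \sum_(k < n.+1) (f (node n k.+1))%:R * \1_(`]node n k, node n k.+1]) s.

Let approxE n s k : (k < n.+1)%N -> s \in `]node n k, node n k.+1] ->
  approx n s = (f (node n k.+1))%:R.
Proof.
move=> kn sk; rewrite /approx (bigD1 (Ordinal kn))//= indicE mem_set// mulr1.
rewrite big1 ?addr0// => i ik; rewrite indicE memNset ?mulr0//= => si.
move: sk si; rewrite !in_itv/= => /andP[s1 s2] /andP[s3 s4].
have [ik'|ki|/eqP] := ltngtP i k.
- by move: (ler_node n ik') => h1; move: (le_lt_trans (le_trans s4 h1) s1); rewrite ltxx.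
- by move: (ler_node n ki) => h1; move: (le_lt_trans (le_trans s2 h1) s3); rewrite ltxx.
- by move=> e; move/eqP: ik; apply; apply: val_inj; exact/eqP.
Qed.

(** Right ends of cells are used because [f] is constant only to the right of [s]: the right end of
    the cell of [s] lies within one mesh after [s]. *)
Let approx_cvg s : s \in `]a, a + h] -> approx n s @[n --> \oo] --> ((f s)%:R : R).
Proof.
rewrite in_itv/= => sah.
have s0 : 0 <= s by case/andP: sah => s1 _; exact: le_trans a0 (ltW s1).
have [e e0 he] := fr s0.
apply: cvg_near_cst.
have [N _ hN] : \forall n \near \oo, h / n.+1%:R < e.
  have : (h * n.+1%:R^-1) @[n --> \oo] --> h * 0.
    by apply: cvgMr; exact: cvg_harmonic.
  rewrite mulr0 => /cvgr_lt; exact.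
exists N => // n /hN /= hn.
have [k /andP[k1 k2]] := grid_cover n h0 sah.
rewrite (@approxE n s k)//; last by rewrite in_itv/= k1 k2.
congr ((nat_of_bool _)%:R); apply: he; rewrite k2/=.
have -> : node n k.+1 = (a + h * k%:R / n.+1%:R) + h / n.+1%:R.
  by rewrite /node -natr1 mulrDr mulr1 mulrDl addrA.
by apply: ltrD.
Qed.

Let approx_measurable n (D : set R) : measurable_fun D (approx n).
Proof.
apply: measurable_sum => k; apply: measurable_funM => //.
Qed.

Lemma measurable_right_constant :
  measurable_fun `]a, a + h] (fun s => (f s)%:R : R).
Proof.
apply: (@measurable_fun_cvg _ _ _ _ approx).
  by move=> n; exact: approx_measurable.
by move=> s /=; exact: approx_cvg.
Qed.

Let finite_length : (lebesgue_measure (`]a, (a + h)%R]%classic : set R) < +oo)%E.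
Proof. by rewrite lebesgue_measure_itv/=; case: ifPn => // _; rewrite -EFinB ltry. Qed.

Lemma measurable_right_constantS (b c : bool) :
  measurable_fun [set` Interval (BSide b a) (BSide c (a + h))]
    (fun s => (f s)%:R : R).
Proof.
apply: (@measurable_funS _ _ _ _ `[a, a + h]).
- exact: measurable_itv.
- by apply: subset_itvScc; case: b; case: c; rewrite bnd_simp.
- have -> : `[a, a + h]%classic = [set a] `|` `]a, a + h]%classic.
    by rewrite setU1itv// bnd_simp lerDl ltW.
  apply/measurable_funU => //; split; last exact: measurable_right_constant.
  exact: measurable_fun_set1.
Qed.

Lemma right_sum_cvg :
  right_sum n @[n --> \oo] -->
  (\int[lebesgue_measure]_(s in `[a, a + h]) (f s)%:R : R).
Proof.
have mD : measurable (`]a, a + h]%classic : set R) by exact: measurable_itv.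
have i1 : lebesgue_measure.-integrable `]a, a + h] (EFin \o (fun=> 1 : R)).
  apply: measurable_bounded_integrable => //; exists 1; split => // y y1 s _ /=.
  by rewrite normr1 ltW.
have app1 n s : `]a, a + h]%classic s -> `|approx n s| <= 1.
  move=> /= sah; have := sah; rewrite in_itv/= => sah'.
  have [k /andP[k1 k2]] := grid_cover n h0 sah'.
  rewrite (@approxE n s k)//; last by rewrite in_itv/= k1 k2.
  by case: (f _); rewrite ?normr1 ?normr0.
have [] := @dominated_convergence _ _ R lebesgue_measure `]a, a + h]%classic mD
   (fun n s => (approx n s)%:E) (fun s => (f s)%:R%:E) (fun=> 1%:E).
- by move=> n; apply/measurable_EFinP; exact: approx_measurable.
- by apply/measurable_EFinP; exact: measurable_right_constant.
- by apply/aeW => s sah; apply/cvg_EFin; [near=> n|exact: approx_cvg].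
- exact: i1.
- by apply/aeW => s n sah; rewrite lee_fin; exact: app1.
move=> ifr _ cv.
rewrite -Rintegral_itv_obnd_cbnd//.
pose I := \int[lebesgue_measure]_(s in `]a, a + h]) ((f s)%:R : R).
have fin : (\int[lebesgue_measure]_(s in `]a, (a + h)%R]) ((f s)%:R : R)%:E = I%:E)%E.
  by rewrite /I /Rintegral fineK//; exact: integrable_fin_num.
rewrite fin in cv.
apply: (cvg_trans _ (fine_cvg cv)); apply: near_eq_cvg; near=> n => /=.
have iterm (k : nat) : lebesgue_measure.-integrable `]a, a + h]
    (EFin \o (fun s => (f (node n k.+1))%:R * \1_(`]node n k, node n k.+1]) s : R)).
  apply: measurable_bounded_integrable => //; first exact: measurable_funM.
  exists 1; split => // y y1 s _ /=; apply: le_trans (ltW y1).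
  by rewrite indicE -natrM; case: (f _); case: (_ \in _); rewrite ?normr1 ?normr0.
under eq_integral do rewrite -sumEFin.
rewrite integral_sum//=; last by move=> k; exact: iterm.
rewrite /right_sum (eq_bigr (fun k : 'I_n.+1 =>
  ((h / n.+1%:R) * (f (a + h * k.+1%:R / n.+1%:R))%:R)%:E)).
  by rewrite sumEFin.
move=> k _; rewrite -/(node n k.+1); case: (f _) => /=; last first.
  by under eq_integral do rewrite mul0r; rewrite integral0 mulr0.
under eq_integral do rewrite mul1r.
rewrite integral_indic//= mulr1.
rewrite setIidl; last first.
  apply: subset_itv; rewrite bnd_simp /node.
    by rewrite lerDl divr_ge0// mulr_ge0// ltW.
  by rewrite lerD2l -mulrA ger_pMr// ler_pdivrMr// mul1r ler_nat.
rewrite lebesgue_measure_itv/= lte_fin /node ltrD2l ltr_pM2r ?invr_gt0//.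
rewrite ltr_pM2l// ltr_nat ltnSn -EFinB; congr EFin.
by rewrite -natr1 mulrDr mulr1 mulrDl; ring.
Unshelve. all: by end_near.
Qed.

End right_constant.

(** * Probabilities of path events *)

Section real_probability.
Context d (T : measurableType d) (R : realType).
Variable Q : {measure set T -> \bar R}.
Hypothesis Q1 : Q setT = 1%E.

Definition pr (A : set T) : R := fine (Q A).

Lemma prE A : measurable A -> Q A = (pr A)%:E.
Proof.
move=> mA; rewrite /pr fineK// ge0_fin_numE//.
rewrite (@le_lt_trans _ _ 1%E) ?ltry// -Q1.
by apply: le_measure; rewrite ?inE.
Qed.

Lemma pr_ge0 A : 0 <= pr A.
Proof. exact: fine_ge0. Qed.

Lemma prT : pr setT = 1. Proof. by rewrite /pr Q1. Qed.

Lemma pr_le A B : measurable A -> measurable B -> A `<=` B -> pr A <= pr B.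
Proof.
by move=> mA mB AB; rewrite -lee_fin -!prE//; apply: le_measure; rewrite ?inE.
Qed.

Lemma pr_le1 A : measurable A -> pr A <= 1.
Proof. by move=> mA; rewrite -prT; apply: pr_le. Qed.

Lemma pr_split A B : measurable A -> measurable B ->
  pr A = pr (A `&` B) + pr (A `\` B).
Proof.
move=> mA mB; apply/EFin_inj; rewrite EFinD -!prE//.
- by rewrite addeC -measureDI.
- exact: measurableD.
- exact: measurableI.
Qed.

Lemma prC A : measurable A -> pr (~` A) = 1 - pr A.
Proof.
by move=> mA; have := pr_split measurableT mA; rewrite prT setTI setTD; lra.
Qed.

Lemma prU2 A B : measurable A -> measurable B -> pr (A `|` B) <= pr A + pr B.
Proof.
move=> mA mB; rewrite -lee_fin EFinD -!prE//; last exact: measurableU.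
exact: measureU2.
Qed.

Lemma pr_bigcup n (A : nat -> set T) : (forall k, measurable (A k)) ->
  pr (\bigcup_(k < n) A k) <= \sum_(k < n) pr (A k).
Proof.
move=> mA; elim: n => [|n IH].
  rewrite big_ord0 (_ : \bigcup_(k < 0) A k = set0) ?/pr ?measure0//.
  by rewrite -subset0 => x [].
rewrite big_ord_recr/= (_ : \bigcup_(k < n.+1) A k = \bigcup_(k < n) A k `|` A n).
  apply: le_trans (prU2 _ _) _ => //; last by rewrite lerD2r.
  by apply: bigcup_measurable.
by rewrite !bigcup_mkord big_ord_recr.
Qed.

(** Fatou's lemma for events; it carries bounds on finer and finer grids over to events that involve
    all times. *)
Lemma pr_liminf A (B : nat -> set T) c : measurable A ->
  (forall n, measurable (B n)) ->
  (forall w, A w -> \forall n \near \oo, B n w) ->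
  (forall e, 0 < e -> \forall n \near \oo, pr (B n) <= c + e) ->
  pr A <= c.
Proof.
move=> mA mB AB Bc; apply/ler_addgt0Pr => e e0.
have [N _ hN] := Bc _ e0.
pose C m := \bigcap_(n in [set n | (m <= n)%N]) B n.
have mC m : measurable (C m) by apply: bigcap_measurable => //; exists m => /=.
have ndC : nondecreasing_seq C.
  move=> m n mn; apply/subsetPset => w Cw k /= nk; apply: Cw => /=.
  exact: leq_trans nk.
have AC : A `<=` \bigcup_m C m.
  by move=> w /AB[m _ hm]; exists m => // n /= mn; exact: hm.
have mUC : measurable (\bigcup_m C m) by exact: bigcupT_measurable.
apply: le_trans (pr_le mA mUC AC) _.
have cv := nondecreasing_cvg_mu (mu := Q) mC mUC ndC.
rewrite -lee_fin -prE//.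
rewrite -(cvg_lim _ cv)//; apply: lime_le; first by apply/cvg_ex; eexists; exact: cv.
near=> m; rewrite /= prE// lee_fin.
apply: (@le_trans _ _ (pr (B (maxn m N)))).
  by apply: pr_le => //; apply: bigcap_inf; rewrite /= leq_maxl.
by apply: hN; rewrite /= leq_maxr.
Unshelve. all: by end_near.
Qed.

End real_probability.

Section path_sigma.
Context {R : realType} {T : ptopologicalType}.
Implicit Types (I J : set R) (A B : set (cadlag_path R T)).

Lemma path_eventsT I : path_events T I setT.
Proof. exact: (@measurableT _ (g_sigma_algebraType _)). Qed.

Lemma path_eventsI I A B :
  path_events T I A -> path_events T I B -> path_events T I (A `&` B).
Proof. exact: (@measurableI _ (g_sigma_algebraType _)). Qed.

Lemma path_events_bigcap I (F : nat -> set (cadlag_path R T)) (P : set nat) :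
  (forall k, P k -> path_events T I (F k)) ->
  path_events T I (\bigcap_(k in P) F k).
Proof.
move=> h; have [->|/set0P P0] := eqVneq P set0.
  by rewrite bigcap_set0; exact: path_eventsT.
exact: (@bigcap_measurable _ (g_sigma_algebraType _)).
Qed.

Lemma path_events_bigcup I (F : nat -> set (cadlag_path R T)) (P : set nat) :
  (forall k, P k -> path_events T I (F k)) ->
  path_events T I (\bigcup_(k in P) F k).
Proof. exact: (@bigcup_measurable _ (g_sigma_algebraType _)). Qed.

Lemma path_events_open I s (U : set T) :
  I s -> open U -> path_events T I [set w : cadlag_path R T | U (w s)].
Proof. by move=> Is oU; apply: sub_gen_smallest; exists s, U. Qed.

Lemma path_eventsS I J : I `<=` J -> path_events T I `<=` path_events T J.
Proof.
move=> IJ; apply: smallest_sub; first exact: smallest_sigma_algebra.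
move=> A [s [U [Is oU ->]]]; apply: path_events_open => //; exact: IJ.
Qed.

Lemma measurable_path_events I A : I `<=` [set t | 0 <= t] ->
  path_events T I A -> measurable A.
Proof. by move=> /path_eventsS IJ /IJ. Qed.

End path_sigma.

Section path_regularity.
Context {R : realType}.

Lemma near_right_constant (A : Type) (f : R -> A) :
  (forall t, 0 <= t -> \forall s \near t^'+, f s = f t) -> right_constant f.
Proof.
move=> h t /h[e /= e0 he]; exists e => // s /andP[].
rewrite le_eqVlt => /predU1P[->//|ts st]; apply: he => //=.
by rewrite ltr0_norm ?subr_lt0// opprB ltrBlDl.
Qed.

Lemma walk_right_constant (X : cadlag_path R Zdiscr) : right_constant X.
Proof.
apply: near_right_constant => t t0; have [+ _] := cadlag_pathP X t0.
by move=> /(_ [set X t]); apply; exact: (@discrete_set1 Zdiscr).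
Qed.

Lemma config_eval_continuous x : continuous (fun eta : config => eta x).
Proof. exact: (@proj_continuous int (fun=> bool) x). Qed.

Lemma site_right_constant (w : cadlag_path R config) x :
  right_constant (fun s => w s x).
Proof.
apply: near_right_constant => t t0; have [wt _] := cadlag_pathP w t0.
have : w s x @[s --> t^'+] --> w t x.
  exact: (cvg_comp _ _ wt (@config_eval_continuous x (w t))).
by move=> /(_ [set w t x]); apply; exact: discrete_set1.
Qed.

(** The witness is the supremum of the times up to which [f] keeps the value [f a]. If [f] still had
    this value there, right constancy would prolong it further. *)
Lemma first_exit (A : Type) (f : R -> A) a b : right_constant f ->
  0 <= a -> a <= b -> f b <> f a ->
  exists r, [/\ a < r, r <= b, forall s, a <= s < r -> f s = f a & f r <> f a].
Proof.
move=> fr a0 ab fba.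
pose S := [set s | a <= s <= b /\ forall u, a <= u <= s -> f u = f a].
have Sa : S a.
  by split; [rewrite lexx|move=> u; rewrite -eq_le => /eqP ->].
have Sb : ubound S b by move=> s [/andP[]].
have supS : has_sup S by split; [exists a|exists b].
pose r := sup S.
have rb : r <= b by apply: ge_sup => //; exists a.
have ar : a <= r by apply: ub_le_sup => //; exists b.
have below s : a <= s < r -> f s = f a.
  move=> /andP[as_ sr]; have [s' [_ hs'] ss'] := sup_gt supS.1 sr.
  by apply: hs'; rewrite as_ ltW.
have [e e0 he] := fr r (le_trans a0 ar).
have frn : f r <> f a.
  move=> fra; pose r' := Num.min b (r + e / 2).
  have rltb : r < b by rewrite lt_neqAle rb andbT; apply/eqP => rbE; rewrite -rbE in fba.
  have rr' : r < r' by rewrite lt_min rltb ltrDl divr_gt0.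
  have : S r'.
    split; first by rewrite (le_trans ar (ltW rr'))/= ge_min lexx.
    move=> u /andP[au ur']; have [ur|ru] := ltP u r; first by apply: below; rewrite au.
    rewrite -fra; apply: he; rewrite ru/=; apply: le_lt_trans ur' _.
    by rewrite gt_min; apply/orP; right; rewrite ltrD2l ltr_pdivrMr// ltr_pMr// ltr1n.
  move=> /(ub_le_sup (ex_intro _ b Sb)); rewrite -/r leNgt => /negP; exact.
exists r; split => //; rewrite lt_neqAle ar andbT; apply/eqP => arE.
by apply: frn; rewrite -arE.
Qed.

End path_regularity.

(** * Means of bounded functions *)

Section adapted.
Context {T : pointedType} {R : realType}.
Implicit Types (F : set (set T)) (f g : T -> R).

Definition adapted F f := measurable_fun (setT : set (g_sigma_algebraType F)) f.

Lemma adaptedS F F' f : F `<=` F' -> adapted F f -> adapted F' f.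
Proof.
move=> FF' mf _ Y mY.
apply: (sub_smallest2r (smallest_sigma_algebra setT F') FF').
exact: (mf measurableT _ mY).
Qed.

Lemma adapted_cst F c : adapted F (fun=> c).
Proof. exact: measurable_cst. Qed.

Lemma adaptedD F f g : adapted F f -> adapted F g -> adapted F (fun w => f w + g w).
Proof. exact: measurable_funD. Qed.

Lemma adaptedB F f g : adapted F f -> adapted F g -> adapted F (fun w => f w - g w).
Proof. exact: measurable_funB. Qed.

Lemma adaptedM F f g : adapted F f -> adapted F g -> adapted F (fun w => f w * g w).
Proof. exact: measurable_funM. Qed.

Lemma adapted_indic F A : F A -> adapted F (\1_A).
Proof.
by move=> FA; apply: measurable_indic; exact: sub_gen_smallest.
Qed.

Lemma adapted_cvg F (h : nat -> T -> R) f :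
  (forall n, adapted F (h n)) -> (forall w, h n w @[n --> \oo] --> f w) ->
  adapted F f.
Proof.
move=> ah hf; apply: (@measurable_fun_cvg _ (g_sigma_algebraType F) R setT h f).
  exact: ah.
by move=> w _; exact: hf.
Qed.

Lemma adapted_ge F f c : sigma_algebra setT F -> adapted F f -> F [set w | c <= f w].
Proof.
move=> sF af; rewrite -[F](sigma_algebra_id sF).
have := af measurableT `[c, +oo[%classic (measurable_itv _).
rewrite setTI; congr (<<s F>> _); apply/seteqP; split => w /=; rewrite in_itv/= andbT//.
Qed.

End adapted.

Section layers.
Context {R : realType}.

Lemma sum_steps_le K (y : R) : 0 <= y ->
  \sum_(k < K) (k.+1%:R <= y)%R%:R <= y.
Proof.
move=> y0; elim: K => [|K IH]; first by rewrite big_ord0.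
rewrite big_ord_recr/=; have [Ky|yK] := lerP K.+1%:R y; last by rewrite addr0.
apply: le_trans Ky; rewrite -natr1 lerD2r.
rewrite (_ : K%:R = \sum_(k < K) 1); last by rewrite sumr_const card_ord.
apply: ler_sum => k _.
by case: (k.+1%:R <= y).
Qed.

Lemma sum_steps_ge K (y : R) : y <= K.+1%:R ->
  y <= \sum_(k < K) (k.+1%:R <= y)%R%:R + 1.
Proof.
elim: K => [|K IH] yK; first by rewrite big_ord0 add0r.
rewrite big_ord_recr/=; have [Ky|Ky] := lerP K.+1%:R y.
  rewrite (eq_bigr (fun=> 1)); last first.
    move=> k _; rewrite (_ : _ <= y) //; apply: le_trans Ky.
    by rewrite ler_nat; exact: ltnW (ltn_ord k).
  rewrite sumr_const card_ord; apply: le_trans yK _.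
  by rewrite /= -[K.+2%:R]natr1 -[K.+1%:R]natr1.
by rewrite addr0; apply: IH; exact: ltW.
Qed.

Definition layers n (v : R) : R :=
  n.+1%:R^-1 * \sum_(k < n.+1) (k.+1%:R / n.+1%:R <= v)%R%:R.

Lemma layersP n v : 0 <= v <= 1 -> `|v - layers n v| <= n.+1%:R^-1.
Proof.
move=> /andP[v0 v1]; have n0 : 0 < n.+1%:R :> R by [].
have -> : layers n v = n.+1%:R^-1 * \sum_(k < n.+1) (k.+1%:R <= v * n.+1%:R)%R%:R.
  congr (_ * _); apply: eq_bigr => k _; by rewrite ler_pdivrMr.
have vn : v = n.+1%:R^-1 * (v * n.+1%:R) by rewrite mulrCA mulVf ?mulr1// lt0r_neq0.
rewrite [X in `|X - _|]vn -mulrBr normrM gtr0_norm ?invr_gt0//.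
rewrite -[leRHS]mulr1 ler_pM2l ?invr_gt0//.
have h1 := @sum_steps_le n.+1 (v * n.+1%:R) (mulr_ge0 v0 (ltW n0)).
have h2 : v * n.+1%:R <= \sum_(k < n.+1) (k.+1%:R <= v * n.+1%:R)%R%:R + 1.
  apply: sum_steps_ge; apply: (@le_trans _ _ (1 * n.+1%:R)).
    by rewrite ler_pM2r.
  by rewrite mul1r ler_nat.
by rewrite ler_norml; lra.
Qed.

End layers.

Section expectation.
Context d (T : measurableType d) (R : realType) (M : probability T R).
Implicit Types (f g h : T -> R).

Definition bounded_mfun f := measurable_fun setT f /\ exists c, forall w, `|f w| <= c.
Definition mean f : R := \int[M]_w f w.

Lemma bmf_integrable f : bounded_mfun f -> M.-integrable setT (EFin \o f).
Proof.
move=> [mf [c fc]]; apply: measurable_bounded_integrable => //.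
  by rewrite (le_lt_trans (probability_le1 M measurableT))// ltry.
exists c; split; first exact: num_real.
by move=> y cy w _ /=; exact: le_trans (fc w) (ltW cy).
Qed.

Lemma bmf_cst c : bounded_mfun (fun=> c).
Proof. by split; [exact: measurable_cst|exists `|c|]. Qed.

Lemma bmfD f g : bounded_mfun f -> bounded_mfun g -> bounded_mfun (fun w => f w + g w).
Proof.
move=> [mf [a fa]] [mg [b gb]]; split; first exact: measurable_funD.
by exists (a + b) => w; apply: le_trans (ler_normD _ _) _; exact: lerD.
Qed.

Lemma bmfM f g : bounded_mfun f -> bounded_mfun g -> bounded_mfun (fun w => f w * g w).
Proof.
move=> [mf [a fa]] [mg [b gb]]; split; first exact: measurable_funM.
by exists (a * b) => w; rewrite normrM; apply: ler_pM.
Qed.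

Lemma bmfZ c f : bounded_mfun f -> bounded_mfun (fun w => c * f w).
Proof. by apply: bmfM; exact: bmf_cst. Qed.

Lemma bmfB f g : bounded_mfun f -> bounded_mfun g -> bounded_mfun (fun w => f w - g w).
Proof.
move=> bf bg; have -> : (fun w => f w - g w) = (fun w => f w + (-1) * g w).
  by apply/funext => w; rewrite mulN1r.
by apply: bmfD => //; exact: bmfZ.
Qed.

Lemma bmf_indic A : measurable A -> bounded_mfun (\1_A).
Proof.
move=> mA; split; first exact: measurable_indic.
by exists 1 => w; rewrite indicE; case: (_ \in _); rewrite ?normr1 ?normr0.
Qed.

Lemma mean_cst c : mean (fun=> c) = c.
Proof.
rewrite /mean Rintegral_cst//; have -> : fine (M setT) = 1 by rewrite probability_setT.
by rewrite mulr1.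
Qed.

Lemma meanD f g : bounded_mfun f -> bounded_mfun g ->
  mean (fun w => f w + g w) = mean f + mean g.
Proof. by move=> bf bg; rewrite /mean RintegralD//; exact: bmf_integrable. Qed.

Lemma meanZ c f : bounded_mfun f -> mean (fun w => c * f w) = c * mean f.
Proof. by move=> bf; rewrite /mean RintegralZl//; exact: bmf_integrable. Qed.

Lemma meanB f g : bounded_mfun f -> bounded_mfun g ->
  mean (fun w => f w - g w) = mean f - mean g.
Proof. by move=> bf bg; rewrite /mean RintegralB//; exact: bmf_integrable. Qed.

Lemma le_mean f g : bounded_mfun f -> bounded_mfun g ->
  (forall w, f w <= g w) -> mean f <= mean g.
Proof.
by move=> bf bg fg; apply: le_Rintegral => //; exact: bmf_integrable.
Qed.

Lemma mean_indic A : measurable A -> mean (\1_A) = pr M A.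
Proof. by move=> mA; rewrite /mean /Rintegral integral_indic// setIT. Qed.

Lemma mean_ge0 f : (forall w, 0 <= f w) -> 0 <= mean f.
Proof. by move=> f0; apply: Rintegral_ge0. Qed.

Lemma mean_norm_le f c : bounded_mfun f -> (forall w, `|f w| <= c) -> `|mean f| <= c.
Proof.
move=> bf fc; have fc' w : - c <= f w <= c by rewrite -ler_norml.
rewrite ler_norml -[X in X <= _]mean_cst -[X in _ && (_ <= X)]mean_cst.
by rewrite !le_mean//; try exact: bmf_cst; move=> w; have /andP[] := fc' w.
Qed.

(* A linear functional of a bounded function is controlled by its values on
   the superlevel sets, because the function is an average of their indicators. *)
Lemma functional_layers (F : set (set T)) (Lambda : (T -> R) -> R) (K kappa : R) g :
  sigma_algebra setT F -> F `<=` measurable ->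
  (forall a f h, bounded_mfun f -> bounded_mfun h ->
     Lambda (fun w => a * f w + h w) = a * Lambda f + Lambda h) ->
  (forall f c, bounded_mfun f -> (forall w, `|f w| <= c) -> Lambda f <= K * c) ->
  (forall B, F B -> Lambda (\1_B) <= kappa) ->
  adapted F g -> (forall w, 0 <= g w <= 1) -> Lambda g <= kappa.
Proof.
move=> sF Fm lin bnd ind ag g01.
have bg : bounded_mfun g.
  split; last by exists 1 => w; have /andP[? ?] := g01 w; rewrite ger0_norm.
  move=> _ Y mY; apply: Fm; rewrite -[F](sigma_algebra_id sF).
  exact: ag.
pose B n k := [set w | k.+1%:R / n.+1%:R <= g w].
have FB n k : F (B n k) by exact: adapted_ge.
have bB n k : bounded_mfun (\1_(B n k)) by apply: bmf_indic; exact: Fm.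
pose S n m w : R := \sum_(k < m) \1_(B n k) w.
have SE n m w : S n m.+1 w = 1 * \1_(B n m) w + S n m w.
  by rewrite /S big_ord_recr/= addrC mul1r.
have bS n m : bounded_mfun (S n m).
  elim: m => [|m IH].
    rewrite (_ : S n 0%N = fun=> 0); first exact: bmf_cst.
    by apply/funext => w; rewrite /S big_ord0.
  rewrite (_ : S n m.+1 = fun w => 1 * \1_(B n m) w + S n m w); last exact/funext/SE.
  by apply: bmfD => //; exact: bmfZ.
have L0 : Lambda (fun=> 0) = 0.
  have := lin (-1) _ _ (bmf_cst 0) (bmf_cst 0); rewrite mulr0 addr0.
  by rewrite mulN1r addNr.
have LS n m : Lambda (S n m) <= m%:R * kappa.
  elim: m => [|m IH].
    rewrite (_ : S n 0%N = fun=> 0) ?L0 ?mul0r//.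
    by apply/funext => w; rewrite /S big_ord0.
  rewrite (_ : S n m.+1 = fun w => 1 * \1_(B n m) w + S n m w); last exact/funext/SE.
  rewrite lin// mul1r -natr1 mulrDl mul1r addrC lerD//.
  exact: ind.
have Sg n w : `|g w - n.+1%:R^-1 * S n n.+1 w| <= n.+1%:R^-1.
  have -> : S n n.+1 w = \sum_(k < n.+1) (k.+1%:R / n.+1%:R <= g w)%R%:R.
    apply: eq_bigr => k _; rewrite indicE; congr (nat_of_bool _)%:R.
    by apply/idP/idP; rewrite inE.
  exact: layersP.
have main n : Lambda g <= kappa + K * n.+1%:R^-1.
  have bD : bounded_mfun (fun w => g w - n.+1%:R^-1 * S n n.+1 w).
    by apply: bmfB => //; exact: bmfZ.
  have -> : g = (fun w => n.+1%:R^-1 * S n n.+1 w + (g w - n.+1%:R^-1 * S n n.+1 w)).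
    by apply/funext => w; ring.
  rewrite lin//; apply: lerD; last exact: bnd.
  by rewrite ler_pdivrMl// LS.
have : K * n.+1%:R^-1 @[n --> \oo] --> K * 0 by apply: cvgMr; exact: cvg_harmonic.
rewrite mulr0 => cK.
have : kappa + K * n.+1%:R^-1 @[n --> \oo] --> kappa + 0 by apply: cvgD => //; exact: cvg_cst.
rewrite addr0 => ck; rewrite -(cvg_lim _ ck)//; apply: limr_ge.
  by apply/cvg_ex; exists kappa.
by apply: nearW.
Qed.

End expectation.

Section mixture_mean.
Context d d' (X : measurableType d) (Y : measurableType d') (R : realType).
Variables (mu : probability X R) (k : R.-pker X ~> Y).

Let k1 x : k x setT = 1%E. Proof. exact: prob_kernel. Qed.

Lemma bmf_kernel A : measurable A -> bounded_mfun (fun x => pr (k x) A : R).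
Proof.
move=> mA; split.
  have mk : measurable_fun setT (k ^~ A) by exact: measurable_kernel.
  by apply/measurable_EFinP; apply: eq_measurable_fun mk => x _ /=; rewrite (prE (k1 x) mA).
by exists 1 => x; rewrite ger0_norm ?pr_ge0// (pr_le1 (k1 x) mA).
Qed.

Lemma pr_mixtureE A : measurable A ->
  pr (mixture mu k) A = mean mu (fun x => pr (k x) A).
Proof.
move=> mA; rewrite /pr /mean /Rintegral /mixture/=; congr fine.
by apply: eq_integral => x _; exact: (prE (k1 x) mA).
Qed.

End mixture_mean.

(** * The first jump after a fixed time *)

Section first_jump_grid.
Context {R : realType}.
Implicit Types (X : cadlag_path R Zdiscr) (x y : int) (s t u : R).

Definition node (t u : R) n k : R := t + (u - t) * k%:R / n.+1%:R.

Definition visits s x : set (cadlag_path R Zdiscr) := [set X | X s = x].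

(** Discrete counterpart of [first_jump] that looks at finitely many times. A coarse grid can
    overlook a jump, so only occurrence on all fine grids is compared with [first_jump]. *)
Definition grid_jump t u n x y : set (cadlag_path R Zdiscr) :=
  \bigcup_(k < n.+1)
    ((\bigcap_(j < k.+1) (visits (node t u n j) x)) `&`
     (visits (node t u n k.+1) y)).

Lemma node0 t u n : node t u n 0 = t.
Proof. by rewrite /node mulr0 mul0r addr0. Qed.

Lemma node_last t u n : node t u n n.+1 = u.
Proof. by rewrite /node mulfK ?pnatr_eq0// addrC subrK. Qed.

Lemma nodeS t u n k : node t u n k.+1 = node t u n k + (u - t) / n.+1%:R.
Proof. by rewrite /node -natr1 mulrDr mulr1 mulrDl addrA. Qed.

Lemma ler_node t u n k l : t <= u -> (k <= l)%N -> node t u n k <= node t u n l.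
Proof.
move=> tu kl; rewrite /node lerD2l ler_pM2r ?invr_gt0//.
by rewrite ler_wpM2l ?subr_ge0// ler_nat.
Qed.

Lemma node_bounds t u n k : t <= u -> (k <= n.+1)%N -> t <= node t u n k <= u.
Proof.
move=> tu kn; rewrite -[X in X <= _](node0 t u n) ler_node//=.
by rewrite -[leRHS](node_last t u n) ler_node.
Qed.

Lemma first_jump_near t u x y X : 0 <= t -> first_jump t u x y X ->
  \forall n \near \oo, grid_jump t u n x y X.
Proof.
move=> t0 [r [/andP[tr ru] Xx Xy]].
have tu : t <= u by exact: le_trans (ltW tr) ru.
have [e e0 he] := walk_right_constant X (le_trans t0 (ltW tr)).
have [N _ hN] : \forall n \near \oo, (u - t) / n.+1%:R < e.
  have : ((u - t) * n.+1%:R^-1) @[n --> \oo] --> (u - t) * 0.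
    by apply: cvgMr; exact: cvg_harmonic.
  rewrite mulr0 => /cvgr_lt; exact.
exists N => // n /hN /= hn.
have ut0 : 0 < u - t by rewrite subr_gt0; exact: lt_le_trans tr ru.
have : t < r <= t + (u - t) by rewrite tr addrC subrK.
move=> /(grid_cover n ut0)[k /andP[k1 k2]].
exists k; first exact: ltn_ord.
split=> [j /= jk|/=].
  apply: Xx; have /andP[-> _]/= : t <= node t u n j <= u.
    by apply: node_bounds => //; have := ltn_ord k; lia.
  by apply: le_lt_trans k1; apply: ler_node.
rewrite -Xy; apply: he; rewrite [leRHS]/node k2/= nodeS.
exact: ltrD.
Qed.

Lemma grid_jump_uniq t u n x y z X : y != x -> z != x ->
  grid_jump t u n x y X -> grid_jump t u n x z X -> y = z.
Proof.
move=> yx zx [k _ [hk Xk]] [l _ [hl Xl]].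
have [kl|lk|kl] := ltngtP k l.
- by move: yx; rewrite -Xk (hl k.+1)// eqxx.
- by move: zx; rewrite -Xl (hk l.+1)// eqxx.
- by rewrite -Xk -Xl kl.
Qed.

Lemma exit_first_jump t u x X : 0 <= t -> t <= u -> X t = x -> X u <> x ->
  exists2 y, y != x & first_jump t u x y X.
Proof.
move=> t0 tu Xt Xu.
have [|r [tr ru Xr Xrn]] := first_exit (walk_right_constant X) t0 tu.
  by rewrite Xt.
exists (X r); first by apply/eqP; rewrite -Xt.
by exists r; split; rewrite ?tr// => s /Xr; rewrite Xt.
Qed.

(** Gives measurability of an event that involves uncountably many times. If all fine grids see a
    jump to [y], there is a true first jump to some [z], which fine grids see as well; a grid sees
    one target only, so [y = z]. *)
Lemma first_jumpE t u x y : 0 <= t -> t <= u -> y != x ->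
  first_jump t u x y =
  \bigcup_N \bigcap_(n in [set n | (N <= n)%N]) grid_jump t u n x y.
Proof.
move=> t0 tu yx; apply/seteqP; split => X.
  by move=> /(first_jump_near t0)[N _ hN]; exists N => // n /= /hN.
move=> [N _ hN].
have [k /= kN [hk Xk]] := hN N (leqnn N).
have /andP[tn nu] := node_bounds tu kN.
have Xt : X t = x by rewrite -[t](node0 t u N); exact: hk.
have Xkx : X (node t u N k.+1) <> x by rewrite Xk; exact/eqP.
have [z zx [r [/andP[tr rk] Xr Xz]]] := exit_first_jump t0 tn Xt Xkx.
have jz : first_jump t u x z X.
  by exists r; split => //; rewrite tr (le_trans rk).
have [M _ hM] := first_jump_near t0 jz.
suff -> : y = z by [].
apply: (@grid_jump_uniq t u (maxn M N) x _ _ X) => //.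
  by apply: hN; rewrite /= leq_maxr.
by apply: hM; rewrite /= leq_maxl.
Qed.

Lemma path_events_at I s x : I s ->
  path_events Zdiscr I (visits s x).
Proof.
move=> Is; have ox : open ([set x] : set Zdiscr) by exact: discrete_open.
exact: (path_events_open (R := R) Is ox).
Qed.

Lemma measurable_at s x : 0 <= s ->
  measurable (visits s x).
Proof. exact: path_events_at. Qed.

Lemma path_events_grid_jump t u n x y : 0 <= t -> t <= u ->
  path_events Zdiscr [set r | 0 <= r <= u] (grid_jump t u n x y).
Proof.
move=> t0 tu; have inI k : (k <= n.+1)%N -> 0 <= node t u n k <= u.
  by move=> /(node_bounds tu)/andP[h ->]; rewrite (le_trans t0 h).
apply: path_events_bigcup => k /= kn; apply: path_eventsI.
  apply: path_events_bigcap => j /= jk; apply: path_events_at; apply: inI; lia.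
by apply: path_events_at; exact: inI.
Qed.

Lemma measurable_grid_jump t u n x y : 0 <= t -> t <= u ->
  measurable (grid_jump t u n x y).
Proof.
move=> t0 tu; apply: (measurable_path_events (I := [set r | 0 <= r <= u])).
  by move=> r /= /andP[].
exact: path_events_grid_jump.
Qed.

Lemma measurable_first_jump t u x y : 0 <= t -> t <= u -> y != x ->
  measurable (first_jump t u x y : set (cadlag_path R Zdiscr)).
Proof.
move=> t0 tu yx; rewrite first_jumpE//.
apply: bigcupT_measurable => N; apply: bigcap_measurable; first by exists N => /=.
by move=> n _; exact: measurable_grid_jump.
Qed.

End first_jump_grid.

Lemma interval_length (R : realType) (a b : R) : a <= b ->
  fine (lebesgue_measure (`[a, b]%classic : set R)) = b - a.
Proof.
rewrite lebesgue_measure_itv/= lte_fin le_eqVlt => /predU1P[->|->//].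
by rewrite ltxx subrr.
Qed.

(** * Jump probabilities of the quenched walk over a short time interval *)

Section walk_estimates.
Context {R : realType}.
Variables (alpha beta : R) (xi : cadlag_path R config).
Variable Q : {measure set (cadlag_path R Zdiscr) -> \bar R}.
Hypotheses (Q1 : Q setT = 1%E) (beta0 : 0 < beta) (ab : beta < alpha).
Hypothesis hQ : jump_law (rwre_rate alpha beta xi) 0 Q.

Local Notation lam := (alpha + beta).
Implicit Types (x y : int).
Local Notation mu := (@lebesgue_measure R).

Definition occupation x (t u : R) : R :=
  \int[mu]_(s in `[t, u]) ((xi s x)%:R : R).

(** The integral over [t, u] of the rate of jumping up from [x], see [rate_mass_up]. The environment
    enters only through [occupation]. *)
Definition up_weight x t u := beta * (u - t) + (alpha - beta) * occupation x t u.

Lemma rate_up t x :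
  rwre_rate alpha beta xi t x (x + 1) = beta + (alpha - beta) * (xi t x)%:R.
Proof. by rewrite /rwre_rate eqxx; ring. Qed.

Lemma rate_down t x :
  rwre_rate alpha beta xi t x (x - 1) = alpha - (alpha - beta) * (xi t x)%:R.
Proof.
rewrite /rwre_rate (_ : (x - 1 == x + 1) = false) ?eqxx; first by ring.
by apply/eqP; lia.
Qed.

Lemma rate_other t x y : y != x + 1 -> y != x - 1 ->
  rwre_rate alpha beta xi t x y = 0.
Proof. by rewrite /rwre_rate => /negbTE -> /negbTE ->. Qed.

Let site01 t x : 0 <= ((xi t x)%:R : R) <= 1.
Proof. by case: (xi t x); rewrite /= ?lexx ler01. Qed.

Lemma rate_bounds t x y : 0 <= rwre_rate alpha beta xi t x y <= lam.
Proof.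
have b0 := beta0; have ba := ab.
have [->|y1] := eqVneq y (x + 1).
  by rewrite rate_up; case: (xi t x) => /=; apply/andP; split; lra.
have [->|y2] := eqVneq y (x - 1).
  by rewrite rate_down; case: (xi t x) => /=; apply/andP; split; lra.
by rewrite rate_other// lexx/=; lra.
Qed.

Variables (t u : R).
Hypotheses (t0 : 0 <= t) (tu : t < u).

Let finite_length : (mu (`[t, u]%classic : set R) < +oo)%E.
Proof. by rewrite lebesgue_measure_itv/=; case: ifPn => // _; rewrite -EFinB ltry. Qed.

Let measure_length : fine (mu (`[t, u]%classic : set R)) = u - t.
Proof. by rewrite interval_length ?ltW. Qed.

Lemma bounded_integrable (f : R -> R) c : measurable_fun `[t, u] f ->
  (forall s, t <= s <= u -> `|f s| <= c) -> mu.-integrable `[t, u] (EFin \o f).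
Proof.
move=> mf fc; apply: measurable_bounded_integrable => //.
exists c; split; first exact: num_real.
move=> y cy s /=; rewrite in_itv/= => /fc h; exact: le_trans h (ltW cy).
Qed.

Lemma measurable_site x : measurable_fun `[t, u] (fun s => (xi s x)%:R : R).
Proof.
have ut0 : 0 < u - t by rewrite subr_gt0.
have := @measurable_right_constantS _ _ _ _ t0 ut0 (site_right_constant xi x) true false.
by rewrite addrC subrK.
Qed.

Lemma integrable_site x : mu.-integrable `[t, u] (EFin \o (fun s => (xi s x)%:R : R)).
Proof.
apply: (@bounded_integrable _ 1); first exact: measurable_site.
by move=> s _; rewrite ger0_norm; have /andP[] := site01 s x.
Qed.

Lemma integrable_cst (c : R) : mu.-integrable `[t, u] (EFin \o (fun=> c)).
Proof. by apply: (@bounded_integrable _ `|c|). Qed.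

Lemma occupation_bounds x : 0 <= occupation x t u <= u - t.
Proof.
apply/andP; split.
  by apply: Rintegral_ge0 => s _; have /andP[] := site01 s x.
rewrite -[leRHS]mul1r -measure_length -Rintegral_cst//.
apply: le_Rintegral => //; [exact: integrable_site|exact: integrable_cst|].
by move=> s _; have /andP[] := site01 s x.
Qed.

Lemma integral_rate_affine (a b : R) x :
  \int[mu]_(s in `[t, u]) (a + b * (xi s x)%:R) =
  a * (u - t) + b * occupation x t u.
Proof.
have iz : mu.-integrable `[t, u] (EFin \o (fun s => b * (xi s x)%:R : R)).
  apply: (@bounded_integrable _ `|b|).
    by apply: measurable_funM => //; exact: measurable_site.
  move=> s _; rewrite normrM; case: (xi s x) => /=; rewrite ?normr1 ?mulr1//.
  by rewrite normr0 mulr0.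
rewrite RintegralD//; last exact: integrable_cst.
rewrite Rintegral_cst// measure_length; congr (_ + _).
by rewrite RintegralZl//; exact: integrable_site.
Qed.

Lemma measurable_rate x y :
  measurable_fun `[t, u] (fun s => rwre_rate alpha beta xi s x y).
Proof.
have m a b : measurable_fun `[t, u] (fun s => a + b * (xi s x)%:R : R).
  by apply: measurable_funD => //; apply: measurable_funM => //; exact: measurable_site.
have [->|y1] := eqVneq y (x + 1).
  by apply: eq_measurable_fun (m beta (alpha - beta)) => s _; rewrite rate_up.
have [->|y2] := eqVneq y (x - 1).
  by apply: eq_measurable_fun (m alpha (- (alpha - beta))) => s _; rewrite rate_down mulNr.
by apply: eq_measurable_fun (m 0 0) => s _; rewrite rate_other// mul0r addr0.
Qed.

Definition rate_mass x y := \int[mu]_(s in `[t, u]) rwre_rate alpha beta xi s x y.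

Lemma rate_mass_up x : rate_mass x (x + 1) = up_weight x t u.
Proof.
rewrite /up_weight -integral_rate_affine; apply: eq_Rintegral => s _.
by rewrite rate_up.
Qed.

Lemma rate_mass_down x : rate_mass x (x - 1) = lam * (u - t) - up_weight x t u.
Proof.
have -> : lam * (u - t) - up_weight x t u =
    alpha * (u - t) + (- (alpha - beta)) * occupation x t u.
  by rewrite /up_weight; ring.
rewrite -integral_rate_affine; apply: eq_Rintegral => s _.
by rewrite rate_down mulNr.
Qed.

(** The factor in [jump_law] for a first jump to [y], after insertion of the constant total rate
    [alpha + beta]. *)
Definition jump_mass x y := \int[mu]_(s in `[t, u])
  (rwre_rate alpha beta xi s x y * expR (- (lam * (s - t)))).

Let damping01 s : t <= s <= u -> 1 - lam * (u - t) <= expR (- (lam * (s - t))) <= 1.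
Proof.
move=> /andP[ts su]; have lam0 : 0 < lam by rewrite addr_gt0// (lt_trans beta0).
apply/andP; split.
  apply: le_trans (expR_ge1Dx _).
  by rewrite lerD2l lerN2 ler_pM2l// lerD2r.
by rewrite -expR0 ler_expR oppr_le0 mulr_ge0 ?subr_ge0// ltW.
Qed.

Let measurable_damping : measurable_fun `[t, u] (fun s => expR (- (lam * (s - t)))).
Proof.
apply: measurableT_comp; first exact: measurable_expR.
apply: measurable_funN; apply: measurable_funM => //.
by apply: measurable_funB => //; exact: measurable_id.
Qed.

Let integrable_rate x y : mu.-integrable `[t, u]
  (EFin \o (fun s => rwre_rate alpha beta xi s x y)).
Proof.
apply: (@bounded_integrable _ lam); first exact: measurable_rate.
by move=> s _; have /andP[? ?] := rate_bounds s x y; rewrite ger0_norm.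
Qed.

Let integrable_jump x y : mu.-integrable `[t, u]
  (EFin \o (fun s => rwre_rate alpha beta xi s x y * expR (- (lam * (s - t))))).
Proof.
apply: (@bounded_integrable _ lam).
  apply: measurable_funM; first exact: measurable_rate.
  exact: measurable_damping.
move=> s stu; have /andP[r0 r1] := rate_bounds s x y.
have /andP[_ e1] := damping01 stu.
rewrite ger0_norm ?mulr_ge0 ?expR_ge0//; apply: le_trans r1.
by rewrite ler_piMr.
Qed.

Lemma jump_mass_le x y : jump_mass x y <= rate_mass x y.
Proof.
apply: le_Rintegral => // s; rewrite /= in_itv/= => stu.
have /andP[r0 r1] := rate_bounds s x y; have /andP[_ e1] := damping01 stu.
by rewrite ler_piMr.
Qed.

Lemma jump_mass_ge x y : (1 - lam * (u - t)) * rate_mass x y <= jump_mass x y.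
Proof.
rewrite -RintegralZl//; apply: le_Rintegral => //.
  apply: (@bounded_integrable _ (`|1 - lam * (u - t)| * lam)).
    by apply: measurable_funM => //; exact: measurable_rate.
  move=> s _; rewrite normrM; have /andP[r0 r1] := rate_bounds s x y.
  by rewrite ler_wpM2l// ger0_norm.
move=> s; rewrite /= in_itv/= => stu.
have /andP[r0 r1] := rate_bounds s x y; have /andP[e1 _] := damping01 stu.
by rewrite mulrC ler_wpM2l.
Qed.

Lemma jump_mass_other x y : y != x + 1 -> y != x - 1 -> jump_mass x y = 0.
Proof.
move=> y1 y2; rewrite /jump_mass (@eq_Rintegral _ _ _ _ _ (fun=> 0)).
  by rewrite Rintegral_cst// mul0r.
by move=> s _; rewrite rate_other// mul0r.
Qed.

Local Notation prQ := (pr Q).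
Let past := path_events Zdiscr [set r : R | 0 <= r <= t].

Let past_measurable G : past G -> measurable G.
Proof. by apply: measurable_path_events => r /= /andP[]. Qed.

Lemma pr_first_jump G x y : past G -> y != x ->
  prQ (G `&` (visits t x) `&` first_jump t u x y) =
  prQ (G `&` (visits t x)) * jump_mass x y.
Proof.
move=> pG yx; have [_ /(_ t u x y G)] := hQ.
rewrite t0 ltW// => /(_ isT yx pG) /= h.
apply/EFin_inj; rewrite EFinM -!prE//; last first.
- apply: measurableI; last by apply: measurable_first_jump => //; exact: ltW.
  by apply: measurableI; [exact: past_measurable|exact: measurable_at].
- by apply: measurableI; [exact: past_measurable|exact: measurable_at].
rewrite h; congr (_ * _%:E)%E; apply: eq_Rintegral => s.
rewrite inE/= in_itv/= => /andP[ts su].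
congr (_ * expR (- _)).
rewrite (@eq_Rintegral _ _ _ _ _ (fun=> lam)); last first.
  by move=> r _; rewrite rate_up rate_down; ring.
by rewrite Rintegral_cst// interval_length.
Qed.

(** Being away from [x] at time [u] requires a first jump. The two neighbours together contribute at
    most the integrated total rate, and the other targets give countably many null events. *)
Lemma pr_leave_lt G x : past G ->
  prQ (G `&` (visits t x) `\` (visits u x)) <=
  lam * (u - t) * prQ (G `&` (visits t x)).
Proof.
move=> pG; set H := G `&` _; have tu' : t <= u by exact: ltW.
have mH : measurable H.
  by apply: measurableI; [exact: past_measurable|exact: measurable_at].
have mJ y : y != x -> measurable (H `&` first_jump t u x y).
  by move=> yx; apply: measurableI => //; exact: measurable_first_jump.
have u0 : 0 <= u by exact: le_trans tu'.
pose far (y : int) := [&& y != x, y != x + 1 & y != x - 1].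
pose N k := if unpickle k is Some y then
  (if far y then H `&` first_jump t u x y else set0) else set0.
have N0 k : Q.-negligible (N k).
  rewrite /N; case: (unpickle k) => [y|]; last exact: negligible_set0.
  case: ifPn => [/and3P[yx y1 y2]|_]; last exact: negligible_set0.
  apply/negligibleP; first exact: mJ.
  have e : Q (H `&` first_jump t u x y) = 0%E.
    by rewrite (prE Q1 (mJ _ yx)) pr_first_jump ?jump_mass_other ?mulr0.
  exact: e.
have mN k : measurable (N k).
  rewrite /N; case: (unpickle k) => [y|]//.
  by case: ifPn => [/and3P[yx _ _]|_]//; exact: mJ.
have UN0 : prQ (\bigcup_k N k) = 0.
  rewrite /pr measure_negligible//; first exact: bigcupT_measurable.
  exact: negligible_bigcup.
have xp : x + 1 != x by apply/eqP; lia.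
have xm : x - 1 != x by apply/eqP; lia.
have mUN : measurable (\bigcup_k N k) by exact: bigcupT_measurable.
have sub : H `\` (visits u x) `<=`
    (H `&` first_jump t u x (x + 1) `|` H `&` first_jump t u x (x - 1)) `|`
    \bigcup_k N k.
  move=> X [HX Xu]; have [y yx jy] := exit_first_jump t0 tu' HX.2 Xu.
  have [e|y1] := eqVneq y (x + 1); first by left; left; rewrite -e.
  have [e|y2] := eqVneq y (x - 1); first by left; right; rewrite -e.
  by right; exists (pickle y) => //; rewrite /N pickleK /far yx y1 y2.
have mB : measurable (H `\` (visits u x)).
  by apply: measurableD => //; exact: measurable_at.
apply: le_trans (pr_le Q1 mB _ sub) _.
  by apply: measurableU => //; apply: measurableU; exact: mJ.
apply: le_trans (prU2 Q1 _ mUN) _; first by apply: measurableU; exact: mJ.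
rewrite UN0 addr0; apply: le_trans (prU2 Q1 _ _) _; [exact: mJ|exact: mJ|].
rewrite !pr_first_jump// -mulrDr mulrC ler_wpM2r ?pr_ge0//.
apply: le_trans (lerD (jump_mass_le _ _) (jump_mass_le _ _)) _.
by rewrite rate_mass_up rate_mass_down addrC subrK.
Qed.

End walk_estimates.

(** * Comparison of the quenched walk with the grid walk *)

Section walk_grid.
Context {R : realType}.
Variables (alpha beta : R) (xi : cadlag_path R config).
Variable Q : {measure set (cadlag_path R Zdiscr) -> \bar R}.
Hypotheses (Q1 : Q setT = 1%E) (beta0 : 0 < beta) (ab : beta < alpha).
Hypothesis hQ : jump_law (rwre_rate alpha beta xi) 0 Q.
Implicit Types (x y : int) (t u : R).

Local Notation lam := (alpha + beta).
Local Notation prQ := (pr Q).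
Local Notation past t := (path_events Zdiscr [set r : R | 0 <= r <= t]).

Let lam0 : 0 < lam.
Proof. by rewrite addr_gt0// (lt_trans beta0). Qed.

Lemma past_measurable t G : past t G -> measurable G.
Proof. by apply: measurable_path_events => r /= /andP[]. Qed.

Lemma past_le t u : t <= u -> past t `<=` past u.
Proof.
by move=> tu; apply: path_eventsS => r /= /andP[-> /le_trans]; exact.
Qed.

Lemma past_at t G x : 0 <= t -> past t G -> past t (G `&` (visits t x)).
Proof.
move=> t0 pG; apply: path_eventsI => //; apply: path_events_at => /=.
by rewrite t0 lexx.
Qed.

Lemma pr_leave t u G x : 0 <= t -> t <= u -> past t G ->
  prQ (G `&` (visits t x) `\` (visits u x)) <=
  lam * (u - t) * prQ (G `&` (visits t x)).
Proof.
move=> t0; rewrite le_eqVlt => /predU1P[<-|tu] pG; last first.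
  exact: (pr_leave_lt Q1 beta0 ab hQ t0 tu x pG).
rewrite subrr mulr0 mul0r (_ : _ `\` _ = set0) ?/pr ?measure0//.
by rewrite -subset0 => X [[]].
Qed.

Lemma pr_stay t u G x : 0 <= t -> t <= u -> past t G ->
  prQ (G `&` (visits t x)) * (1 - lam * (u - t)) <=
  prQ (G `&` (visits t x) `&` (visits u x)).
Proof.
move=> t0 tu pG; have := pr_leave x t0 tu pG.
have mH := past_measurable (past_at x t0 pG).
have := pr_split Q1 mH (measurable_at x (le_trans t0 tu)).
by lra.
Qed.

(** Since [jump_law] speaks of deterministic times only, the first jump is located in a cell of a
    fine grid. Leaving [x] within a cell of length h and then [y] before [u] has probability at most
    lam h times lam (u - t), and the cell lengths add up to u - t. *)
Lemma pr_two_jumps t u G x y : 0 <= t -> t < u -> past t G -> y != x ->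
  prQ (G `&` (visits t x) `&` first_jump t u x y `\` (visits u y)) <=
  (lam * (u - t)) ^+ 2 * prQ (G `&` (visits t x)).
Proof.
move=> t0 tu pG yx; set H := G `&` _; have tu' := ltW tu.
have pH : past t H by exact: past_at.
have u0 := le_trans t0 tu'.
have mH := past_measurable pH.
have mu_y : measurable (visits u y) by exact: measurable_at.
apply: (@pr_liminf _ _ _ _ Q1 _ (fun n => H `&` grid_jump t u n x y `\` (visits u y))).
- apply: (measurableD _ mu_y); apply: (measurableI _ _ mH).
  exact: measurable_first_jump.
- move=> n; apply: (measurableD _ mu_y); apply: (measurableI _ _ mH).
  exact: measurable_grid_jump.
- move=> X [[HX /(first_jump_near t0)[N _ hN]] Xu].
  by exists N => // n /hN.
move=> e e0; apply: nearW => n.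
pose s := node t u n.
have s_ge k : (k <= n.+1)%N -> 0 <= s k.
  by move=> kn; have /andP[h _] := node_bounds tu' kn; exact: le_trans h.
pose B k := if (k < n.+1)%N then
  H `&` (visits (s k) x) `&` (visits (s k.+1) y) `\` (visits u y) else set0.
have mB k : measurable (B k).
  rewrite /B; case: ifPn => // kn; apply: measurableD => //.
  apply: measurableI; first apply: measurableI => //;
    by apply: measurable_at; apply: s_ge => //; lia.
have le_B k : (k < n.+1)%N -> prQ (B k) <= lam * (u - t) * (lam * ((u - t) / n.+1%:R)) * prQ H.
  move=> kn; rewrite /B kn.
  have sk0 : 0 <= s k by apply: s_ge; lia.
  have sk1 : 0 <= s k.+1 by exact: s_ge.
  have ts : t <= s k by have /andP[] := node_bounds tu' (ltnW kn).
  have ss : s k <= s k.+1 by exact: ler_node.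
  have su : s k.+1 <= u by have /andP[] := node_bounds tu' kn.
  have pHk : past (s k) H by exact: past_le ts _ pH.
  have pHk1 : past (s k.+1) (H `&` (visits (s k) x)).
    by apply: past_le ss _ _; exact: past_at.
  apply: le_trans (pr_leave y sk1 su pHk1) _.
  have h1 : lam * (u - s k.+1) <= lam * (u - t).
    by rewrite ler_pM2l// lerD2l lerN2 (le_trans ts).
  rewrite -[leRHS]mulrA; apply: ler_pM => //.
  - by rewrite mulr_ge0 ?subr_ge0// ltW.
  - exact: pr_ge0.
  have mHk := past_measurable (past_at x sk0 pHk).
  have mk1 z : measurable (visits (s k.+1) z).
    exact: measurable_at.
  apply: (@le_trans _ _ (prQ (H `&` (visits (s k) x) `\` (visits (s k.+1) x)))).
    apply: (pr_le Q1 (measurableI _ _ mHk (mk1 y)) (measurableD mHk (mk1 x))).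
    by move=> X [HX /= Xy]; split => //= Xx; move: yx; rewrite -Xy Xx eqxx.
  apply: le_trans (pr_leave x sk0 ss pHk) _.
  have -> : s k.+1 - s k = (u - t) / n.+1%:R by rewrite /s nodeS addrAC subrr add0r.
  rewrite ler_wpM2l//.
    by rewrite mulr_ge0 ?divr_ge0 ?subr_ge0// ltW.
  by apply: pr_le => // X [].
apply: (@le_trans _ _ (prQ (\bigcup_(k < n.+1) B k))).
  apply: pr_le => //.
  - apply: (measurableD _ mu_y); apply: (measurableI _ _ mH).
    exact: measurable_grid_jump.
  - by apply: bigcup_measurable => k _; exact: mB.
  move=> X [[HX [k /= kn [hk Xk]]] Xu]; exists k => //; rewrite /B kn.
  exact: (conj (conj (conj HX (hk k (ltnSn k))) Xk) Xu).
apply: le_trans (pr_bigcup Q1 _ mB) _.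
apply: (@le_trans _ _ (\sum_(k < n.+1)
    lam * (u - t) * (lam * ((u - t) / n.+1%:R)) * prQ H)).
  by apply: ler_sum => k _; exact: le_B.
rewrite sumr_const card_ord -[leLHS]mulr_natr.
have -> : lam * (u - t) * (lam * ((u - t) / n.+1%:R)) * prQ H * n.+1%:R =
    (lam * (u - t)) ^+ 2 * prQ H * (n.+1%:R / n.+1%:R) by ring.
by rewrite divff ?pnatr_eq0// mulr1 lerDl ltW.
Qed.

(** One square is lost through the exponential damping of the jump density, which is at least 1 -
    lam (u - t); the other because the walk may jump again before [u]. *)
Lemma pr_move t u G x y : 0 <= t -> t < u -> past t G ->
  y = x + 1 \/ y = x - 1 ->
  prQ (G `&` (visits t x)) *
    (rate_mass alpha beta xi t u x y - 2 * (lam * (u - t)) ^+ 2) <=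
  prQ (G `&` (visits t x) `&` (visits u y)).
Proof.
move=> t0 tu pG hy; set H := G `&` _; have tu' := ltW tu.
have yx : y != x by apply/eqP; case: hy => ->; lia.
have u0 := le_trans t0 tu'.
have mH : measurable H by exact: past_measurable (past_at x t0 pG).
have mu_y : measurable (visits u y) by exact: measurable_at.
have mJ : measurable (H `&` first_jump t u x y).
  by apply: measurableI => //; exact: measurable_first_jump.
have h1 := pr_two_jumps t0 tu pG yx.
have h2 := pr_split Q1 mJ mu_y.
have h3 := pr_first_jump Q1 beta0 ab hQ t0 tu pG yx.
have h4 : prQ (H `&` first_jump t u x y `&` (visits u y)) <=
    prQ (H `&` (visits u y)).
  by apply: pr_le => //; [exact: measurableI|exact: measurableI|move=> X [[? _] ?]].
have h5 := jump_mass_ge xi beta0 ab t0 tu x y.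
have h67 : 0 <= rate_mass alpha beta xi t u x y <= lam * (u - t).
  have b0 := beta0; have ba := ab.
  have /andP[l0 l1] := occupation_bounds xi t0 tu x.
  have uw : 0 <= up_weight alpha beta xi x t u <= lam * (u - t).
    by rewrite /up_weight; apply/andP; split; nra.
  case: hy => ->; first by rewrite rate_mass_up.
  by rewrite rate_mass_down//; move: uw => /andP[? ?]; apply/andP; split; lra.
have /andP[h6 h7] := h67.
have p0 : 0 <= prQ H by exact: pr_ge0.
rewrite -/H in h1 h3.
have h8 : rate_mass alpha beta xi t u x y - (lam * (u - t)) ^+ 2 <=
   jump_mass alpha beta xi t u x y.
  apply: le_trans h5; rewrite mulrBl mul1r lerD2l lerN2 expr2.
  by apply: ler_wpM2l => //; exact: le_trans h6 h7.
have := ler_wpM2l p0 h8.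
by rewrite !mulrBr; lra.
Qed.

Variable N : nat.
Definition grid_time i : R := i%:R / N.+1%:R.
Local Notation tm := grid_time.
Definition move_prob : R := lam / N.+1%:R.
Definition up_prob i x := up_weight alpha beta xi x (tm i) (tm i.+1).

Lemma grid_time_ge0 i : 0 <= tm i.
Proof. by rewrite /grid_time divr_ge0. Qed.

Lemma grid_time_lt i : tm i < tm i.+1.
Proof. by rewrite /grid_time ltr_pM2r ?invr_gt0// ltr_nat. Qed.

Lemma grid_timeB i : lam * (tm i.+1 - tm i) = move_prob.
Proof. by rewrite /grid_time /move_prob -mulrBl -natrB// subSnn mul1r. Qed.

Lemma up_prob_bounds i x : 0 <= up_prob i x <= move_prob.
Proof.
have b0 := beta0; have ba := ab; rewrite /up_prob /up_weight -(grid_timeB i).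
have /andP[l0 l1] := occupation_bounds xi (grid_time_ge0 i) (grid_time_lt i) x.
have := grid_time_lt i; rewrite -subr_gt0.
move: (tm i.+1 - tm i) (occupation _ _ _ _) l0 l1 => h o l0 l1 h0.
by apply/andP; split; nra.
Qed.

Definition stays_in (A : nat -> set int) i n : set (cadlag_path R Zdiscr) :=
  \bigcap_(j < n.+1) [set X : cadlag_path R Zdiscr | A (i + j)%N (X (tm (i + j)))].

Lemma measurable_stays_in A i n : measurable (stays_in A i n).
Proof.
apply: bigcap_measurable; first by exists 0%N.
move=> j _; have oA : open (A (i + j)%N : set Zdiscr) by exact: discrete_open.
exact: (path_events_open (R := R) (grid_time_ge0 (i + j)) oA).
Qed.

Lemma stays_inS A i n :
  stays_in A i n.+1 = [set X : cadlag_path R Zdiscr | A i (X (tm i))] `&` stays_in A i.+1 n.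
Proof.
apply/seteqP; split=> X.
  move=> h; split; first by have := h 0%N isT; rewrite /= addn0.
  by move=> j /= jn; rewrite addSnnS; apply: h.
move=> [h0 h] [|j] /= jn; first by rewrite addn0.
by rewrite -addSnnS; apply: h.
Qed.

Hypothesis q1 : move_prob <= 1.

(** In each step the two neighbours lose 2 q^2 each by [pr_move], while standing still loses nothing
    by [pr_stay]. The total is of order 1 / N per unit of time. *)
Lemma pr_stays_in A n i x G : past (tm i) G ->
  prQ (G `&` (visits (tm i) x)) *
    (confined move_prob up_prob A i n x - 4 * move_prob ^+ 2 * n%:R) <=
  prQ (G `&` (visits (tm i) x) `&` stays_in A i n).
Proof.
have q01 : 0 <= move_prob <= 1 by rewrite q1 andbT divr_ge0// ltW.
elim: n i x G => [|n IH] i x G pG; set H := G `&` _.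
  rewrite mulr0 subr0 /=; case: asboolP => Ax; last by rewrite mulr0 pr_ge0.
  rewrite mulr1 (_ : H `&` _ = H)//; apply/seteqP; split => X; first by case.
  by move=> HX; split => // -[|//] _ /=; rewrite addn0 HX.2.
have p0 : 0 <= prQ H by exact: pr_ge0.
have pH : past (tm i) H by apply: past_at => //; exact: grid_time_ge0.
have pH1 : past (tm i.+1) H by apply: past_le pH; exact/ltW/grid_time_lt.
have mH := past_measurable pH.
rewrite [confined _ _ _ _ _ _]/=; case: asboolP => Ax; last first.
  apply: le_trans (pr_ge0 _ _); rewrite mulr_ge0_le0// sub0r oppr_le0.
  by apply: mulr_ge0 => //; apply: mulr_ge0 => //; exact: sqr_ge0.
pose E := stays_in A i.+1 n.
have mE : measurable E by exact: measurable_stays_in.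
have -> : H `&` stays_in A i n.+1 = H `&` E.
  rewrite stays_inS; apply/seteqP; split => X [HX]; first by case.
  by move=> EX; split=> //; split=> //=; rewrite HX.2.
pose at1 y := (visits (tm i.+1) y).
have m1 y : measurable (at1 y) by apply: measurable_at; exact: grid_time_ge0.
pose c y := confined move_prob up_prob A i.+1 n y.
have c01 y : 0 <= c y <= 1.
  by rewrite confined_ge0 ?confined_le1// => *; exact: up_prob_bounds.
(* The three possible landing sites are disjoint events, so the lower bounds for them may be
   added. *)
have three F : measurable F ->
    prQ (F `&` at1 (x + 1)) + prQ (F `&` at1 (x - 1)) + prQ (F `&` at1 x) <= prQ F.
  move=> mF; rewrite (pr_split Q1 mF (m1 (x + 1))) -addrA lerD2l.
  have mF1 : measurable (F `\` at1 (x + 1)) by exact: measurableD.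
  rewrite (pr_split Q1 mF1 (m1 (x - 1))).
  have at1_uniq y z X : at1 y X -> at1 z X -> y = z by move=> <- <-.
  apply: lerD; apply: (pr_le Q1 (measurableI _ _ mF (m1 _))).
  - exact: (measurableI _ _ mF1 (m1 _)).
  - move=> X [FX aX]; split=> //; split => // aX'.
    by have := at1_uniq _ _ _ aX aX'; lia.
  - exact: (measurableD mF1 (m1 _)).
  - move=> X [FX aX]; split; first split => // aX'.
      by have := at1_uniq _ _ _ aX aX'; lia.
    by move=> aX'; have := at1_uniq _ _ _ aX aX'; lia.
apply: le_trans (three _ (measurableI _ _ mH mE)).
have ih y : prQ (H `&` at1 y) * (c y - 4 * move_prob ^+ 2 * n%:R) <=
    prQ (H `&` E `&` at1 y).
  by rewrite setIAC; exact: IH.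
have h1 := ih (x + 1); have h2 := ih (x - 1); have h3 := ih x.
have ti := grid_time_ge0 i; have tl := grid_time_lt i.
have w1 := pr_move ti tl pG (or_introl erefl : x + 1 = x + 1 \/ x + 1 = x - 1).
have w2 := pr_move ti tl pG (or_intror erefl : x - 1 = x + 1 \/ x - 1 = x - 1).
have w3 := pr_stay x ti (ltW tl) pG.
rewrite grid_timeB in w1 w2 w3.
rewrite rate_mass_up// -/(up_prob i x) in w1.
rewrite rate_mass_down// grid_timeB -/(up_prob i x) in w2.
rewrite -/H -/(at1 _) in w1 w2 w3.
have w0 := three _ mH.
rewrite /step -/(c _) -/(c (x - 1)) -/(c x).
have /andP[c10 c11] := c01 (x + 1); have /andP[c20 c21] := c01 (x - 1).
have /andP[c30 c31] := c01 x.
have s0 := sqr_ge0 move_prob.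
have n0 : 0 <= 4 * move_prob ^+ 2 * n%:R by apply: mulr_ge0 => //; apply: mulr_ge0.
have v1 := ler_wpM2r c10 w1; have v2 := ler_wpM2r c20 w2; have v3 := ler_wpM2r c30 w3.
have v0 := ler_wpM2l n0 w0.
have k1 : prQ H * (2 * move_prob ^+ 2) * c (x + 1) <= prQ H * (2 * move_prob ^+ 2).
  by apply: ler_piMr => //; apply: mulr_ge0 => //; apply: mulr_ge0.
have k2 : prQ H * (2 * move_prob ^+ 2) * c (x - 1) <= prQ H * (2 * move_prob ^+ 2).
  by apply: ler_piMr => //; apply: mulr_ge0 => //; apply: mulr_ge0.
have eN : (n.+1%:R : R) = n%:R + 1 by rewrite natr1.
rewrite eN.
move: (prQ (H `&` at1 (x + 1))) (prQ (H `&` at1 (x - 1))) (prQ (H `&` at1 x))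
  (c (x + 1)) (c (x - 1)) (c x) (prQ H) h1 h2 h3 v1 v2 v3 v0 k1 k2.
by move=> a1 a2 a3 e1 e2 e3 P0; lra.
Qed.

End walk_grid.

(** * Events of the environment *)

Lemma sigma_preimage (aT rT : Type) (f : aT -> rT) (G : set (set rT))
    (D : set (set aT)) :
  (forall A, G A -> (<<s D>>) (f @^-1` A)) ->
  forall A, (<<s G>>) A -> (<<s D>>) (f @^-1` A).
Proof.
move=> GD; have sD := smallest_sigma_algebra setT D.
apply: (smallest_sub (X := [set A | (<<s D>>) (f @^-1` A)])) => //; split => /=.
- by rewrite preimage_set0; case: sD.
- by move=> A hA; rewrite setTD preimage_setC -setTD; case: sD => _ + _; apply.
- by move=> F hF; rewrite preimage_bigcup; case: sD => _ _; apply.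
Qed.

Section config_sigma_algebra.
Implicit Types (eta zeta : config) (U : set config).

(** Cylinder sets, with the sites enumerated by [pickle]. *)
Definition agree n eta : set config :=
  [set zeta | forall x : int, (pickle x < n)%N -> zeta x = eta x].

Definition bits_config (e : seq bool) : config :=
  fun x : int => nth false e (pickle x).

Definition sites : set (set config) :=
  [set A | exists x b, A = [set eta : config | eta x = b]].

(** Otherwise some sequence outside [U] would agree with [eta] on more and more sites, hence
    converge to [eta]. *)
Lemma open_agree U eta : open U -> U eta -> exists n, agree n eta `<=` U.
Proof.
move=> oU Ueta; apply: contrapT => /forallNP h.
have /choice[z hz] : forall n, exists zeta, agree n eta zeta /\ ~ U zeta.
  by move=> n; have /existsNP[zeta /not_implyP] := h n; exists zeta.
have cz : z @ \oo --> eta.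
  have /= := @pointwise_cvgP (discrete_topology int) bool (z @ \oo) eta _.
  case=> _; apply => x; apply: cvg_near_cst; exists (pickle x).+1 => // n /= xn.
  by have [/(_ x xn)] := hz n.
have : nbhs eta U by exact: open_nbhs_nbhs.
by move=> /cz[N _ /(_ N (leqnn N))]; have [] := hz N.
Qed.

Lemma sites_agree n eta : (<<s sites>>) (agree n eta).
Proof.
pose F j : set config := if unpickle j is Some x then
  [set zeta | (pickle (x : int) < n)%N -> zeta x = eta x] else setT.
have -> : agree n eta = \bigcap_j F j.
  apply/seteqP; split => zeta h.
    by move=> j _; rewrite /F; case: unpickle => // x; exact: h.
  by move=> x; have := h (pickle x) I; rewrite /F pickleK.
apply: (@bigcapT_measurable _ (g_sigma_algebraType sites)) => j.
rewrite /F; case: unpickle => [x|]; last exact: measurableT.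
have [xn|xn] := ltnP (pickle x) n.
  rewrite (_ : [set _ | _] = [set zeta : config | zeta x = eta x]).
    by apply: sub_gen_smallest; exists x, (eta x).
  by apply/seteqP; split => zeta /= h //; exact: h.
by rewrite (_ : [set _ | _] = setT); [exact: measurableT|rewrite -subTset].
Qed.

(** An open set is the union of the cylinders inside it, and cylinders are countably many because
    finite bit strings are. *)
Lemma sites_open U : open U -> (<<s sites>>) U.
Proof.
move=> oU.
pose F j : set config := if unpickle j is Some e then
  (if `[< agree (size (e : seq bool)) (bits_config e) `<=` U >]
   then agree (size e) (bits_config e) else set0) else set0.
have -> : U = \bigcup_j F j.
  apply/seteqP; split => eta; last first.
    move=> [j _]; rewrite /F; case: unpickle => // e; case: asboolP => // h.
    exact: h.
  move=> /(open_agree oU)[n hn].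
  pose e := mkseq (fun j => if unpickle j is Some x then eta x else false) n.
  have ae : agree n eta = agree (size e) (bits_config e).
    rewrite size_mkseq /bits_config; apply/seteqP; split => zeta h x xn.
      by rewrite nth_mkseq// pickleK; exact: h.
    by rewrite h// nth_mkseq// pickleK.
  exists (pickle e) => //; rewrite /F pickleK -ae; case: asboolP => [_ //|].
  by move=> /(_ hn).
apply: (@bigcupT_measurable _ (g_sigma_algebraType sites)) => j.
rewrite /F; case: unpickle => [e|]; last exact: measurable0.
by case: asboolP => _; [exact: sites_agree|exact: measurable0].
Qed.

Lemma sites_measurable (A : set config) : measurable A -> (<<s sites>>) A.
Proof.
apply: smallest_sub; first exact: smallest_sigma_algebra.
by move=> U; exact: sites_open.
Qed.

Lemma site_open x b : open [set eta : config | eta x = b].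
Proof.
have := @open_comp _ _ (fun eta : config => eta x) [set b].
by apply=> [eta _|]; [exact: config_eval_continuous|exact: discrete_open].
Qed.

Lemma measurable_space_shift z : measurable_fun setT (space_shift z).
Proof.
move=> _ A mA; rewrite setTI.
apply: (sigma_preimage (f := space_shift z) _ mA) => U oU.
apply: sub_gen_smallest; apply: open_comp => // eta _.
exact: continuous_space_shift.
Qed.

End config_sigma_algebra.

Section path_shift.
Context {R : realType}.
Implicit Types (w : cadlag_path R config).

Lemma path_ext (T : ptopologicalType) (w v : cadlag_path R T) :
  (forall t, w t = v t) -> w = v.
Proof.
case: w v => [w cw] [v cv] /= /funext wv; subst v.
by congr Path; exact: Prop_irrelevance.
Qed.

Lemma path_events_preimage (f : cadlag_path R config -> cadlag_path R config)
    (I J : set R) :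
  (forall s (U : set config), J s -> open U ->
     path_events config I (f @^-1` [set w : cadlag_path R config | U (w s)])) ->
  forall A, path_events config J A -> path_events config I (f @^-1` A).
Proof. by move=> h; apply: sigma_preimage => A [s [U [Js oU ->]]]; exact: h. Qed.

Lemma measurable_space_time_shift z (s : {nonneg R}) :
  measurable_fun setT (space_time_shift z s).
Proof.
move=> _ A mA; rewrite setTI.
apply: (path_events_preimage (f := space_time_shift z s) _ mA) => r U /= r0 oU.
have oV : open (space_shift z @^-1` U).
  by apply: open_comp => // eta _; exact: continuous_space_shift.
by apply: (path_events_open (R := R) _ oV) => /=; rewrite addr_ge0.
Qed.

Lemma measurable_eval (s : R) : 0 <= s ->
  measurable_fun setT (fun w : cadlag_path R config => w s).
Proof.
move=> s0 _ A mA; rewrite setTI.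
apply: (sigma_preimage (f := fun w : cadlag_path R config => w s) _ mA) => U oU.
exact: (path_events_open (R := R) (I := [set r | 0 <= r]) s0 oU).
Qed.

Lemma site_events_path (S : set (int * R)) (I : set R) :
  (forall p, S p -> I p.2) ->
  forall A, site_events S A -> path_events config I A.
Proof.
move=> SI; apply: smallest_sub; first exact: smallest_sigma_algebra.
move=> A [x [s [b [Sxs ->]]]].
exact: (path_events_open (R := R) (SI _ Sxs) (@site_open x b)).
Qed.

(** The kernel produces Borel sets of configurations, whereas cone mixing is stated for events
    generated by sites; this passes from the former to the latter at time 0. *)
Lemma site_events_start (A0 : set config) : measurable A0 ->
  site_events [set p | p.2 = 0] [set w : cadlag_path R config | A0 (w 0)].
Proof.
move=> /sites_measurable.
apply: (sigma_preimage (f := fun w : cadlag_path R config => w 0)).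
by move=> A [x [b ->]]; apply: sub_gen_smallest; exists x, 0, b.
Qed.

Lemma measurable_start (eta : config) :
  measurable [set w : cadlag_path R config | w 0 = eta].
Proof.
rewrite (_ : [set _ | _] = \bigcap_j (if unpickle j is Some x then
  [set w : cadlag_path R config | w 0 (x : int) = eta x] else setT)).
  apply: bigcapT_measurable => j; case: unpickle => [x|] //.
  exact: (path_events_open (R := R) (I := [set r | 0 <= r]) (lexx 0) (@site_open x (eta x))).
apply/seteqP; split => [w wE j _|w h] /=.
  by case: unpickle => // x; rewrite /= wE.
by apply/funext => x; have := h (pickle x) I; rewrite pickleK.
Qed.

Lemma cone_time (theta t : R) p : cone theta t p -> 0 <= p.2.
Proof. by case. Qed.

End path_shift.

(** * Decorrelation on cones *)

Section mixture_bounds.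
Context d d' (X : measurableType d) (Y : measurableType d') (R : realType).
Variables (mu : probability X R) (k : R.-pker X ~> Y).
Implicit Types (A B C : set Y) (c : R).

Lemma pr_mixture_le A B C c : measurable A -> measurable B -> measurable C ->
  (forall x, pr (k x) A <= c * pr (k x) B + pr (k x) C) ->
  pr (mixture mu k) A <= c * pr (mixture mu k) B + pr (mixture mu k) C.
Proof.
move=> mA mB mC h; rewrite !pr_mixtureE//.
have bA := bmf_kernel k mA; have bB := bmf_kernel k mB; have bC := bmf_kernel k mC.
rewrite -(meanZ mu c bB) -meanD//; last exact: bmfZ.
by apply: le_mean => //; apply: bmfD => //; exact: bmfZ.
Qed.

Lemma pr_mixture_ge A B c : measurable A -> measurable B ->
  (forall x, c * pr (k x) B <= pr (k x) A) ->
  c * pr (mixture mu k) B <= pr (mixture mu k) A.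
Proof.
move=> mA mB h; rewrite !pr_mixtureE//.
have bA := bmf_kernel k mA; have bB := bmf_kernel k mB.
by rewrite -(meanZ mu c bB); apply: le_mean => //; exact: bmfZ.
Qed.

End mixture_bounds.

(** The form in which mixing is used: the past event may depend on all times up to [s], and the apex
    of the shifted cone lies [L] time units above the site [z] at time [s]. *)
Definition cone_decorrelated (R : realType)
    (M : probability (cadlag_path R config) R) (theta L phi : R) :=
  forall (s : {nonneg R}) z G B,
    path_events config [set r | 0 <= r <= s%:num] G ->
    site_events (cone theta L) B ->
    `|pr M (G `&` space_time_shift z s @^-1` B) - pr M G * pr M B| <=
    phi * pr M G.

Lemma slack_null (R : realType) (b phi x m : R) : 0 < phi -> 0 <= m ->
  x <= (b + phi) * m -> (b + 2 * phi) * m <= x -> m = 0.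
Proof. by move=> phi0 m0 h1 h2; nra. Qed.

Section decorrelation.
Context {R : realType}.
Variables (P : R.-pker config ~> cadlag_path R config) (mu : probability config R).
Hypothesis hP : interacting_particle_system P.
Let M := mixture mu P.
Hypothesis hstat : stationary M.
Local Notation path := (cadlag_path R config).
Local Notation prM := (pr M).

Let M1 : M setT = 1%E. Proof. exact: probability_setT. Qed.
Let P1 eta : P eta setT = 1%E. Proof. exact: prob_kernel. Qed.

Definition starts_in (A0 : set config) : set path := [set w | A0 (w 0)].

Lemma measurable_starts_in A0 : measurable A0 -> measurable (starts_in A0).
Proof.
move=> mA; rewrite -[starts_in A0]setTI.
exact: (measurable_eval (lexx (0 : R)) measurableT mA).
Qed.

Let start_null eta : pr (P eta) (~` [set w : path | w 0 = eta]) = 0.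
Proof.
rewrite (prC (P1 eta)) /pr ?(ips_start hP eta) ?subrr//.
exact: measurable_start.
Qed.

(** Under [P eta] the path starts at [eta] almost surely, so [starts_in A0] has probability 0 or
    1. *)
Lemma pr_starts_in eta A0 B : measurable A0 -> measurable B ->
  pr (P eta) (B `&` starts_in A0) = if `[< A0 eta >] then pr (P eta) B else 0.
Proof.
move=> mA0 mB; have mA := measurable_starts_in mA0.
pose S := [set w : path | w 0 = eta]; have mS : measurable S by exact: measurable_start.
have mBA := measurableI _ _ mB mA; have mBS := measurableI _ _ mB mS.
have null D : measurable D -> D `<=` ~` S -> pr (P eta) D = 0.
  move=> mD DS; apply/le_anti/andP; split; last exact: pr_ge0.
  by rewrite -(start_null eta); exact: (pr_le (P1 eta) mD (measurableC mS) DS).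
case: asboolP => h.
  apply/le_anti/andP; split; first by apply: (pr_le (P1 eta) mBA mB).
  rewrite (pr_split (P1 eta) mB mS) (null (B `\` S)) ?addr0.
  - apply: (pr_le (P1 eta) mBS mBA) => w [Bw w0]; split => //.
    by rewrite /starts_in/= w0.
  - exact: measurableD.
  - by move=> w [].
apply: null => // w [_ Aw] w0; apply: h.
by rewrite -w0.
Qed.

Lemma measurable_preimage_shift z s (B : set path) : measurable B ->
  measurable (space_time_shift z s @^-1` B).
Proof.
by move=> mB; have := measurable_space_time_shift z s measurableT mB; rewrite setTI.
Qed.

Lemma pr_shift z s B : measurable B -> prM (space_time_shift z s @^-1` B) = prM B.
Proof. by move=> mB; congr fine; exact: hstat. Qed.

Lemma space_time_shiftE z s :
  space_time_shift z s = space_time_shift z 0%:nng \o time_shift s :> (path -> path).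
Proof. by apply/funext => w; apply: path_ext => t /=; rewrite addr0. Qed.

Lemma time_shiftE s : time_shift s = space_time_shift 0 s :> (path -> path).
Proof.
apply/funext => w; apply: path_ext => t /=.
by apply/funext => x; rewrite /space_shift addr0.
Qed.

Variables (B : set path) (b phi : R).
Hypotheses (mB : measurable B) (b0 : 0 <= b) (phi0 : 0 < phi).

Let event_kernel := [set eta | b + 2 * phi <= pr (P eta) B].

Let measurable_event_kernel : measurable event_kernel.
Proof.
have mk : measurable_fun setT (fun eta => P eta B) by exact: measurable_kernel.
have := emeasurable_fun_c_infty measurableT mk (b + 2 * phi)%:E.
rewrite setTI; congr measurable; apply/seteqP; split => eta /=.
  by rewrite (prE (P1 eta) mB) lee_fin.
by rewrite (prE (P1 eta) mB) lee_fin.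
Qed.

(** Upgrades a bound given the configuration at time 0 to one given the whole past. The
    configurations in [event_kernel] have measure zero, for a start there would give [B] a
    conditional probability above [b + phi]. By stationarity they are avoided at time [s] as well,
    and the Markov property concludes. The second [phi] provides the strict gap. *)
Lemma markov_upper_bound (s : {nonneg R}) G :
  (forall A0, measurable A0 ->
     prM (B `&` starts_in A0) <= (b + phi) * prM (starts_in A0)) ->
  path_events config [set r | 0 <= r <= s%:num] G ->
  prM (G `&` time_shift s @^-1` B) <= (b + 2 * phi) * prM G.
Proof.
move=> hB pG.
have mG : measurable G by apply: measurable_path_events pG => r /= /andP[].
have mA := measurable_starts_in measurable_event_kernel.
have null : prM (starts_in event_kernel) = 0.
  have h1 := hB _ measurable_event_kernel.
  have h2 : (b + 2 * phi) * prM (starts_in event_kernel) <=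
      prM (B `&` starts_in event_kernel).
    apply: pr_mixture_ge => //; first exact: measurableI.
    move=> eta; rewrite -{1}[starts_in _]setTI !pr_starts_in//.
    by case: asboolP => h; rewrite ?mulr0// (prT (P1 eta)) mulr1.
  exact: slack_null phi0 (pr_ge0 _ _) h1 h2.
pose N := time_shift s @^-1` starts_in event_kernel.
have mN : measurable N by rewrite /N time_shiftE; exact: measurable_preimage_shift.
have N0 : prM N = 0 by rewrite /N time_shiftE pr_shift.
have c0 : 0 <= b + 2 * phi by rewrite addr_ge0// mulr_ge0// ltW.
have mGB : measurable (G `&` time_shift s @^-1` B).
  by apply: measurableI => //; rewrite time_shiftE; exact: measurable_preimage_shift.
rewrite -[leRHS]addr0 -N0; apply: pr_mixture_le => // eta.
rewrite -lee_fin EFinD EFinM -!(prE (P1 eta))// (ips_markov hP)//.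
apply: (@le_trans _ _ (\int[P eta]_(w in G) ((b + 2 * phi)%:E + (\1_N w)%:E))%E).
  apply: ge0_le_integral => //.
  - apply: measurable_funTS.
    have mk : measurable_fun setT (fun eta => P eta B) by exact: measurable_kernel.
    exact: (measurableT_comp mk (measurable_eval (ge0 s))).
  - apply: emeasurable_funD => //; apply/measurable_EFinP.
    exact: measurable_indic.
  move=> w Gw; rewrite (prE (P1 _) mB) -EFinD lee_fin indicE.
  have [wN|wN] := boolP (w \in N).
    by rewrite (le_trans (pr_le1 (P1 _) mB))// lerDr.
  rewrite addr0 leNgt; apply/negP => h; move: wN => /negP; apply.
  by rewrite inE /N /= /starts_in /event_kernel /= add0r ltW.
rewrite ge0_integralD//; last first.
  apply/measurable_EFinP; exact: measurable_indic.
rewrite integral_cst// integral_indic//; apply: leeD => //.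
by apply: le_measure; rewrite ?inE//; exact: measurableI.
Qed.

End decorrelation.

Section cone_decorrelation.
Context {R : realType}.
Variables (P : R.-pker config ~> cadlag_path R config) (mu : probability config R).
Hypothesis hP : interacting_particle_system P.
Local Notation M := (mixture mu P).
Hypothesis hstat : stationary M.
Local Notation path := (cadlag_path R config).
Local Notation prM := (pr M).
Variables (theta L phi : R).
Hypothesis phi0 : 0 < phi.
Hypothesis mix : (cone_dependence M theta L <= phi%:E)%E.

Let M1 : M setT = 1%E. Proof. exact: probability_setT. Qed.

Lemma measurable_cone_event B : site_events (cone theta L) B -> measurable B.
Proof. by apply: site_events_path => p; exact: cone_time. Qed.

Lemma cone_upper_bound (s : {nonneg R}) z G B :
  path_events config [set r | 0 <= r <= s%:num] G ->
  site_events (cone theta L) B ->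
  prM (G `&` space_time_shift z s @^-1` B) <= (prM B + 2 * phi) * prM G.
Proof.
move=> pG cB; have mB := measurable_cone_event cB.
rewrite space_time_shiftE.
have -> : (space_time_shift z 0%:nng \o time_shift s) @^-1` B =
  time_shift s @^-1` (space_time_shift z 0%:nng @^-1` B) by [].
apply: markov_upper_bound => //.
- exact: measurable_preimage_shift.
- exact: pr_ge0.
(* The shift by [z] is moved from [B] to the set of starting configurations, since [cone_dependence]
   concerns the unshifted cone. *)
move=> A0 mA0; pose A1 := space_shift (- z) @^-1` A0.
have mA1 : measurable A1.
  by have := measurable_space_shift (- z) measurableT mA0; rewrite setTI.
have mSA1 := measurable_starts_in (R := R) mA1.
have eA : starts_in A0 = space_time_shift z 0%:nng @^-1` starts_in A1 :> set path.
  apply/seteqP; split => w; rewrite /starts_in /A1 /= addr0;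
  by congr A0; apply/funext => x; rewrite /space_shift/= subrK.
rewrite eA -preimage_setI !pr_shift//; last exact: measurableI.
have [A10|A10] := eqVneq (prM (starts_in A1)) 0.
  rewrite A10 mulr0 -A10; apply: (pr_le M1) => //; exact: measurableI.
have pA1 : 0 < prM (starts_in A1) by rewrite lt0r A10 pr_ge0.
have : (`|cond_prob M B (starts_in A1) - prM B|%:E <= phi%:E)%E.
  apply: le_trans mix; apply: ereal_sup_ubound.
  exists (starts_in A1), B; split => //; first exact: site_events_start.
  by rewrite (prE M1 mSA1) lte_fin.
rewrite lee_fin ler_norml => /andP[_]; rewrite lerBlDl => h.
by rewrite -ler_pdivrMr.
Qed.

(** The lower half is the upper bound for the complement of [B], which is again a cone event. *)
Lemma cone_decorrelation : cone_decorrelated M theta L (2 * phi).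
Proof.
move=> s z G B pG cB; have mB := measurable_cone_event cB.
have mG : measurable G by apply: measurable_path_events pG => r /= /andP[].
have mSB := measurable_preimage_shift z s mB.
have cCB : site_events (cone theta L) (~` B).
  exact: (@measurableC _ (g_sigma_algebraType _)).
have h1 := cone_upper_bound z pG cB.
have h2 := cone_upper_bound z pG cCB.
rewrite preimage_setC -setDE (prC M1 mB) in h2.
have h3 := pr_split M1 mG mSB.
rewrite ler_norml; apply/andP; split; lra.
Qed.

End cone_decorrelation.

(** * The grid walk in a random environment *)

Section grid_rates.
Context {R : realType}.
Variables (alpha beta : R) (N : nat).
Local Notation path := (cadlag_path R config).
Local Notation tm := (@grid_time R N).
Local Notation up w := (@up_prob R alpha beta w N).
Implicit Types (w : path) (x y : int).

Definition grid_shift x i : path -> path :=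
  space_time_shift x (NngNum (@grid_time_ge0 R N i)).

Lemma grid_timeD i j : tm (i + j) = tm i + tm j.
Proof. by rewrite /grid_time natrD mulrDl. Qed.

Lemma grid_timeS i : tm i.+1 = tm i + N.+1%:R^-1.
Proof. by rewrite -addn1 grid_timeD /grid_time mul1r. Qed.

Lemma ler_grid_time i j : (i <= j)%N -> tm i <= tm j.
Proof. by move=> ij; rewrite /grid_time ler_pM2r ?invr_gt0// ler_nat. Qed.

Let occupation_cvg w x i :
  right_sum (fun s => w s x) (tm i) N.+1%:R^-1 n @[n --> \oo] -->
  occupation w x (tm i) (tm i.+1).
Proof.
rewrite grid_timeS; apply: right_sum_cvg; rewrite ?invr_gt0//.
- exact: grid_time_ge0.
- exact: site_right_constant.
Qed.

Lemma adapted_up (F : set (set path)) x i : sigma_algebra setT F ->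
  (forall s b, tm i <= s <= tm i.+1 -> F [set w : path | w s x = b]) ->
  adapted F (fun w => up w i x).
Proof.
move=> sF hF; rewrite /up_prob /up_weight.
apply: adaptedD; first exact: adapted_cst.
apply: adaptedM; first exact: adapted_cst.
apply: (adapted_cvg (h := fun n w =>
  right_sum (fun s => w s x) (tm i) N.+1%:R^-1 n)); last first.
  by move=> w; exact: occupation_cvg.
move=> n; apply: (@measurable_sum _ (g_sigma_algebraType F)) => k.
apply: (@measurable_funM _ (g_sigma_algebraType F)) => //.
set s := _ + _.
have hs : tm i <= s <= tm i.+1.
  rewrite grid_timeS /s lerDl divr_ge0 ?mulr_ge0//= lerD2l ler_pdivrMr//.
  by rewrite ler_pM2l ?invr_gt0// ler_nat.
have := adapted_indic (R := R) (hF s true hs).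
congr (adapted F _); apply/funext => w; rewrite indicE; congr (nat_of_bool _)%:R.
by apply/idP/idP; rewrite inE.
Qed.

(** Both occupation integrals are limits of the same Riemann sums, which replaces a change of
    variables. *)
Lemma up_shift w x y i j : up (grid_shift x i w) j y = up w (i + j) (x + y).
Proof.
rewrite /up_prob /up_weight; congr (_ * _ + _ * _).
  by rewrite !grid_timeS; ring.
rewrite -(cvg_lim (@Rhausdorff R) (@occupation_cvg w (x + y) (i + j))).
apply/esym/(cvg_lim (@Rhausdorff R)).
have e n : right_sum (fun s => grid_shift x i w s y) (tm j) N.+1%:R^-1 n =
    right_sum (fun s => w s (x + y)) (tm (i + j)) N.+1%:R^-1 n.
  apply: eq_bigr => k _.
  congr (_ * (nat_of_bool _)%:R); rewrite /= /space_shift [y + x]addrC; congr (w _ _).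
  by rewrite grid_timeD; ring.
have := @occupation_cvg (grid_shift x i w) y j.
by under eq_cvg do rewrite e.
Qed.

End grid_rates.

Section functional_decorrelation.
Context {R : realType}.
Variable N : nat.
Local Notation path := (cadlag_path R config).
Local Notation tm := (@grid_time R N).
Local Notation env_past i := (path_events config [set r : R | 0 <= r <= tm i]).
Variable M : probability path R.
Hypothesis hstat : stationary M.
Local Notation E := (mean M).
Local Notation prM := (pr M).
Local Notation shift := (@grid_shift R N).
Implicit Types (f g : path -> R) (x y : int).

Let M1 : M setT = 1%E. Proof. exact: probability_setT. Qed.

(** Stands for conditioning on the environment up to a grid time. Functions are used instead of
    events because transition probabilities of the walk enter as factors. *)
Definition past_weight i f := adapted (env_past i) f /\ forall w, 0 <= f w <= 1.

Lemma sigma_env_past i : sigma_algebra setT (env_past i).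
Proof. exact: smallest_sigma_algebra. Qed.

Lemma env_past_measurable i : env_past i `<=` measurable.
Proof. by move=> A; apply: measurable_path_events => r /= /andP[]. Qed.

Lemma adapted_bmf F f c : F `<=` measurable -> sigma_algebra setT F ->
  adapted F f -> (forall w, `|f w| <= c) -> bounded_mfun f.
Proof.
move=> Fm sF af fc; split; last by exists c.
move=> _ Y mY; apply: Fm; rewrite -[F](sigma_algebra_id sF).
exact: (af measurableT _ mY).
Qed.

Lemma past_weight_bmf i f : past_weight i f -> bounded_mfun f.
Proof.
move=> [af f01]; apply: (adapted_bmf (c := 1) _ _ af).
- exact: env_past_measurable.
- exact: sigma_env_past.
- by move=> w; have /andP[? ?] := f01 w; rewrite ger0_norm.
Qed.

Lemma past_weight_le i j f : (i <= j)%N -> past_weight i f -> past_weight j f.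
Proof.
move=> ij [af f01]; split => //; apply: adaptedS af.
apply: path_eventsS => r /= /andP[-> ri]/=.
exact: le_trans ri (ler_grid_time N ij).
Qed.

Lemma past_weightM i f g : past_weight i f -> past_weight i g ->
  past_weight i (fun w => f w * g w).
Proof.
move=> [af f01] [ag g01]; split; first exact: adaptedM.
move=> w; have /andP[f0 f1] := f01 w; have /andP[g0 g1] := g01 w.
by rewrite mulr_ge0//= mulr_ile1.
Qed.

Lemma past_weight1 i : past_weight i (fun=> 1).
Proof. by split; [exact: adapted_cst|move=> w; rewrite ler01 lexx]. Qed.

Lemma mean_past_ge0 i f : past_weight i f -> 0 <= E f.
Proof. by move=> [_ f01]; apply: mean_ge0 => w; have /andP[] := f01 w. Qed.

Lemma normr_mean_weight i f g c : past_weight i f -> bounded_mfun g ->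
  (forall w, `|g w| <= c) -> `|E (fun w => f w * g w)| <= c * E f.
Proof.
move=> pf bg gc; have bf := past_weight_bmf pf.
have f0 w : 0 <= f w by have /andP[] := pf.2 w.
rewrite ler_norml -mulNr -!meanZ//; apply/andP; split.
  apply: le_mean; [exact: bmfZ|exact: bmfM|] => w.
  rewrite mulrC ler_wpM2l//; by have := gc w; rewrite ler_norml => /andP[].
apply: le_mean; [exact: bmfM|exact: bmfZ|] => w.
rewrite mulrC ler_wpM2r//; by have := gc w; rewrite ler_norml => /andP[].
Qed.

Lemma measurable_grid_shift x i : measurable_fun setT (shift x i).
Proof. exact: measurable_space_time_shift. Qed.

Lemma bmf_shift x i g : bounded_mfun g -> bounded_mfun (g \o shift x i).
Proof.
move=> [mg [c gc]]; split; last by exists c => w; exact: gc.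
exact: (measurableT_comp mg (measurable_grid_shift x i)).
Qed.

Lemma mean_shift x i g : bounded_mfun g -> E (g \o shift x i) = E g.
Proof.
move=> bg; have mS := measurable_grid_shift x i.
rewrite /mean /Rintegral; congr fine.
have := @integral_pushforward _ _ path path R _ mS M setT (EFin \o g).
rewrite preimage_setT => <- //.
- apply: eq_measure_integral => A mA _; rewrite /pushforward; exact: hstat.
- by apply/measurable_EFinP; case: bg.
- exact: (bmf_integrable M (bmf_shift x i bg)).
Qed.

Variables (theta L phi : R).
Hypothesis phi0 : 0 <= phi.
Hypothesis decor : cone_decorrelated M theta L phi.

Lemma sigma_cone_events : sigma_algebra setT (site_events (cone theta L)).
Proof. exact: smallest_sigma_algebra. Qed.

Lemma cone_events_measurable : site_events (cone theta L) `<=` measurable.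
Proof. by move=> A; exact: measurable_cone_event. Qed.

Let sign_norm (a b : R) : (forall s : bool, (-1) ^+ s * a <= b) -> `|a| <= b.
Proof.
move=> h; rewrite ler_norml; have := h true; have := h false.
by rewrite expr0 expr1 mul1r mulN1r => h1 h2; rewrite lerNl h2.
Qed.

Let norm_sign (a b : R) (s : bool) : `|a| <= b -> (-1) ^+ s * a <= b.
Proof. by move=> h; apply: le_trans h; rewrite -[leRHS](normrMsign s) ler_norm. Qed.

(** [functional_layers] replaces the cone event by a function [g]; the sign [s] yields both halves
    of the absolute value. *)
Let decor_event i x F g : env_past i F -> adapted (site_events (cone theta L)) g ->
  (forall w, 0 <= g w <= 1) ->
  `|E (fun w => \1_F w * g (shift x i w)) - prM F * E g| <= phi * prM F.
Proof.
move=> pF ag g01; have mF := env_past_measurable pF.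
have bF : bounded_mfun (\1_F : path -> R) by exact: bmf_indic.
have F01 w : 0 <= (\1_F w : R) <= 1.
  by rewrite indicE; case: (_ \in _); rewrite /= ?lexx ler01.
apply: sign_norm => s.
apply: (@functional_layers _ _ _ (site_events (cone theta L))
  (fun g => (-1) ^+ s * (E (fun w => \1_F w * g (shift x i w)) - prM F * E g)) 2).
- exact: sigma_cone_events.
- exact: cone_events_measurable.
- move=> a f h bf bh.
  have bfs := bmf_shift x i bf; have bhs := bmf_shift x i bh.
  rewrite meanD ?meanZ//; last exact: bmfZ.
  rewrite (_ : (fun w => _) =
    fun w => a * (\1_F w * f (shift x i w)) + \1_F w * h (shift x i w)).
    rewrite meanD ?meanZ//; first by ring.
    + exact: bmfM.
    + by apply: bmfZ; exact: bmfM.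
    + exact: bmfM.
  by apply/funext => w; ring.
- move=> f c bf fc; apply: norm_sign.
  have c0 : 0 <= c by exact: le_trans (normr_ge0 _) (fc point).
  apply: le_trans (ler_normB _ _) _; rewrite mulrDl mul1r; apply: lerD.
    apply: mean_norm_le; first by apply: bmfM => //; exact: bmf_shift.
    move=> w; rewrite normrM; have /andP[F0 F1] := F01 w.
    by rewrite ger0_norm// -[leRHS]mul1r; exact: ler_pM.
  rewrite normrM ger0_norm ?pr_ge0// -[leRHS]mul1r; apply: ler_pM => //.
  + exact: pr_ge0.
  + exact: pr_le1.
  + exact: mean_norm_le.
- move=> B cB; apply: norm_sign; have mB := cone_events_measurable cB.
  rewrite mean_indic//.
  have -> : (fun w => \1_F w * \1_B (shift x i w)) =
      \1_(F `&` shift x i @^-1` B) :> (path -> R).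
    by apply/funext => w; rewrite !indicE in_setI -natrM mulnb.
  have mSB : measurable (shift x i @^-1` B) by exact: measurable_preimage_shift.
  rewrite mean_indic; last exact: measurableI.
  exact: decor.
- exact: ag.
- exact: g01.
Qed.

(** The same for the past event, which becomes a weight [f]. The term [phi * E f] is absorbed into
    the functional, so that the bound to be checked on events is the constant 0. *)
Let decor_unit i x f g : past_weight i f -> adapted (site_events (cone theta L)) g ->
  (forall w, 0 <= g w <= 1) ->
  `|E (fun w => f w * g (shift x i w)) - E f * E g| <= phi * E f.
Proof.
move=> [af f01] ag g01.
have gn w : `|g w| <= 1 by have /andP[? ?] := g01 w; rewrite ger0_norm.
have bg : bounded_mfun g.
  exact: (adapted_bmf cone_events_measurable sigma_cone_events ag gn).
have bgs := bmf_shift x i bg.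
apply: sign_norm => s; rewrite -subr_le0.
apply: (@functional_layers _ _ _ (env_past i)
  (fun f => (-1) ^+ s * (E (fun w => f w * g (shift x i w)) - E f * E g) - phi * E f)
  (2 + phi)).
- exact: sigma_env_past.
- exact: env_past_measurable.
- move=> a k h bk bh.
  rewrite meanD ?meanZ//; last exact: bmfZ.
  rewrite (_ : (fun w => _) = fun w => a * (k w * g (shift x i w)) + h w * g (shift x i w)).
    rewrite meanD ?meanZ//; first by ring.
    + exact: bmfM.
    + by apply: bmfZ; exact: bmfM.
    + exact: bmfM.
  by apply/funext => w; ring.
- move=> k c bk kc.
  have c0 : 0 <= c by exact: le_trans (normr_ge0 _) (kc point).
  have Ek : `|E k| <= c by exact: mean_norm_le.
  have Eg : `|E g| <= 1 by exact: mean_norm_le.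
  rewrite mulrDl; apply: lerD; last first.
    by rewrite -mulrN ler_wpM2l//; apply: le_trans Ek; rewrite -normrN ler_norm.
  apply: norm_sign; apply: le_trans (ler_normB _ _) _.
  rewrite mulrDl mul1r; apply: lerD.
    apply: mean_norm_le; first exact: bmfM.
    by move=> w; rewrite normrM -[leRHS]mulr1; exact: ler_pM.
  by rewrite normrM -[leRHS]mulr1; exact: ler_pM.
- move=> F pF; rewrite subr_le0 mean_indic; last exact: env_past_measurable pF.
  by apply: norm_sign; exact: decor_event.
- exact: af.
- exact: f01.
Qed.

(** An affine map takes [-c, c] to [0, 1]; its constant cancels in the covariance and its slope
    accounts for the factor [2 * c]. *)
Lemma mean_decorrelation i x f g c : past_weight i f ->
  adapted (site_events (cone theta L)) g -> 0 < c -> (forall w, `|g w| <= c) ->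
  `|E (fun w => f w * g (shift x i w)) - E f * E g| <= 2 * c * phi * E f.
Proof.
move=> pf ag c0 gc; pose h w := (2 * c)^-1 * g w + 2^-1.
have c20 : 0 < 2 * c by rewrite mulr_gt0.
have gh w : g w = 2 * c * h w - c by rewrite /h; field; rewrite lt0r_neq0.
have bf := past_weight_bmf pf.
have bg := adapted_bmf cone_events_measurable sigma_cone_events ag gc.
have bh : bounded_mfun h by apply: bmfD; [exact: bmfZ|exact: bmf_cst].
have bhs := bmf_shift x i bh.
have ah : adapted (site_events (cone theta L)) h.
  by apply: adaptedD; [apply: adaptedM => //; exact: adapted_cst|exact: adapted_cst].
have h01 w : 0 <= h w <= 1.
  have := gc w; rewrite ler_norml gh => /andP[h1 h2]; apply/andP; split.
    by rewrite -(pmulr_rge0 _ c20); lra.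
  by rewrite -(ler_pM2l c20); lra.
have := decor_unit x pf ah h01.
have -> : E (fun w => f w * g (shift x i w)) =
    2 * c * E (fun w => f w * h (shift x i w)) - c * E f.
  rewrite -!meanZ//; last exact: bmfM.
  rewrite -meanB; last 2 first.
  - by apply: bmfZ; exact: bmfM.
  - exact: bmfZ.
  by congr mean; apply/funext => w; rewrite gh; ring.
have -> : E g = 2 * c * E h - c.
  rewrite -meanZ// -[c in RHS](mean_cst M) -meanB; last 2 first.
  - exact: bmfZ.
  - exact: bmf_cst.
  by congr mean; apply/funext => w; rewrite gh mean_cst.
move: (E (fun w => f w * h _)) (E f) (E h) => a b e hab.
have -> : 2 * c * a - c * b - b * (2 * c * e - c) = 2 * c * (a - b * e) by ring.
by rewrite normrM gtr0_norm// -!mulrA ler_pM2l// ler_pM2l.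
Qed.

End functional_decorrelation.

(** * Annealed drift *)

Section annealed_walk.
Context {R : realType}.
Variables (alpha beta : R) (N : nat).
Local Notation path := (cadlag_path R config).
Local Notation tm := (@grid_time R N).
Local Notation env_past i := (path_events config [set r : R | 0 <= r <= tm i]).
Local Notation q := (move_prob alpha beta N).
Local Notation up w := (@up_prob R alpha beta w N).
Hypotheses (beta0 : 0 < beta) (ab : beta < alpha) (q1 : q <= 1).
Variable M : probability path R.
Local Notation E := (mean M).
Local Notation past_weight := (@past_weight R N).
Local Notation shift := (@grid_shift R N).
Implicit Types (f g : path -> R) (x y : int) (Phi Psi : int -> path -> R).

Let q01 : 0 <= q <= 1.
Proof.
rewrite q1 andbT /move_prob divr_ge0// addr_ge0 ?ltW//.
exact: lt_trans ab.
Qed.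

Let up01 w i x : 0 <= up w i x <= q. Proof. exact: up_prob_bounds. Qed.

Definition env_walk i n Phi x w := walk q (up w) i n (fun y => Phi y w) x.
Definition env_drift i n x w := drift q (up w) i n x.

(** A step multiplies the weight by a transition probability, which reads the environment up to the
    next grid time. *)
Lemma past_weight_up i x f : past_weight i f ->
  past_weight i.+1 (fun w => f w * up w i x) /\
  past_weight i.+1 (fun w => f w * (q - up w i x)).
Proof.
move=> /(past_weight_le (leqnSn i)) pf.
have au : adapted (env_past i.+1) (fun w => up w i x).
  apply: adapted_up; first exact: smallest_sigma_algebra.
  move=> s b /andP[s1 s2].
  have h : [set r : R | 0 <= r <= tm i.+1] s.
    by rewrite /= s2 (le_trans (@grid_time_ge0 R N i) s1).
  exact: (path_events_open (R := R) h (@site_open x b)).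
have /andP[q0 _] := q01.
split; apply: past_weightM => //; split.
- exact: au.
- by move=> w; have /andP[-> h] := up01 w i x; rewrite (le_trans h).
- by apply: adaptedB => //; exact: adapted_cst.
- move=> w; have /andP[h0 h] := up01 w i x; rewrite subr_ge0 h/=.
  by rewrite lerBlDr (le_trans q1)// lerDl.
Qed.

Lemma past_weightZ i c f : 0 <= c <= 1 -> past_weight i f ->
  past_weight i (fun w => f w * c).
Proof.
by move=> c01 pf; apply: past_weightM => //; split => //; exact: adapted_cst.
Qed.

Lemma bmf_up i x : bounded_mfun (fun w => up w i x).
Proof.
have [p _] := past_weight_up x (past_weight1 N i).
have := past_weight_bmf p.
by congr bounded_mfun; apply/funext => w; rewrite mul1r.
Qed.

Lemma bmf_step i Phi x : (forall y, bounded_mfun (Phi y)) ->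
  bounded_mfun (fun w => step q (up w) i (fun y => Phi y w) x).
Proof.
move=> bP; apply: bmfD; last by apply: bmfZ; exact: bP.
apply: bmfD; apply: bmfM; [exact: bmf_up|exact: bP| |exact: bP].
by apply: bmfB; [exact: bmf_cst|exact: bmf_up].
Qed.

Lemma bmf_env_walk i n Phi x : (forall y, bounded_mfun (Phi y)) ->
  bounded_mfun (env_walk i n Phi x).
Proof.
move=> bP; rewrite /env_walk; elim: n i x => [|n IH] i x /=; first exact: bP.
exact: (@bmf_step i (env_walk i.+1 n Phi) x (IH i.+1)).
Qed.

Lemma bmf_local_drift i x : bounded_mfun (fun w => local_drift q (up w) i x).
Proof.
by apply: bmfB; [exact: bmf_up|apply: bmfB; [exact: bmf_cst|exact: bmf_up]].
Qed.

Lemma bmf_env_drift i n x : bounded_mfun (env_drift i n x).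
Proof.
rewrite /env_drift; elim: n i x => [|n IH] i x /=; first exact: bmf_cst.
apply: bmfD; first exact: bmf_local_drift.
exact: (@bmf_step i (env_drift i.+1 n) x (IH i.+1)).
Qed.

Lemma normr_env_drift i n x w : `|env_drift i n x w| <= q * n%:R.
Proof. exact: normr_drift. Qed.

Lemma mean_step i Phi x f : bounded_mfun f -> (forall y, bounded_mfun (Phi y)) ->
  E (fun w => f w * step q (up w) i (fun y => Phi y w) x) =
  E (fun w => (f w * up w i x) * Phi (x + 1) w) +
  E (fun w => (f w * (q - up w i x)) * Phi (x - 1) w) +
  E (fun w => (f w * (1 - q)) * Phi x w).
Proof.
move=> bf bP.
have b1 : bounded_mfun (fun w => (f w * up w i x) * Phi (x + 1) w).
  by apply: bmfM => //; apply: bmfM => //; exact: bmf_up.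
have b2 : bounded_mfun (fun w => (f w * (q - up w i x)) * Phi (x - 1) w).
  apply: bmfM => //; apply: bmfM => //.
  by apply: bmfB; [exact: bmf_cst|exact: bmf_up].
have b3 : bounded_mfun (fun w => (f w * (1 - q)) * Phi x w).
  by apply: bmfM => //; apply: bmfM => //; exact: bmf_cst.
rewrite -meanD// -meanD//; last exact: bmfD.
by congr mean; apply/funext => w; rewrite /step; ring.
Qed.

(** A weak Markov property: [f] times the probability of any walk path from [x] is a past weight at
    step [i + n], so a comparison valid for all these weights can be summed over walk paths. *)
Lemma mean_walk_le i n Phi Psi x f :
  (forall y, bounded_mfun (Phi y)) -> (forall y, bounded_mfun (Psi y)) ->
  (forall y g, past_weight (i + n) g ->
     E (fun w => g w * Phi y w) <= E (fun w => g w * Psi y w)) ->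
  past_weight i f ->
  E (fun w => f w * env_walk i n Phi x w) <= E (fun w => f w * env_walk i n Psi x w).
Proof.
move=> bP bS; elim: n i x f => [|n IH] i x f h pf.
  by apply: h; rewrite addn0.
have bf := past_weight_bmf pf.
have bPn y := bmf_env_walk i.+1 n y bP; have bSn y := bmf_env_walk i.+1 n y bS.
have -> : (fun w => f w * env_walk i n.+1 Phi x w) =
  (fun w => f w * step q (up w) i (fun y => env_walk i.+1 n Phi y w) x) by [].
have -> : (fun w => f w * env_walk i n.+1 Psi x w) =
  (fun w => f w * step q (up w) i (fun y => env_walk i.+1 n Psi y w) x) by [].
have [p1 p2] := past_weight_up x pf.
have /andP[q0 _] := q01.
have p3 : past_weight i.+1 (fun w => f w * (1 - q)).
  by apply: past_weightZ (past_weight_le (leqnSn i) pf); rewrite subr_ge0 q1/= gerBl.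
have hn y g : past_weight (i.+1 + n) g ->
    E (fun w => g w * Phi y w) <= E (fun w => g w * Psi y w).
  by rewrite addSnnS; exact: h.
rewrite mean_step// mean_step//; apply: lerD; first apply: lerD.
- exact: (IH _ _ _ hn p1).
- exact: (IH _ _ _ hn p2).
- exact: (IH _ _ _ hn p3).
Qed.

Lemma env_walk_cst i n c x w : env_walk i n (fun _ _ => c) x w = c.
Proof. exact: walk_cst. Qed.

Lemma mean_walk_cst_le i n Phi x f e : (forall y, bounded_mfun (Phi y)) ->
  (forall y g, past_weight (i + n) g -> E (fun w => g w * Phi y w) <= e * E g) ->
  past_weight i f -> E (fun w => f w * env_walk i n Phi x w) <= e * E f.
Proof.
move=> bP h pf; have bf := past_weight_bmf pf.
have -> : e * E f = E (fun w => f w * env_walk i n (fun _ _ => e) x w).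
  rewrite -meanZ//; congr mean; apply/funext => w.
  by rewrite env_walk_cst mulrC.
apply: mean_walk_le => //; first by move=> y; exact: bmf_cst.
move=> y g pg; rewrite (_ : (fun w => g w * e) = (fun w => e * g w)).
  by rewrite meanZ ?h//; exact: past_weight_bmf pg.
by apply/funext => w; rewrite mulrC.
Qed.

(* During [n] grid steps the walk stays put with probability [(1 - q) ^ n],
   whatever the environment; then no information on the environment after
   time [i0] has been used. *)
Lemma mean_walk_blind i0 i n Phi x f (e kappa : R) :
  (forall y, bounded_mfun (Phi y)) ->
  (forall y g, past_weight (i + n) g -> E (fun w => g w * Phi y w) <= e * E g) ->
  (forall g, past_weight i0 g -> E (fun w => g w * Phi x w) <= kappa * E g) ->
  (i0 <= i)%N -> past_weight i0 f ->
  E (fun w => f w * env_walk i n Phi x w) <=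
  ((1 - q) ^+ n * kappa + (1 - (1 - q) ^+ n) * e) * E f.
Proof.
move=> bP; elim: n i f => [|n IH] i f h hk ii pf.
  by rewrite expr0 mul1r subrr mul0r addr0; exact: hk.
have bf := past_weight_bmf pf.
have -> : (fun w => f w * env_walk i n.+1 Phi x w) =
  (fun w => f w * step q (up w) i (fun y => env_walk i.+1 n Phi y w) x) by [].
have bPn y := bmf_env_walk i.+1 n y bP.
have hn y g : past_weight (i.+1 + n) g -> E (fun w => g w * Phi y w) <= e * E g.
  by rewrite addSnnS; exact: h.
have [p1 p2] := past_weight_up x (past_weight_le ii pf).
have h1 := mean_walk_cst_le (x + 1) bP hn p1.
have h2 := mean_walk_cst_le (x - 1) bP hn p2.
have h3 := IH _ _ hn hk (leq_trans ii (leqnSn i)) pf.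
have e12 : E (fun w => f w * up w i x) + E (fun w => f w * (q - up w i x)) = q * E f.
  rewrite -meanD ?(past_weight_bmf p1) ?(past_weight_bmf p2)//; last 2 first.
  - exact: past_weight_bmf p1.
  - exact: past_weight_bmf p2.
  by rewrite -meanZ//; congr mean; apply/funext => w; ring.
rewrite mean_step//.
have -> : E (fun w => f w * (1 - q) * env_walk i.+1 n Phi x w) =
    (1 - q) * E (fun w => f w * env_walk i.+1 n Phi x w).
  rewrite -meanZ; last exact: (bmfM bf (bPn x)).
  by congr mean; apply/funext => w; ring.
have q0 : 0 <= 1 - q by rewrite subr_ge0.
have h4 := ler_wpM2l q0 h3.
have e12' : e * (E (fun w => f w * up w i x) + E (fun w => f w * (q - up w i x))) =
  e * (q * E f) by rewrite e12.
rewrite exprS; move: h1 h2 h4 e12'.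
move: (E (fun w => _ * up _ _ _)) (E (fun w => _ * (q - _))) => a b.
rewrite mulrDr => h1 h2 h4 e12'.
apply: le_trans (lerD (lerD h1 h2) h4) _.
rewrite e12' le_eqVlt; apply/orP; left; apply/eqP.
ring.
Qed.

Hypothesis hstat : stationary M.

Definition mean_drift n := E (env_drift 0 n 0).

Lemma drift_shift x i j n w :
  env_drift (i + j) n x w = env_drift j n 0 (shift x i w).
Proof.
suff h y : drift q (up w) (i + j) n (x + y) = drift q (up (shift x i w)) j n y.
  by rewrite /env_drift -h addr0.
elim: n j y => [//|n IH] j y /=.
by rewrite /local_drift /step up_shift -addnS -!addrA !IH.
Qed.

Lemma mean_driftE i n x : E (env_drift i n x) = mean_drift n.
Proof.
rewrite /mean_drift -(mean_shift N hstat x i (bmf_env_drift 0 n 0)).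
by congr mean; apply/funext => w; rewrite -[i in LHS]addn0 drift_shift.
Qed.

Lemma mean_drift_incr n l : `|mean_drift (l + n) - mean_drift n| <= q * l%:R.
Proof.
(* The [l] extra steps are put at the end, after the common first [n]. *)
rewrite /mean_drift addnC.
have b i := bmf_env_drift i.
rewrite -meanB; [|exact: b|exact: b]; apply: mean_norm_le; first by apply: bmfB; exact: b.
move=> w; rewrite /env_drift drift_cat addrAC subrr add0r.
rewrite ler_norml; apply/andP; split.
  rewrite -[leLHS](walk_cst q (up w) 0 n _ 0); apply: le_walk => // y.
  by have := normr_env_drift (0 + n) l y w; rewrite ler_norml => /andP[].
rewrite -[leRHS](walk_cst q (up w) 0 n _ 0); apply: le_walk => // y.
by have := normr_env_drift (0 + n) l y w; rewrite ler_norml => /andP[].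
Qed.

Section gap.
Variables (V theta L phi : R) (l : nat).
Hypotheses (phi0 : 0 <= phi) (V0 : 0 < V) (thetaE : theta = atan V) (L0 : 0 <= L).
Hypothesis slope : (alpha + beta) * (expR 1 - 1) <= V.
Hypothesis gap : tm l = 2 * L.
Hypothesis decor : cone_decorrelated M theta L phi.

(** Half-width of the cone with apex at time [L]. At step [l], by [gap], it already equals [V * L];
    this room makes an exit of the walk unlikely. *)
Let width j : R := V * (tm j - L).

(** As cos (atan V) = 1 / sqrt (1 + V^2), the cone of angle atan V is the set |x| <= V (s - L). *)
Let width_cone j x s : `|x%:~R| <= width j -> tm j <= s -> cone theta L (x, s).
Proof.
move=> xW js.
have jL : L <= tm j.
  by rewrite -subr_ge0 -(pmulr_rge0 _ V0); exact: le_trans xW.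
have T0 : 0 <= s - L by rewrite subr_ge0 (le_trans jL).
split; first exact: le_trans (le_trans L0 jL) js.
rewrite /norm2 /inner2 /= !mulr0 !mulr1 subr0 add0r -!expr2.
have VV : 0 < 1 + V ^+ 2 by rewrite ltr_pwDl// sqr_ge0.
rewrite thetaE cos_atan ler_pdivrMr ?sqrtr_gt0//.
rewrite -[X in _ <= X * _](ger0_norm T0) -sqrtr_sqr -sqrtrM ?sqr_ge0//.
apply: ler_wsqrtr; rewrite mulrDr mulr1 addrC lerD2l -exprMn.
rewrite -[leLHS](real_normK (num_real _)) ler_sqr ?nnegrE//; last first.
  by rewrite mulr_ge0// ltW.
apply: le_trans xW _; rewrite /width mulrC ler_wpM2r//; first exact: ltW.
by rewrite lerD2r.
Qed.

(** This is what the stopping is for: the rates read before an exit lie in the cone during the whole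
    grid interval. *)
Lemma adapted_cone_drift j n x :
  adapted (site_events (cone theta L)) (fun w => cone_drift q (up w) width j n x).
Proof.
elim: n j x => [|n IH] j x /=; first exact: adapted_cst.
case: (boolP (`|x%:~R : R| <= width j)) => xW; last exact: adapted_cst.
have au : adapted (site_events (cone theta L)) (fun w => up w j x).
  apply: adapted_up; first exact: smallest_sigma_algebra.
  move=> s b /andP[s1 _]; apply: sub_gen_smallest; exists x, s, b; split => //.
  exact: width_cone xW s1.
have aq : adapted (site_events (cone theta L)) (fun w => q - up w j x).
  by apply: adaptedB => //; exact: adapted_cst.
apply: adaptedD; first exact: adaptedB.
rewrite /step; apply: adaptedD; first by apply: adaptedD; exact: adaptedM.
by apply: adaptedM => //; exact: adapted_cst.
Qed.

(** After a shift of the environment by [x] and [i], the drift is replaced by [cone_drift] and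
    decorrelated from [f]. With [c = q n], decorrelation costs [2 c phi]; the replacement costs [c]
    times [expR (- (V * L))] twice, under the weight and in the mean. *)
Lemma mean_drift_gap i n x f : past_weight i f ->
  `|E (fun w => f w * env_drift (i + l) n x w) - mean_drift n * E f| <=
  2 * (phi + expR (- (V * L))) * (q * n%:R) * E f.
Proof.
move=> pf; have bf := past_weight_bmf pf.
have Ef0 := mean_past_ge0 M pf.
(* [mean_decorrelation] asks for a positive bound [c], hence the separate case [n = 0]. *)
case: n => [|n].
  rewrite mulr0 mulr0 mul0r (_ : mean_drift 0 = 0) ?mul0r ?subr0; last exact: mean_cst.
  rewrite (_ : (fun w => _) = fun=> 0) ?mean_cst ?normr0//.
  by apply/funext => w; rewrite mulr0.
set n1 := n.+1; set c := q * n1%:R.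
have lam0 : 0 < alpha + beta by rewrite addr_gt0// (lt_trans beta0).
have c0 : 0 < c by rewrite /c /move_prob mulr_gt0// divr_gt0.
pose C w := cone_drift q (up w) width l n1 0.
pose D w := env_drift l n1 0 w.
set eps := expR (- (V * L)).
have DC w : `|D w - C w| <= c * eps.
  have := @drift_cone_drift _ q (up w) q01 (up01 w) width l n1 0.
  rewrite normr0 sub0r /width gap (_ : 2 * L - L = L); last by ring.
  apply => j _; rewrite grid_timeS -lerBrDl -mulrBr.
  rewrite (_ : _ - L - _ = N.+1%:R^-1); last by ring.
  by rewrite /move_prob mulrAC ler_pM2r ?invr_gt0.
have Cc w : `|C w| <= c by exact: normr_cone_drift.
have bD : bounded_mfun D by exact: bmf_env_drift.
have aC : adapted (site_events (cone theta L)) C by exact: adapted_cone_drift.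
have bC : bounded_mfun C.
  exact: (adapted_bmf (@cone_events_measurable R theta L) (sigma_cone_events theta L) aC Cc).
have h1 := mean_decorrelation phi0 decor x pf aC c0 Cc.
have eD : (fun w => f w * env_drift (i + l) n1 x w) = (fun w => f w * D (shift x i w)).
  by apply/funext => w; rewrite drift_shift.
rewrite eD -(mean_driftE l n1 0) -/D.
have bDs := bmf_shift N x i bD; have bCs := bmf_shift N x i bC.
have h2 : `|E (fun w => f w * D (shift x i w)) - E (fun w => f w * C (shift x i w))| <=
    c * eps * E f.
  rewrite -meanB; [|exact: bmfM|exact: bmfM].
  have -> : (fun w => f w * D (shift x i w) - f w * C (shift x i w)) =
      (fun w => f w * (D (shift x i w) - C (shift x i w))).
    by apply/funext => w; rewrite mulrBr.
  by apply: (normr_mean_weight _ pf); [exact: bmfB|move=> w; exact: DC].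
have h3 : `|E D - E C| <= c * eps.
  by rewrite -meanB//; apply: mean_norm_le => //; exact: bmfB.
have h4 : `|E D * E f - E C * E f| <= c * eps * E f.
  by rewrite -mulrBl normrM (ger0_norm Ef0) ler_wpM2r.
move: h1 h2 h4.
move: (E (fun w => f w * D _)) (E (fun w => f w * C _)) (E D) (E C) (E f) => a b d e z.
rewrite !ler_norml => /andP[h1 h1'] /andP[h2 h2'] /andP[h4 h4'].
by apply/andP; split; lra.
Qed.

End gap.

End annealed_walk.

Lemma defect_arith (R : realType) (a X d1 d2 B C D D' : R) :
  `|a| <= B -> `|d1 - d2| <= B -> X <= C -> - X <= C -> 2 * B + C = D -> D <= D' ->
  `|a + X + d2 - d1| <= D'.
Proof.
rewrite !ler_norml => /andP[h1 h2] /andP[h3 h4] h5 h6 h7 h8.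
by apply/andP; split; lra.
Qed.

Section concentration.
Context {R : realType}.
Variables (alpha beta : R) (N : nat).
Local Notation path := (cadlag_path R config).
Local Notation tm := (@grid_time R N).
Local Notation q := (move_prob alpha beta N).
Local Notation up w := (@up_prob R alpha beta w N).
Hypotheses (beta0 : 0 < beta) (ab : beta < alpha) (q_half : q <= 2^-1).
Variable M : probability path R.
Hypothesis hstat : stationary M.
Local Notation E := (mean M).
Local Notation past_weight := (@past_weight R N).
Local Notation env_drift := (@env_drift R alpha beta N).
Local Notation env_walk := (@env_walk R alpha beta N).
Local Notation mean_drift := (@mean_drift R alpha beta N M).
Implicit Types (f g : path -> R) (x y : int).

Let q1 : q <= 1. Proof. by apply: le_trans q_half _; lra. Qed.

Let q0 : 0 < q.
Proof. by rewrite /move_prob divr_gt0// addr_gt0// (lt_trans beta0). Qed.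

Lemma mean_drift_defect_le n i x f : past_weight i f ->
  `|E (fun w => f w * env_drift i n x w) - mean_drift n * E f| <=
  2 * (q * n%:R) * E f.
Proof.
move=> pf; have bf := past_weight_bmf pf; have Ef0 := mean_past_ge0 M pf.
have bD := bmf_env_drift beta0 ab q1 i n x.
have h1 : `|E (fun w => f w * env_drift i n x w)| <= q * n%:R * E f.
  by apply: (normr_mean_weight _ pf) => // w; exact: normr_env_drift.
have h2 : `|mean_drift n| <= q * n%:R.
  apply: mean_norm_le; first exact: bmf_env_drift.
  by move=> w; exact: normr_env_drift.
apply: le_trans (ler_normB _ _) _.
rewrite [2 * _]mulr_natl mulr2n mulrDl; apply: lerD => //.
by rewrite normrM (ger0_norm Ef0) ler_wpM2r.
Qed.

Section regular_drift.
Variables (V theta L phi : R) (l : nat).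
Hypotheses (phi0 : 0 <= phi) (V0 : 0 < V) (thetaE : theta = atan V) (L0 : 0 <= L).
Hypothesis slope : (alpha + beta) * (expR 1 - 1) <= V.
Hypothesis gap : tm l = 2 * L.
Hypothesis decor : cone_decorrelated M theta L phi.
Hypothesis l0 : (0 < l)%N.

Local Notation p := ((1 - q) ^+ l).
Local Notation kappa := (2 * (phi + expR (- (V * L)))).

Let p0 : 0 < p.
Proof. by rewrite exprn_gt0// subr_gt0 (le_lt_trans q_half)//; lra. Qed.

Let p1 : p <= 1.
Proof. by rewrite exprn_ile1 ?subr_ge0// gerBl ltW. Qed.

Let kappa0 : 0 <= kappa.
Proof. by rewrite mulr_ge0// addr_ge0// expR_ge0. Qed.

(** Solves the fixed-point equation [key] of [mean_drift_defect]: an attempt costs [2 q l], and on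
    average [1 / p] attempts are made. *)
Definition drift_error n := 2 * (q * l%:R) / p + kappa * (q * n%:R).

(** Strong induction. If the walk stands still for [l] steps, [mean_drift_gap] bounds the remaining
    drift; otherwise the induction hypothesis does, after any past. The displacement in these steps
    and the change of [mean_drift] from [m] to [l + m] cost [q l] each. *)
Lemma mean_drift_defect n i x f : past_weight i f ->
  `|E (fun w => f w * env_drift i n x w) - mean_drift n * E f| <=
  drift_error n * E f.
Proof.
elim/ltn_ind: n i x f => n IH i x f pf.
have bf := past_weight_bmf pf; have Ef0 := mean_past_ge0 M pf.
have ql0 : 0 <= q * l%:R by rewrite mulr_ge0// ltW.
have qn0 m : 0 <= q * m%:R by rewrite mulr_ge0// ltW.
have ql_le : 2 * (q * l%:R) <= 2 * (q * l%:R) / p.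
  by apply: ler_peMr; [rewrite mulr_ge0|rewrite invf_ge1].
have [nl|ln] := ltnP n l.
  apply: le_trans (mean_drift_defect_le n x pf) _; rewrite ler_wpM2r//.
  apply: (@le_trans _ _ (2 * (q * l%:R))).
    by rewrite ler_pM2l// ler_pM2l// ler_nat ltnW.
  by apply: le_trans ql_le _; rewrite lerDl mulr_ge0.
have [m nE] : exists m, n = (l + m)%N by exists (n - l)%N; rewrite subnKC.
have mn : (m < n)%N by rewrite nE -[X in (X < _)%N]add0n ltn_add2r.
rewrite {1 2}nE.
have bDl := bmf_env_drift beta0 ab q1 i l x.
have bDm y := bmf_env_drift beta0 ab q1 (i + l) m y.
(* The sign extracts a two-sided estimate from the one-sided [mean_walk_blind]. *)
pose Phi (s : bool) (y : int) w := (-1) ^+ s * (env_drift (i + l) m y w - mean_drift m).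
have bP s y : bounded_mfun (Phi s y).
  by apply: bmfZ; apply: bmfB => //; exact: bmf_cst.
have EP s y g j : past_weight j g -> E (fun w => g w * Phi s y w) =
    (-1) ^+ s * (E (fun w => g w * env_drift (i + l) m y w) - mean_drift m * E g).
  move=> pg; have bg := past_weight_bmf pg.
  rewrite -(meanZ M (mean_drift m) bg) -meanB; [|exact: (bmfM bg (bDm y))|exact: bmfZ].
  rewrite -meanZ; last by apply: bmfB; [exact: (bmfM bg (bDm y))|exact: bmfZ].
  by congr mean; apply/funext => w; rewrite /Phi; ring.
have sgn (s : bool) (a b : R) : `|a| <= b -> (-1) ^+ s * a <= b.
  by move=> h; apply: le_trans h; rewrite -[leRHS](normrMsign s) ler_norm.
have blind s := @mean_walk_blind R alpha beta N beta0 ab q1 M i i l (Phi s) x f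
  (drift_error m) (kappa * (q * m%:R)) (bP s).
pose X s := E (fun w => f w * env_walk i l (Phi s) x w).
have hX s : X s <= (p * (kappa * (q * m%:R)) + (1 - p) * drift_error m) * E f.
  apply: blind => //.
  - by move=> y g pg; rewrite (EP s y g _ pg); apply: sgn; exact: IH.
  - move=> g pg; rewrite (EP s x g _ pg); apply: sgn.
    exact: (mean_drift_gap beta0 ab q1 hstat phi0 V0 thetaE L0 slope gap decor).
have XN : X true = - X false.
  rewrite -mulN1r -meanZ; last by apply: bmfM => //; exact: bmf_env_walk.
  congr mean; apply/funext => w; rewrite mulrCA; congr (_ * _).
  rewrite /env_walk -walkZ; apply: eq_walk => y.
  by rewrite /Phi expr0 expr1 mul1r.
have ED : E (fun w => f w * env_drift i (l + m) x w) =
    E (fun w => f w * env_drift i l x w) + X false + mean_drift m * E f.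
  rewrite -(meanZ M (mean_drift m) bf) -meanD; [|exact: bmfM|].
    rewrite -meanD; [|by apply: bmfD; apply: bmfM => //; exact: bmf_env_walk|exact: bmfZ].
    congr mean; apply/funext => w.
    rewrite /env_drift drift_cat -/(env_drift _ _ _ _).
    have -> : env_walk i l (Phi false) x w =
        walk q (up w) i l (drift q (up w) (i + l) m) x - mean_drift m.
      rewrite /env_walk.
      rewrite (@eq_walk R q (up w) i l _
        (fun y => 1 * drift q (up w) (i + l) m y + - mean_drift m) x).
        by rewrite walkD walk_cst mul1r.
      by move=> y; rewrite /Phi expr0 !mul1r.
    by rewrite /env_drift; ring.
  by apply: bmfM => //; exact: bmf_env_walk.
have h1 : `|E (fun w => f w * env_drift i l x w)| <= q * l%:R * E f.
  by apply: (normr_mean_weight _ pf) => // w; exact: normr_env_drift.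
have h2 : `|mean_drift (l + m) * E f - mean_drift m * E f| <= q * l%:R * E f.
  rewrite -mulrBl normrM (ger0_norm Ef0) ler_wpM2r//.
  exact: mean_drift_incr.
have h3 := hX false; have h4 := hX true; rewrite XN in h4.
rewrite ED nE.
have key : 2 * (q * l%:R) + (p * (kappa * (q * m%:R)) + (1 - p) * drift_error m) =
    drift_error m.
  by rewrite /drift_error; field; rewrite lt0r_neq0.
have key' : 2 * (q * l%:R * E f) +
    (p * (kappa * (q * m%:R)) + (1 - p) * drift_error m) * E f = drift_error m * E f.
  by rewrite mulrA -mulrDl key.
have mono : drift_error m * E f <= drift_error (l + m) * E f.
  rewrite ler_wpM2r// /drift_error lerD2l ler_wpM2l// ler_pM2l// ler_nat.
  exact: leq_addl.
exact: defect_arith h1 h2 h3 h4 key' mono.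
Qed.

End regular_drift.
End concentration.

(** * Exponential moments and concentration *)

Section exponential_moments.
Context {R : realType}.
Variables (alpha beta : R) (N : nat).
Local Notation path := (cadlag_path R config).
Local Notation q := (move_prob alpha beta N).
Local Notation up w := (@up_prob R alpha beta w N).
Hypotheses (beta0 : 0 < beta) (ab : beta < alpha) (q1 : q <= 1).
Variable M : probability path R.
Local Notation E := (mean M).
Local Notation past_weight := (@past_weight R N).
Local Notation env_drift := (@env_drift R alpha beta N).
Local Notation env_walk := (@env_walk R alpha beta N).
Local Notation mean_drift := (@mean_drift R alpha beta N M).
Implicit Types (f g : path -> R) (x y : int).

Let q01 : 0 <= q <= 1.
Proof.
rewrite q1 andbT /move_prob divr_ge0// addr_ge0 ?ltW//.
exact: lt_trans ab.
Qed.

Let up01 w i x : 0 <= up w i x <= q. Proof. exact: up_prob_bounds. Qed.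

Variables (b : nat) (err Cb : R).
Hypothesis defect : forall i x f, past_weight i f ->
  `|E (fun w => f w * env_drift i b x w) - mean_drift b * E f| <= err * E f.
Hypothesis CbE : 16 * expR (q * (expR 2 - 1) * b%:R) <= Cb.

Definition block_factor s := 1 + s * mean_drift b + `|s| * err + s ^+ 2 * Cb.

(** [walk_expM] produces the drift in the given environment; integration against [f] and [defect]
    replace it by its mean, at the cost [err] on either side. *)
Lemma mean_block_exp s i x f : `|s| <= 1 -> past_weight i f ->
  E (fun w => f w * env_walk i b (fun y _ => expR (s * y%:~R)) x w) <=
  expR (s * x%:~R) * block_factor s * E f.
Proof.
move=> s1 pf; have bf := past_weight_bmf pf; have Ef0 := mean_past_ge0 M pf.
have bD := bmf_env_drift beta0 ab q1 i b x.
have b1 : bounded_mfun (fun w => (1 + s ^+ 2 * Cb) * f w) by exact: bmfZ.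
have b2 : bounded_mfun (fun w => s * (f w * env_drift i b x w)).
  by apply: bmfZ; exact: bmfM.
apply: (@le_trans _ _ (E (fun w => expR (s * x%:~R) *
    ((1 + s ^+ 2 * Cb) * f w + s * (f w * env_drift i b x w))))).
  apply: le_mean.
  - by apply: bmfM => //; apply: bmf_env_walk => // y; exact: bmf_cst.
  - by apply: bmfZ; exact: bmfD.
  move=> w; have /andP[f0 _] := pf.2 w.
  have h := walk_expM q01 (up01 w) i b x s1.
  apply: (@le_trans _ _ (f w * (expR (s * x%:~R) *
     (1 + s * env_drift i b x w + s ^+ 2 * Cb)))).
    rewrite ler_wpM2l//; apply: le_trans h _.
    rewrite ler_wpM2l ?expR_ge0// lerD2l ler_wpM2l ?sqr_ge0//.
  by rewrite le_eqVlt; apply/orP; left; apply/eqP; ring.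
rewrite meanZ; last exact: bmfD.
rewrite meanD// meanZ// meanZ; last exact: bmfM.
rewrite -[leRHS]mulrA ler_wpM2l ?expR_ge0//.
have h : s * (E (fun w => f w * env_drift i b x w) - mean_drift b * E f) <= `|s| * (err * E f).
  apply: le_trans (ler_norm _) _; rewrite normrM ler_wpM2l//.
  exact: defect.
rewrite /block_factor; move: h; rewrite mulrBr.
move: (E (fun w => _ * _)) (E f) => a z h.
rewrite lerBlDr in h; apply: le_trans (lerD (lexx _) h) _.
by rewrite le_eqVlt; apply/orP; left; apply/eqP; ring.
Qed.

Lemma block_factor_ge0 s : `|s| <= 1 -> 0 <= block_factor s.
Proof.
move=> s1; have := mean_block_exp 0 s1 (past_weight1 N 0).
rewrite mulr0 expR0 mul1r mean_cst mulr1; apply: le_trans.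
apply: mean_ge0 => w; rewrite mul1r /env_walk.
rewrite -(walk_cst q (up w) 0 b 0 0); apply: le_walk => // y.
Qed.

(** The bound for one block holds given any past, so each block contributes one factor although
    blocks are not independent. *)
Lemma mean_walk_exp s k i x f : `|s| <= 1 -> past_weight i f ->
  E (fun w => f w * env_walk i (k * b) (fun y _ => expR (s * y%:~R)) x w) <=
  expR (s * x%:~R) * block_factor s ^+ k * E f.
Proof.
move=> s1; elim: k i x f => [|k IH] i x f pf.
  have bf := past_weight_bmf pf; rewrite expr0 mulr1 -meanZ//.
  rewrite (_ : (fun w => _) = (fun w => expR (s * x%:~R) * f w))//.
  by apply/funext => w; rewrite mulrC.
have bf := past_weight_bmf pf.
pose Phi y w := env_walk (i + b) (k * b) (fun z _ => expR (s * z%:~R)) y w.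
pose Psi y (w : path) := block_factor s ^+ k * expR (s * y%:~R).
have bPhi y : bounded_mfun (Phi y).
  by apply: bmf_env_walk => // z; exact: bmf_cst.
have bPsi y : bounded_mfun (Psi y) by exact: bmf_cst.
have -> : (fun w => f w * env_walk i (k.+1 * b) (fun y _ => expR (s * y%:~R)) x w) =
    (fun w => f w * env_walk i b Phi x w).
  by apply/funext => w; rewrite mulSn /env_walk walk_cat.
apply: le_trans (mean_walk_le beta0 ab q1 x bPhi bPsi _ pf) _.
  move=> y g pg; have bg := past_weight_bmf pg.
  apply: le_trans (IH (i + b)%N y g pg) _.
  rewrite -meanZ//.
  rewrite le_eqVlt; apply/orP; left; apply/eqP; congr mean.
  by apply/funext => w; rewrite /Psi; ring.
have -> : (fun w => f w * env_walk i b Psi x w) =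
  (fun w => block_factor s ^+ k * (f w * env_walk i b (fun y _ => expR (s * y%:~R)) x w)).
  by apply/funext => w; rewrite /env_walk walkZ; ring.
have bW : bounded_mfun (env_walk i b (fun y _ => expR (s * y%:~R)) x).
  by apply: bmf_env_walk => // y; exact: bmf_cst.
rewrite meanZ; last exact: bmfM.
rewrite exprS [X in _ <= X](_ : _ = block_factor s ^+ k *
  (expR (s * x%:~R) * block_factor s * E f)); last by ring.
rewrite ler_wpM2l ?exprn_ge0 ?block_factor_ge0//.
exact: mean_block_exp.
Qed.

(** Chernoff's inequality at [s] and [- s]. As the threshold contains [err], the normalisation [a]
    leaves only the excess [dl] and the second-order term. *)
Lemma mean_tail k s dl : 0 <= s <= 1 ->
  E (env_walk 0 (k * b)
      (fun y _ => (k%:R * (err + dl) < `|y%:~R - k%:R * mean_drift b|)%R%:R) 0) <=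
  2 * expR (- (k%:R * (s * dl - s ^+ 2 * Cb))).
Proof.
move=> /andP[s0 s1]; set d := mean_drift b.
have bexp t : bounded_mfun (env_walk 0 (k * b) (fun y _ => expR (t * y%:~R)) 0).
  by apply: bmf_env_walk => // y; exact: bmf_cst.
pose a (t : R) := expR (- (k%:R * (t * d + s * (err + dl)))).
have one t : `|t| = s -> a t * E (env_walk 0 (k * b) (fun y _ => expR (t * y%:~R)) 0) <=
    expR (- (k%:R * (s * dl - s ^+ 2 * Cb))).
  move=> ts; have t1 : `|t| <= 1 by rewrite ts.
  have := mean_walk_exp k 0 t1 (past_weight1 N 0).
  rewrite mulr0 expR0 mul1r mean_cst mulr1.
  rewrite (_ : (fun w => _) = env_walk 0 (k * b) (fun y _ => expR (t * y%:~R)) 0); last first.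
    by apply/funext => w; rewrite mul1r.
  move=> h; have ft : block_factor t <= expR (t * d + s * err + s ^+ 2 * Cb).
    apply: le_trans (expR_ge1Dx _); rewrite /block_factor ts -!addrA.
    by rewrite -(real_normK (num_real t)) ts.
  have fk : block_factor t ^+ k <= expR (k%:R * (t * d + s * err + s ^+ 2 * Cb)).
    rewrite mulrC expRM_natr lerXn2r ?nnegrE ?expR_ge0//.
    exact: block_factor_ge0.
  apply: le_trans (ler_wpM2l (expR_ge0 _) (le_trans h fk)) _.
  rewrite -expRD ler_expR le_eqVlt; apply/orP; left; apply/eqP; ring.
have hs := one s (ger0_norm s0).
have hN := one (- s) (etrans (normrN s) (ger0_norm s0)).
apply: le_trans (_ : _ <= a s * E (env_walk 0 (k * b) (fun y _ => expR (s * y%:~R)) 0) +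
   a (- s) * E (env_walk 0 (k * b) (fun y _ => expR (- s * y%:~R)) 0)) _; last first.
  by rewrite [2 * _]mulr_natl mulr2n; exact: lerD.
rewrite -(meanZ M (a s) (bexp s)) -(meanZ M (a (- s)) (bexp (- s))) -meanD;
  [|exact: (bmfZ _ (bexp s))|exact: (bmfZ _ (bexp (- s)))].
apply: le_mean.
- by apply: bmf_env_walk => // y; exact: bmf_cst.
- exact: (bmfD (bmfZ _ (bexp s)) (bmfZ _ (bexp (- s)))).
move=> w; rewrite /env_walk -(walkZ q (up w) 0 (k * b) (a (- s))).
rewrite -walkD; apply: le_walk => // y.
case: ltP => h; last by rewrite addr_ge0// mulr_ge0 ?expR_ge0.
rewrite /a -!expRD /=.
have [yd|yd] := lerP 0 (y%:~R - k%:R * d).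
  rewrite ger0_norm// in h.
  apply: ler_wpDr; first exact: expR_ge0.
  rewrite -[leLHS]expR0 ler_expR.
  have h' := ler_wpM2l s0 (ltW h).
  apply: (@le_trans _ _ (s * (y%:~R - k%:R * d) - s * (k%:R * (err + dl)))).
    by rewrite subr_ge0.
  by rewrite le_eqVlt; apply/orP; left; apply/eqP; ring.
rewrite ltr0_norm// in h.
apply: ler_wpDl; first exact: expR_ge0.
rewrite -[leLHS]expR0 ler_expR.
have h' := ler_wpM2l s0 (ltW h).
apply: (@le_trans _ _ (s * (- (y%:~R - k%:R * d)) - s * (k%:R * (err + dl)))).
  by rewrite subr_ge0.
by rewrite le_eqVlt; apply/orP; left; apply/eqP; ring.
Qed.

End exponential_moments.

Section annealed_tail.
Context {R : realType}.
Variables (alpha beta : R).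
Local Notation path := (cadlag_path R config).
Local Notation lam := (alpha + beta).
Hypotheses (beta0 : 0 < beta) (ab : beta < alpha).
Variable M : probability path R.
Hypothesis hstat : stationary M.
Hypothesis mixing : forall V phi : R, 0 < V -> 0 < phi ->
  \forall L \near \oo, cone_decorrelated M (atan V) L%:R phi.

(** [m] and [c] are chosen before [N], so the decay in [k] is uniform over fine grids; only the
    velocity depends on [N], and [pr_escape] compares these velocities. *)
Lemma annealed_tail (eps : R) : 0 < eps ->
  exists m : nat, exists c : R, [/\ (0 < m)%N, 0 < c &
    \forall N \near \oo, exists v : R, forall k : nat,
      mean M (env_walk alpha beta N 0 (k * (m * N.+1))
        (fun y _ => (eps * (k * m)%:R < `|y%:~R - v * (k * m)%:R|)%R%:R) 0) <=
      2 * expR (- (c * k%:R))].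
Proof.
move=> eps0; have lam0 : 0 < lam by rewrite addr_gt0// (lt_trans beta0).
(* The slowest widening of the cone per unit of time that [drift_cone_drift] admits. *)
pose V := lam * (expR 1 - 1).
have V0 : 0 < V by rewrite mulr_gt0// subr_gt0 -[ltLHS]expR0 ltr_expR.
(* With [expR (- (V * L))] at most [phi], the part of [drift_error] proportional to time is at most
   4 phi lam = eps / 4 per unit of time. *)
pose phi := eps / (16 * lam).
have phi0 : 0 < phi by rewrite divr_gt0// mulr_gt0.
have small : \forall L \near \oo, expR (- (V * L%:R)) <= phi :> R.
  exists (Num.bound ((V * phi)^-1)) => // n /= hn.
  have Vphi0 : 0 < V * phi by rewrite mulr_gt0.
  have h1 : (V * phi)^-1 < n%:R.
    by apply: lt_le_trans (archi_boundP _) _; rewrite ?ler_nat// invr_ge0 ltW.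
  have h2 : 1 < V * n%:R * phi by rewrite mulrAC -ltr_pdivrMl// mulr1.
  rewrite expRN -[leRHS]invrK lef_pV2 ?posrE ?invr_gt0 ?expR_gt0//.
  apply: le_trans (expR_ge1Dx _).
  have : phi^-1 <= V * n%:R by rewrite -(ler_pM2r phi0) mulVf ?lt0r_neq0// ltW.
  by lra.
have [L [L0 expL decor]] : exists L : nat, [/\ (0 < L)%N,
    expR (- (V * L%:R)) <= phi & cone_decorrelated M (atan V) L%:R phi].
  near \oo => L; exists L; split; near: L.
  - by exists 1%N.
  - exact: small.
  - exact: mixing.
(* A lower bound for (1 - q)^l on every fine grid, since 1 - q >= exp (- 2 q) and q l = 2 lam L. *)
pose p := expR (- (4 * lam * L%:R)) : R.
have p0 : 0 < p by exact: expR_gt0.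
(* Blocks so long that the fixed part of [drift_error] is at most eps / 4 per unit of time. *)
have [m m0 hm] : exists2 m : nat, (0 < m)%N & 4 * lam * L%:R / p <= eps / 4 * m%:R.
  pose z := 4 * lam * L%:R / p / (eps / 4).
  have e4 : 0 < eps / 4 by rewrite divr_gt0.
  have z0 : 0 <= z.
    apply: divr_ge0; last exact: ltW.
    by apply: divr_ge0; [rewrite !mulr_ge0// ltW|exact: ltW].
  exists (Num.bound z).+1 => //; rewrite [leRHS]mulrC -ler_pdivrMr//.
  apply: le_trans (ltW (archi_boundP z0)) _.
  by rewrite ler_nat.
pose C := 16 * expR (lam * (expR 2 - 1) * m%:R).
have C0 : 0 < C by rewrite mulr_gt0// expR_gt0.
pose dl := eps / 2 * m%:R.
have dl0 : 0 < dl by rewrite mulr_gt0 ?divr_gt0// ltr0n.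
(* Keeps [s ^+ 2 * C] below half of the gain [s * dl]; the other half becomes the rate [c]. *)
pose s := Num.min 1 (dl / (2 * C)).
have s0 : 0 < s by rewrite lt_min ltr01 divr_gt0// mulr_gt0.
have s1 : s <= 1 by rewrite ge_min lexx.
have sC : s * C <= dl / 2.
  have : s <= dl / (2 * C) by rewrite ge_min lexx orbT.
  have C20 : 0 < 2 * C by exact: mulr_gt0.
  by rewrite ler_pdivlMr// => h; lra.
pose c := s * dl / 2.
exists m, c; split => //; first by rewrite divr_gt0// mulr_gt0.
have : \forall N \near \oo, move_prob alpha beta N <= 2^-1.
  exists (Num.bound (2 * lam)) => // N /= hN.
  have h1 : 2 * lam < N%:R.
    by apply: lt_le_trans (archi_boundP _) _; rewrite ?ler_nat// mulr_ge0// ltW.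
  rewrite /move_prob ler_pdivrMr// -[N.+1%:R]natr1; lra.
move=> [N0 _ hN]; exists N0 => // N /= /hN q_half.
set b := (m * N.+1)%N; set l := (2 * L * N.+1)%N.
have q1 : move_prob alpha beta N <= 1 by apply: le_trans q_half _; lra.
have gap : grid_time N l = 2 * L%:R :> R.
  by rewrite /grid_time /l !natrM mulfK ?pnatr_eq0.
have l0 : (0 < l)%N by rewrite /l !muln_gt0 L0.
have defect i x f (pf : past_weight N i f) :=
  mean_drift_defect beta0 ab q_half hstat (ltW phi0) V0 erefl (ler0n R L)
   (lexx _) gap decor l0 b x pf.
have nN0 : N.+1%:R != 0 :> R by rewrite pnatr_eq0.
have qb : move_prob alpha beta N * b%:R = lam * m%:R.
  by rewrite /move_prob /b natrM; move: (N.+1%:R : R) nN0 => n n0; field.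
have ql : move_prob alpha beta N * l%:R = 2 * lam * L%:R.
  by rewrite /move_prob /l !natrM; move: (N.+1%:R : R) nN0 => n n0; field.
have q0 : 0 <= move_prob alpha beta N by rewrite divr_ge0// ltW.
have pN : p <= (1 - move_prob alpha beta N) ^+ l.
  have := onem_ge_expR (z := move_prob alpha beta N); rewrite q0 q_half => /(_ isT) h.
  have -> : p = expR (- (2 * move_prob alpha beta N)) ^+ l.
    rewrite -expRM_natr /p; congr expR.
    have -> : - (2 * move_prob alpha beta N) * l%:R =
      - (2 * (move_prob alpha beta N * l%:R)) by ring.
    by rewrite ql; ring.
  by rewrite lerXn2r ?nnegrE ?expR_ge0// (le_trans (expR_ge0 _) h).
set err := drift_error _ _ _ _ _ _ _ _ in defect.
have err_le : err <= eps / 2 * m%:R.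
  rewrite /err /drift_error qb ql.
  have h1 : 2 * (2 * lam * L%:R) / (1 - move_prob alpha beta N) ^+ l <= eps / 4 * m%:R.
    apply: le_trans hm; have -> : 2 * (2 * lam * L%:R) = 4 * lam * L%:R by ring.
    apply: ler_wpM2l; first by rewrite !mulr_ge0// ltW.
    by rewrite lef_pV2 ?posrE//; exact: lt_le_trans pN.
  have h2 : 2 * (phi + expR (- (V * L%:R))) * (lam * m%:R) <= eps / 4 * m%:R.
    have -> : eps / 4 = 2 * (phi + phi) * lam by rewrite /phi; field; rewrite lt0r_neq0.
    rewrite -[leRHS]mulrA; apply: ler_wpM2r; first by rewrite mulr_ge0// ltW.
    by rewrite ler_pM2l// lerD2l.
  apply: le_trans (lerD h1 h2) _.
  by rewrite le_eqVlt; apply/orP; left; apply/eqP; field.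
exists (mean_drift alpha beta N M b / m%:R) => k.
have CbE : 16 * expR (move_prob alpha beta N * (expR 2 - 1) * b%:R) <= C.
  by rewrite mulrAC qb mulrAC.
apply: le_trans (_ : _ <= 2 * expR (- (k%:R * (s * dl - s ^+ 2 * C)))) _; last first.
  rewrite ler_pM2l// ler_expR lerN2 mulrC ler_wpM2l//.
  have : s * (s * C) <= s * (dl / 2) by rewrite ler_wpM2l// ltW.
  by rewrite /c expr2 -mulrA; lra.
have s01 : 0 <= s <= 1 by rewrite s1 ltW.
apply: le_trans (mean_tail beta0 ab q1 defect CbE k dl s01).
apply: le_mean.
- by apply: bmf_env_walk => // y; exact: bmf_cst.
- by apply: bmf_env_walk => // y; exact: bmf_cst.
move=> w; apply: le_walk => [|i x|y].
- by rewrite q1 q0.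
- exact: up_prob_bounds.
have -> : mean_drift alpha beta N M b / m%:R * (k * m)%:R = k%:R * mean_drift alpha beta N M b.
  by rewrite natrM; field; rewrite pnatr_eq0 -lt0n.
have h : k%:R * (err + dl) <= eps * (k * m)%:R.
  rewrite natrM mulrCA ler_wpM2l//.
  have -> : eps * m%:R = eps / 2 * m%:R + eps / 2 * m%:R by field.
  by rewrite lerD.
case: ltP => // h1; case: ltP => //.
by move=> h2; have := lt_le_trans h1 (le_trans h2 h); rewrite ltxx.
Unshelve. all: by end_near.
Qed.

End annealed_tail.

(** * Convergence of the walk *)

Section walk_fluctuations.
Context {R : realType}.
Variables (alpha beta : R).
Local Notation path := (cadlag_path R config).
Local Notation walk_path := (cadlag_path R Zdiscr).
Local Notation lam := (alpha + beta).
Hypotheses (beta0 : 0 < beta) (ab : beta < alpha).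
Variable M : probability path R.
Variable Q : R.-pker path ~> walk_path.
Hypothesis hQ : quenched_walk alpha beta Q.
Local Notation MQ := (mixture M Q).

Let Q1 xi : Q xi setT = 1%E. Proof. exact: prob_kernel. Qed.
Let MQ1 : MQ setT = 1%E. Proof. exact: probability_setT. Qed.
Let lam0 : 0 < lam. Proof. by rewrite addr_gt0// (lt_trans beta0). Qed.

Lemma pr_stays_in_start N A n xi : move_prob alpha beta N <= 1 ->
  confined (move_prob alpha beta N) (up_prob alpha beta xi N) A 0 n 0 -
    4 * move_prob alpha beta N ^+ 2 * n%:R <=
  pr (Q xi) (stays_in N A 0 n).
Proof.
move=> q1; have [start _] := hQ xi.
have t0 : grid_time N 0 = 0 :> R by rewrite /grid_time mul0r.
have pT : path_events Zdiscr [set r : R | 0 <= r <= grid_time N 0] setT.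
  exact: path_eventsT.
have := pr_stays_in (Q1 xi) beta0 ab (hQ xi) q1 A n 0 pT.
rewrite setTI t0 (_ : pr _ (visits 0 0) = 1) ?mul1r; last by rewrite /pr start.
move=> /le_trans; apply; apply: (pr_le (Q1 xi)).
- by apply: measurableI; [exact: measurable_at|exact: measurable_stays_in].
- exact: measurable_stays_in.
- by move=> X [].
Qed.

(** The walk is left free before the block begins; its position at that moment is controlled by the
    tail bound. *)
Definition window (b k : nat) (c r : R) (j : nat) : set int :=
  if (j < k * b)%N then setT else [set y | `|y%:~R - c| <= r].

(** The walk is within [r] of [c] when the block begins, up to the tail, and moves at most [r]
    further during the block; hence the radius [2 * r]. *)
Lemma confined_window_ge N xi b k (c r : R) :
  move_prob alpha beta N <= 1 ->
  1 - expR (- r + move_prob alpha beta N * (expR 1 - 1) * b%:R) -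
    walk (move_prob alpha beta N) (up_prob alpha beta xi N) 0 (k * b)
      (fun y => (r < `|y%:~R - c|)%R%:R) 0 <=
  confined (move_prob alpha beta N) (up_prob alpha beta xi N)
    (window b k c (2 * r)) 0 (k * b + b) 0.
Proof.
move=> q1; set q := move_prob _ _ _; set g := up_prob _ _ _ _.
have q01 : 0 <= q <= 1 by rewrite q1 andbT divr_ge0// ltW.
have gq i x : 0 <= g i x <= q by exact: up_prob_bounds.
rewrite confined_cat; last by move=> j y /= jk; rewrite /window jk.
set z := 1 - _.
have -> : z - walk q g 0 (k * b) (fun y => (r < `|y%:~R - c|)%R%:R) 0 =
   walk q g 0 (k * b) (fun y => (-1) * (r < `|y%:~R - c|)%R%:R + z) 0.
  by rewrite walkD walk_cst mulN1r addrC.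
apply: le_walk => // y; rewrite add0n.
case: ltP => h.
  apply: le_trans (confined_ge0 q01 gq _ _ _ _).
  by rewrite mulN1r addrC subr_le0 /z lerBlDr lerDl expR_ge0.
rewrite mulr0 add0r.
have := @confined_window _ q g q01 gq (window b k c (2 * r)) (k * b) b y c (2 * r).
have hA j : (k * b <= j <= k * b + b)%N ->
    window b k c (2 * r) j = [set y | `|y%:~R - c| <= 2 * r].
  by move=> /andP[kj _]; rewrite /window ltnNge kj.
move=> /(_ hA); apply: le_trans; rewrite lerD2l lerN2 ler_expR lerD2r.
by lra.
Qed.

Lemma pr_window_ge N b k (c r : R) : move_prob alpha beta N <= 1 ->
  1 - expR (- r + move_prob alpha beta N * (expR 1 - 1) * b%:R) -
    mean M (env_walk alpha beta N 0 (k * b) (fun y _ => (r < `|y%:~R - c|)%R%:R) 0) -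
    4 * move_prob alpha beta N ^+ 2 * (k * b + b)%:R <=
  pr MQ (stays_in N (window b k c (2 * r)) 0 (k * b + b)).
Proof.
move=> q1; have mS := measurable_stays_in N (window b k c (2 * r)) 0 (k * b + b) (R := R).
rewrite (pr_mixtureE M Q mS).
set a := 1 - _; set z := 4 * _ * _.
have bW : bounded_mfun (env_walk alpha beta N 0 (k * b)
    (fun y _ => (r < `|y%:~R - c|)%R%:R) 0).
  by apply: bmf_env_walk => // y; exact: bmf_cst.
rewrite addrAC -[a - z](mean_cst M) -meanB//; last exact: bmf_cst.
apply: le_mean; [by apply: bmfB => //; exact: bmf_cst|exact: bmf_kernel|].
move=> xi; apply: le_trans (pr_stays_in_start _ _ _ q1).
by rewrite addrAC lerD2r; exact: confined_window_ge.
Qed.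

End walk_fluctuations.

Section geometric_tools.
Context {R : realType}.

Lemma sum_geometric_le (U r : R) n : 0 <= U -> 0 <= r < 1 ->
  \sum_(0 <= k < n) U * r ^+ k <= U / (1 - r).
Proof.
move=> U0 /andP[r0 r1].
have -> : \sum_(0 <= k < n) U * r ^+ k = U * (1 - r ^+ n) / (1 - r).
  have r1' : 1 - r != 0 by rewrite lt0r_neq0// subr_gt0.
  elim: n => [|n IH]; first by rewrite big_geq// expr0 subrr mulr0 mul0r.
  rewrite big_nat_recr//= IH exprS; field.
  exact: r1'.
rewrite ler_pM2r ?invr_gt0 ?subr_gt0// ler_piMr// gerBl.
exact: exprn_ge0.
Qed.

Lemma near_geometric_lt (U r e : R) : 0 <= r < 1 -> 0 < e ->
  \forall k \near \oo, U * r ^+ k < e.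
Proof.
move=> /andP[r0 r1] e0.
have : U * r ^+ k @[k --> \oo] --> U * 0.
  by apply: cvgMr; apply: cvg_expr; rewrite ger0_norm.
by rewrite mulr0 => /cvgr_lt; exact.
Qed.

Lemma near_harmonic_lt (T e : R) : 0 < e ->
  \forall N \near \oo, T / N.+1%:R < e.
Proof.
move=> e0; have : T * N.+1%:R^-1 @[N --> \oo] --> T * 0.
  by apply: cvgMr; exact: cvg_harmonic.
by rewrite mulr0 => /cvgr_lt; exact.
Qed.

End geometric_tools.

(** * From block estimates to an almost sure velocity *)

Section velocity.
Context {R : realType}.
Variables (alpha beta : R).
Local Notation path := (cadlag_path R config).
Local Notation walk_path := (cadlag_path R Zdiscr).
Local Notation lam := (alpha + beta).
Hypotheses (beta0 : 0 < beta) (ab : beta < alpha).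
Variable M : probability path R.
Variable Q : R.-pker path ~> walk_path.
Hypothesis hQ : quenched_walk alpha beta Q.
Local Notation MQ := (mixture M Q).
Hypothesis hstat : stationary M.
Hypothesis mixing : forall V phi : R, 0 < V -> 0 < phi ->
  \forall L \near \oo, cone_decorrelated M (atan V) L%:R phi.

Let MQ1 : MQ setT = 1%E. Proof. exact: probability_setT. Qed.
Let lam0 : 0 < lam. Proof. by rewrite addr_gt0// (lt_trans beta0). Qed.

Definition block_window m k (v r : R) N : set walk_path :=
  stays_in N (window (m * N.+1) k (v * (k * m)%:R) (r * (k * m)%:R)) 0
    (k * (m * N.+1) + m * N.+1).

Implicit Types (m k N : nat) (v r s : R) (X : walk_path).

Lemma measurable_block_window m k v r N : measurable (block_window m k v r N).
Proof. exact: measurable_stays_in. Qed.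

Lemma block_window_le m k (v v' r r' : R) N : `|v - v'| + r <= r' ->
  block_window m k v r N `<=` block_window m k v' r' N.
Proof.
move=> vr X hX j /= jn; have := hX j jn.
rewrite /window/= ; case: ifPn => //= _ h.
apply: le_trans (ler_wpM2r (ler0n R (k * m)) vr).
rewrite mulrDl -[X in X * _ + _](ger0_norm (normr_ge0 _)).
set y := _%:~R; set n := _%:R.
have -> : y - v' * n = (v - v') * n + (y - v * n) by ring.
apply: le_trans (ler_normD _ _) _; rewrite lerD//.
by rewrite normrM normr_id (ger0_norm (ler0n R _)).
Qed.

Lemma block_window_start m k v r N X : block_window m k v r N X ->
  `|(X (k * m)%:R : int)%:~R - v * (k * m)%:R| <= r * (k * m)%:R.
Proof.
move=> hX; have := hX (k * (m * N.+1))%N; rewrite /= ltnS leq_addr => /(_ isT).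
rewrite add0n /window ltnn/=.
by rewrite /grid_time mulnA natrM mulfK ?pnatr_eq0.
Qed.

(** By right continuity the walk is at the same site at the first grid time from [s] on, and on a
    fine grid this time still belongs to the block. *)
Lemma block_window_near m k v r X s : (k * m)%:R <= s < (k.+1 * m)%:R ->
  r * (k * m)%:R < `|(X s : int)%:~R - v * (k * m)%:R| ->
  \forall N \near \oo, (~` block_window m k v r N) X.
Proof.
move=> /andP[ks sk] far.
have s0 : 0 <= s by exact: le_trans ks.
have [e e0 he] := walk_right_constant X s0.
pose e' := Num.min e ((k.+1 * m)%:R - s).
have e'0 : 0 < e' by rewrite lt_min e0 subr_gt0.
have [N0 _ hN0] := near_harmonic_lt 1 e'0.
exists N0 => // N /= /hN0 hN hX; have N10 : 0 < N.+1%:R :> R by [].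
pose P j := s <= grid_time N j.
have exP : exists j, P j.
  exists (Num.bound (s * N.+1%:R)); rewrite /P /grid_time ler_pdivlMr//.
  by apply/ltW/archi_boundP; rewrite mulr_ge0.
case: (ex_minnP exP) => j Pj minj.
have jlt : grid_time N j < s + 1 / N.+1%:R.
  case: j Pj minj => [|j] Pj minj.
    by rewrite {1}/grid_time mul0r ltr_pwDr ?divr_gt0.
  rewrite grid_timeS div1r ltrD2r ltNge; apply/negP => /minj.
  by rewrite ltnn.
have jse : grid_time N j < s + e' by apply: lt_trans jlt _; rewrite ltrD2l.
have je : grid_time N j < s + e.
  by apply: lt_le_trans jse _; rewrite lerD2l ge_min lexx.
have jk : grid_time N j < (k.+1 * m)%:R :> R.
  by apply: lt_le_trans jse _; rewrite -lerBrDl ge_min lexx orbT.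
have Xj : X (grid_time N j) = X s by apply: he; apply/andP; split; [exact: Pj|exact: je].
have kj : (k * (m * N.+1) <= j)%N.
  have := le_trans ks Pj; rewrite /grid_time ler_pdivlMr// -natrM ler_nat.
  by rewrite mulnA.
have jn : (j < (k * (m * N.+1) + m * N.+1).+1)%N.
  move: jk; rewrite /grid_time ltr_pdivrMr// -natrM ltr_nat => jk.
  by rewrite ltnS; apply: ltnW; apply: leq_trans jk _; rewrite -mulnA mulSn addnC.
have := hX j jn; rewrite /= add0n /window ltnNge kj/= Xj.
by move=> /(lt_le_trans far); rewrite ltxx.
Qed.

(** In [U], the constant [K] comes from leaving the window during the block and the 2 from the tail
    at its beginning. The last error vanishes as [N] grows only for fixed [k], so the limit in [N]
    has to precede the sum over [k]. *)
Lemma pr_block_window (eps : R) : 0 < eps ->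
  exists m : nat, exists U r : R, [/\ (0 < m)%N, 0 <= U, 0 <= r < 1 &
    \forall N \near \oo, exists v : R, forall k : nat,
      1 - U * r ^+ k - 4 * lam ^+ 2 * (k.+1 * m)%:R / N.+1%:R <=
      pr MQ (block_window m k v (2 * eps) N)].
Proof.
move=> eps0; have [m [c [m0 c0 tail]]] := annealed_tail beta0 ab hstat mixing eps0.
pose c' := Num.min c (eps * m%:R).
have c'0 : 0 < c' by rewrite lt_min c0 mulr_gt0// ltr0n.
pose K := expR (lam * (expR 1 - 1) * m%:R).
have K0 : 0 < K by exact: expR_gt0.
exists m, (K + 2), (expR (- c')); split => //.
- by rewrite addr_ge0// ltW.
- by rewrite expR_ge0 -[ltRHS]expR0 ltr_expR oppr_lt0.
have [N0 _ hN0] := tail.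
have [N1 _ hN1] := near_harmonic_lt lam (ltr01 (R := R)).
exists (maxn N0 N1) => // N /=; rewrite geq_max => /andP[/hN0[v hv] /hN1 /= /ltW q1].
exists v => k; have h := pr_window_ge beta0 ab M hQ (m * N.+1) k
  (v * (k * m)%:R) (eps * (k * m)%:R) q1.
rewrite /block_window -[2 * eps * _]mulrA; apply: le_trans h.
have N10 : N.+1%:R != 0 :> R by rewrite pnatr_eq0.
have e1 : 4 * move_prob alpha beta N ^+ 2 * (k * (m * N.+1) + m * N.+1)%:R =
    4 * lam ^+ 2 * (k.+1 * m)%:R / N.+1%:R.
  rewrite /move_prob mulSn natrD !natrM natrD !natrM.
  by move: (N.+1%:R : R) N10 => n n0; field.
have e2 : move_prob alpha beta N * (expR 1 - 1) * (m * N.+1)%:R =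
    lam * (expR 1 - 1) * m%:R.
  rewrite /move_prob natrM.
  by move: (N.+1%:R : R) N10 => n n0; field.
rewrite e1 e2 lerD2r addrC [leRHS]addrC.
have rk : expR (- c') ^+ k = expR (- (c' * k%:R)) by rewrite -expRM_natr mulNr.
have h1 : expR (- (eps * (k * m)%:R) + lam * (expR 1 - 1) * m%:R) <= K * expR (- c') ^+ k.
  rewrite rk expRD mulrC ler_pM2l// ler_expR lerN2 natrM.
  rewrite [leRHS]mulrCA [leRHS]mulrC ler_wpM2r//.
  by rewrite ge_min lexx orbT.
have h2 : 2 * expR (- (c * k%:R)) <= 2 * expR (- c') ^+ k.
  rewrite rk ler_pM2l// ler_expR lerN2 ler_wpM2r//.
  by rewrite ge_min lexx.
have h3 := hv k.
rewrite mulrDl; lra.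
Qed.

(* Contains the event that the walk is outside the window at some time of the
   [k]-th block, by right continuity of the path. *)
Definition escape m k v r : set walk_path :=
  \bigcup_K \bigcap_(N in [set N | (K <= N)%N]) ~` block_window m k v r N.

Lemma measurable_escape m k v r : measurable (escape m k v r).
Proof.
apply: bigcupT_measurable => K; apply: bigcap_measurable; first by exists K => /=.
by move=> N _; apply: measurableC; exact: measurable_block_window.
Qed.

Lemma escapeP m k v r X s : (k * m)%:R <= s < (k.+1 * m)%:R ->
  ~ escape m k v r X ->
  `|(X s : int)%:~R - v * (k * m)%:R| <= r * (k * m)%:R.
Proof.
move=> hs nX; rewrite leNgt; apply/negP => /(block_window_near hs)[K _ hK].
by apply: nX; exists K => // N /= /hK.
Qed.

(** In one fixed block the windows of any two fine grids have probability above one half, so some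
    path lies in both and the velocities differ by at most 4 eps. Each window of relative radius 2
    eps thus lies in the one of radius 6 eps around a fixed [v], and [N] can tend to infinity for
    each [k]. *)
Lemma pr_escape (eps : R) : 0 < eps ->
  exists m : nat, exists U r v : R, [/\ (0 < m)%N, 0 <= U, 0 <= r < 1 &
    forall k : nat, pr MQ (escape m k v (6 * eps)) <= U * r ^+ k].
Proof.
move=> eps0; have [m [U [r [m0 U0 r01 [N0 _ hN0]]]]] := pr_block_window eps0.
exists m, U, r.
have quarter : 0 < 4^-1 :> R by rewrite invr_gt0.
(* Block 0 is excluded: its window has centre and radius 0 whatever the velocity. *)
have [k1 k10 hk1] : exists2 k1 : nat, (0 < k1)%N & U * r ^+ k1 < 4^-1.
  have [k0 _ hk0] := near_geometric_lt U r01 quarter.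
  by exists k0.+1 => //; apply: hk0 => /=.
have [N1 _ hN1] := near_harmonic_lt (4 * lam ^+ 2 * (k1.+1 * m)%:R) quarter.
pose Nm := maxn N0 N1.
have [v hv] := hN0 Nm (leq_maxl _ _).
have half N w : (Nm <= N)%N ->
    1 - U * r ^+ k1 - 4 * lam ^+ 2 * (k1.+1 * m)%:R / N.+1%:R <=
      pr MQ (block_window m k1 w (2 * eps) N) ->
    2^-1 < pr MQ (block_window m k1 w (2 * eps) N).
  move=> NN h; apply: lt_le_trans h.
  have := hN1 N (leq_trans (leq_maxr _ _) NN) => /=.
  move: hk1; move: (U * _) (_ / _) => a b; lra.
have close N : (Nm <= N)%N -> exists w, `|w - v| <= 4 * eps /\ forall k : nat,
      1 - U * r ^+ k - 4 * lam ^+ 2 * (k.+1 * m)%:R / N.+1%:R <=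
      pr MQ (block_window m k w (2 * eps) N).
  move=> NN; have [w hw] := hN0 N (leq_trans (leq_maxl _ _) NN).
  exists w; split => //.
  have mA := measurable_block_window m k1 v (2 * eps) Nm.
  have mB := measurable_block_window m k1 w (2 * eps) N.
  have [X [XA XB]] : block_window m k1 v (2 * eps) Nm `&`
      block_window m k1 w (2 * eps) N !=set0.
    apply/set0P/eqP => AB0.
    have sub : block_window m k1 w (2 * eps) N `<=`
        ~` block_window m k1 v (2 * eps) Nm.
      by apply/disjoints_subset; rewrite setIC.
    have h1 := half Nm v (leqnn _) (hv k1); have h2 := half N w NN (hw k1).
    have := pr_le MQ1 mB (measurableC mA) sub; rewrite (prC MQ1 mA).
    move: h1 h2; move: (pr _ _) (pr _ _) => a b; lra.
  have h1 := block_window_start XA; have h2 := block_window_start XB.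
  have km0 : 0 < (k1 * m)%:R :> R by rewrite ltr0n muln_gt0 k10.
  rewrite -(ler_pM2r km0) -{1}(gtr0_norm km0) -normrM.
  have -> : (w - v) * (k1 * m)%:R =
    ((X (k1 * m)%:R : int)%:~R - v * (k1 * m)%:R) -
    ((X (k1 * m)%:R : int)%:~R - w * (k1 * m)%:R) by ring.
  by apply: le_trans (ler_normB _ _) _; apply: le_trans (lerD h1 h2) _; lra.
exists v; split => // k.
apply: (@pr_liminf _ _ _ _ MQ1 _ (fun N => ~` block_window m k v (6 * eps) N)).
- exact: measurable_escape.
- by move=> N; apply: measurableC; exact: measurable_block_window.
- by move=> X [K _ hK]; exists K => // N /= KN; exact: hK.
move=> e e0.
have [N2 _ hN2] := near_harmonic_lt (4 * lam ^+ 2 * (k.+1 * m)%:R) e0.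
exists (maxn Nm N2) => // N /=; rewrite geq_max => /andP[NN /hN2 /= h2].
have [w [wv hw]] := close N NN.
have mB := measurable_block_window m k w (2 * eps) N.
have mC := measurable_block_window m k v (6 * eps) N.
have sub : block_window m k w (2 * eps) N `<=` block_window m k v (6 * eps) N.
  by apply: block_window_le; lra.
rewrite (prC MQ1 mC); have h3 := pr_le MQ1 mB mC sub; have h4 := hw k.
move: h2 h3 h4; move: (pr _ _) (pr _ _) (U * _) (_ / _) => a b z1 z2; lra.
Qed.

Lemma ae_velocity (eps : R) : 0 < eps -> exists v : R,
  {ae MQ, forall X : walk_path,
    \forall t \near +oo, `|(X t : int)%:~R / t - v| <= eps}.
Proof.
(* Six parts are for the window, one for the change of [v * t] within a block. *)
move=> eps0; have eps7 : 0 < eps / 7 by rewrite divr_gt0.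
have [m [U [r [v [m0 U0 r01 hU]]]]] := pr_escape eps7.
exists v; pose F k := escape m k v (6 * (eps / 7)).
have mF k : measurable (F k) by exact: measurable_escape.
have sumF : (\sum_(k <oo) MQ (F k) < +oo)%E.
  apply: (@le_lt_trans _ _ (U / (1 - r))%:E); last exact: ltry.
  apply: lime_le; first by apply: is_cvg_nneseries => k _ _; exact: measure_ge0.
  apply: nearW => n.
  apply: le_trans (_ : _ <= (\sum_(0 <= k < n) U * r ^+ k)%:E)%E _; last first.
    by rewrite lee_fin; exact: sum_geometric_le.
  rewrite -sumEFin; apply: lee_sum => k _.
  by rewrite (prE MQ1 (mF k)) lee_fin; exact: hU.
exists (lim_sup_set F); split.
- by apply: bigcapT_measurable => n; apply: bigcup_measurable => k _; exact: mF.
- exact: lim_sup_set_cvg0.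
move=> X /= nX; apply: contrapT => nL; apply: nX.
have /existsNP[K /not_implyP[_ hK]] :
    ~ (forall n, True -> (\bigcup_(j in [set j | (n <= j)%N]) F j) X).
  by move=> h; apply: nL => n _; exact: h.
have hesc k : (K <= k)%N -> ~ F k X by move=> Kk Fk; apply: hK; exists k.
pose m' : R := m%:R.
have m'0 : 0 < m' by rewrite ltr0n.
(* Beyond the last escape, and so late that [v] times a block length is at most [eps / 7 * t]. *)
exists (Num.max ((K.+1 * m)%:R) (`|v| * m' / (eps / 7))); split; first exact: num_real.
move=> t; rewrite gt_max => /andP[Kt vt].
have t0 : 0 < t by exact: le_lt_trans Kt.
pose k := Num.truncn (t / m').
have tm0 : 0 <= t / m' by rewrite divr_ge0 ?ltW.
have /andP[k1 k2] := truncn_itv tm0.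
have kt : (k * m)%:R <= t by rewrite natrM -ler_pdivlMr.
have tk : t < (k.+1 * m)%:R by rewrite natrM -ltr_pdivrMr.
have Kk : (K <= k)%N.
  have := lt_trans Kt tk; rewrite ltr_nat ltn_mul2r m0 /= ltnS; exact: ltnW.
have h : `|(X t : int)%:~R - v * (k * m)%:R| <= 6 * (eps / 7) * (k * m)%:R.
  by apply: escapeP (hesc k Kk); rewrite kt.
have tkm : `|v * ((k * m)%:R - t)| <= eps / 7 * t.
  rewrite normrM; have h1 : `|(k * m)%:R - t| <= m'.
    rewrite ler0_norm ?subr_le0// opprB lerBlDr ltW//.
    by move: tk; rewrite mulSn natrD.
  apply: le_trans (ler_wpM2l (normr_ge0 _) h1) _.
  by rewrite mulrC [leRHS]mulrC -ler_pdivrMr// ltW// mulrC.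
have -> : (X t : int)%:~R / t - v =
    (((X t : int)%:~R - v * (k * m)%:R) + v * ((k * m)%:R - t)) / t.
  by field; rewrite lt0r_neq0.
rewrite normrM normfV (gtr0_norm t0) ler_pdivrMr//.
apply: le_trans (ler_normD _ _) _; apply: le_trans (lerD h tkm) _.
have : 6 * (eps / 7) * (k * m)%:R <= 6 * (eps / 7) * t.
  by rewrite ler_wpM2l// mulr_ge0// ltW.
lra.
Qed.

(** One path that satisfies the almost sure bounds for all precisions shows that the intervals of
    radius [dl j] around [v j] intersect pairwise; the supremum of their left ends lies in all of
    them and is the velocity. *)
Lemma ae_convergence : exists v : R, {ae MQ, forall X : walk_path,
  ((X t : int)%:~R / t : R) @[t --> +oo] --> v}.
Proof.
pose dl j : R := j.+1%:R^-1.
have dl0 j : 0 < dl j by rewrite invr_gt0.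
have /choice[v hv] : forall j, exists v : R, {ae MQ, forall X : walk_path,
    \forall t \near +oo, `|(X t : int)%:~R / t - v| <= dl j}.
  by move=> j; exact: ae_velocity.
have /ae_foralln hall := hv.
have [X0 hX0] : exists X : walk_path, forall j,
    \forall t \near +oo, `|(X t : int)%:~R / t - v j| <= dl j.
  apply: contrapT => /forallNP none.
  have : MQ.-negligible setT.
    by apply: negligibleS hall => X _ /=; exact: none.
  move=> /negligibleP => /(_ measurableT) h.
  have h0 : MQ setT = 0%E by exact: h.
  by have := MQ1; rewrite h0 => /eqP; rewrite eq_sym onee_eq0.
have vv i j : v i - dl i <= v j + dl j.
  have [t [h1 h2]] : exists t, `|(X0 t : int)%:~R / t - v i| <= dl i /\
      `|(X0 t : int)%:~R / t - v j| <= dl j.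
    by have [t] := @filter_ex _ _ _ _ (filterI (hX0 i) (hX0 j)); exists t.
  by move: h1 h2; rewrite !ler_norml => /andP[? ?] /andP[? ?]; lra.
pose S := range (fun j => v j - dl j).
have supS : has_sup S.
  split; first by exists (v 0%N - dl 0%N), 0%N.
  by exists (v 0%N + dl 0%N) => _ [j _ <-]; exact: vv.
pose vlim := sup S.
have vl j : `|vlim - v j| <= dl j.
  have h1 : v j - dl j <= vlim by apply: ub_le_sup; [exact: supS.2|exists j].
  have h2 : vlim <= v j + dl j.
    by apply: ge_sup; [exact: supS.1|move=> _ [i _ <-]; exact: vv].
  by rewrite ler_norml; apply/andP; split; lra.
exists vlim; apply: filterS hall => X hX.
apply/cvgrPdist_le => e e0.
have e2 : 0 < e / 2 by rewrite divr_gt0.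
have [j _ hj] := near_harmonic_lt 1 e2.
have dj : dl j < e / 2 by have := hj j (leqnn j); rewrite /= div1r.
apply: filterS (hX j) => t ht.
have -> : vlim - (X t : int)%:~R / t = (vlim - v j) - ((X t : int)%:~R / t - v j) by ring.
apply: le_trans (ler_normB _ _) _; have := vl j; lra.
Qed.

End velocity.

Lemma cone_mixing_decorrelated (R : realType)
    (P : R.-pker config ~> cadlag_path R config) (mu : probability config R) :
  interacting_particle_system P -> stationary (mixture mu P) ->
  cone_mixing (mixture mu P) ->
  forall V phi : R, 0 < V -> 0 < phi ->
  \forall L \near \oo, cone_decorrelated (mixture mu P) (atan V) L%:R phi.
Proof.
move=> hP hstat hmix V phi V0 phi0.
have theta0 : 0 < atan V < pi / 2 by rewrite atan_ltpi2 -(atan0 R) lt_atan.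
(* Half of [phi], because [cone_decorrelation] doubles the mixing bound. *)
have phi2 : 0 < phi / 2 by rewrite divr_gt0.
have : \forall t \near +oo,
    (cone_dependence (mixture mu P) (atan V) t < (phi / 2)%:E)%E.
  apply: (hmix _ theta0 [set e | (e < (phi / 2)%:E)%E]).
  by apply: open_ereal_lt'; rewrite lte_fin.
move=> [A [_ hA]].
exists (Num.bound `|A|) => // L /= AL.
have {}AL : A < L%:R.
  apply: le_lt_trans (ler_norm A) _; apply: lt_le_trans (archi_boundP (normr_ge0 A)) _.
  by rewrite ler_nat.
rewrite (_ : phi = 2 * (phi / 2)); last by field.
by apply: cone_decorrelation => //; apply: ltW; exact: hA.
Qed.

Theorem theorem1 (R : realType)
    (P : R.-pker config ~> cadlag_path R config) (mu : probability config R)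
    (alpha beta : R) (Q : R.-pker cadlag_path R config ~> cadlag_path R Zdiscr)
    (hP : interacting_particle_system P)
    (hbeta : 0 < beta) (hab : beta < alpha)
    (hQ : quenched_walk alpha beta Q)
    (hstat : stationary (mixture mu P))
    (herg : ergodic (mixture mu P))
    (hmix : cone_mixing (mixture mu P)) :
  exists v : R, {ae mixture (mixture mu P) Q,
    forall X : cadlag_path R Zdiscr,
      ((X t : int)%:~R / t : R) @[t --> +oo] --> v}.
Proof.
have := ae_convergence hbeta hab hQ hstat (cone_mixing_decorrelated hP hstat hmix).
exact.
Qed.
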